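(* Let $p,q,r,u,v\in\mathbb{N}$. Then for all $s\in\mathbb{C}$ except singularities of the functions on the left-hand side, $$\begin{aligned}&\zeta_2(p,s,q,r,u,v;G_2)+(-1)^p\zeta_2(p,q,s,r,v,u;G_2)+(-1)^{p+q}\zeta_2(v,q,r,s,p,u;G_2)\\&+(-1)^{p+q+v}\zeta_2(v,r,q,s,u,p;G_2)+(-1)^{p+q+r+v}\zeta_2(u,r,s,q,v,p;G_2)\\&+(-1)^{p+q+r+u+v}\zeta_2(u,s,r,q,p,v;G_2)+I_1+I_2+\cdots+I_8=0,\end{aligned}$$ where $I_j=A_j+B_{1j}+B_{2j}$ ($1\le j\le8$) with, writing $N=s+p+q+r+u+v$, $$A_j=2(-1)^{p+a_1}\sum_{k=0}^{[a_2/2]}\zeta(2k)\sum_{\sigma=0}^{a_2-2k}\binom{\sigma+v-1}{\sigma}\sum_{\rho=0}^{a_3-a_4}\binom{\rho+u-a_5}{\rho}\sum_{\omega=0}^{a_6-a_7}\binom{\omega+r-a_8}{\omega}\binom{p+q-1-\omega-a_7}{a_9-1}(-1)^{a_{10}}2^{a_{11}}3^{a_{12}}\zeta(N-2k),$$ $$B_{1j}=2(-1)^{p+b_1}\sum_{k=0}^{[v/2]}2^{-2k}\zeta(2k)\sum_{\sigma=0}^{a_2-1}\binom{\sigma+v-2k}{\sigma}\sum_{\rho=0}^{a_3-b_4}\binom{\rho+u-b_5}{\rho}\sum_{\omega=0}^{a_6-b_7}\binom{\omega+r-b_8}{\omega}\binom{p+q-1-\omega-b_7}{a_9-1}(-1)^{a_{10}}2^{b_{11}}3^{b_{12}}\{\zeta(N-2k)+\phi(N-2k)\},$$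 $$B_{2j}=2(-1)^{p+b_1}\sum_{k=0}^{[(v+1)/2]}(1-2^{-2k})\zeta(2k)\sum_{\sigma=0}^{a_2-1}\binom{\sigma+v-2k}{\sigma}\sum_{\rho=0}^{a_3-b_4}\binom{\rho+u-b_5}{\rho}\sum_{\omega=0}^{a_6-b_7}\binom{\omega+r-b_8}{\omega}\binom{p+q-1-\omega-b_7}{a_9-1}(-1)^{a_{10}}2^{b_{11}}3^{b_{12}}\{\zeta(N-2k)-\phi(N-2k)\},$$ and where, for $j=1,\dots,8$ respectively (listed in order $j=1,2,\dots,8$): $a_1=1,v+1,1,v,v+1,v,v,v+1$; $a_2=p,u,q,u,r,u,r,u$; $a_3=p,p,q,q,r,r,r,r$; $a_4=2k+\sigma,1,2k+\sigma,1,2k+\sigma,1,2k+\sigma,1$; $a_5=1,2k+\sigma,1,2k+\sigma,1,2k+\sigma,1,2k+\sigma$; $a_6=p,p,q,q,p,p,q,q$; $a_7=2k+\sigma+\rho,1+\rho,2k+\sigma+\rho,1+\rho,1,1,1,1$; $a_8=1,1,1,1,2k+\sigma+\rho,1+\rho,2k+\sigma+\rho,1+\rho$; $a_9=q,q,p,p,q,q,p,p$; $a_{10}=0,0,\sigma+\rho+\omega,\rho+\omega,\rho,\rho,\rho+\omega,\rho+\omega$; $a_{11}=\sigma-r-\omega,\ \sigma-r-\omega,\ \sigma-u-\rho,\ -u+2k+2\sigma-\rho-1,\ -r+2k+2\sigma+\rho-\omega-1,\ -r+\sigma+\rho-\omega,\ \sigma,\ \sigma$; $a_{12}=-u-v-\sigma-\rho,\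 -u-v+2k-\rho-1,\ 0,\ -v-\sigma,\ 0,\ -v-\sigma,\ 0,\ -v-\sigma$; $b_1=1,v+1,0,v,v+1,v,v,v+1$; $b_4=1+\sigma,1,1+\sigma,1,1+\sigma,1,1+\sigma,1$; $b_5=1,1+\sigma,1,1+\sigma,1,1+\sigma,1,1+\sigma$; $b_7=1+\sigma+\rho,1+\rho,1+\sigma+\rho,1+\rho,1,1,1,1$; $b_8=1,1,1,1,1+\sigma+\rho,1+\rho,1+\sigma+\rho,1+\rho$; $b_{11}=\sigma-r-\omega,\ \sigma-r-\omega,\ \sigma-u-\rho,\ -u+2\sigma-\rho,\ -r+2\sigma+\rho-\omega,\ -r+\sigma+\rho-\omega,\ \sigma,\ \sigma$; $b_{12}=-u-v+2k-\sigma-\rho-1,\ -u-v+2k-\rho-1,\ 0,\ -v+2k-\sigma-1,\ 0,\ -v+2k-\sigma-1,\ 0,\ -v+2k-\sigma-1$.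
   Context: The zeta-function of the root system $G_2$ is $$\zeta_2(s_1,\dots,s_6;G_2)=\sum_{m,n\geq1}\frac{1}{m^{s_1}n^{s_2}(m+n)^{s_3}(m+2n)^{s_4}(m+3n)^{s_5}(2m+3n)^{s_6}},$$ absolutely convergent when all $\Re s_j>1$ and continued meromorphically in $s$ (here as functions of the single variable $s$ with the other arguments fixed positive integers). $\zeta$ is the Riemann zeta-function (so $\zeta(0)=-1/2$), $\phi(s)=(2^{1-s}-1)\zeta(s)$, and $[x]$ denotes the integer part. *)

(* Defs.v *)
From Stdlib Require Import Reals ZArith ClassicalEpsilon.
From Coquelicot Require Import Coquelicot.

Coercion Z.of_nat : nat >-> Z.

Definition analytic_at (F : C -> C) (z0 : C) : Prop :=
  exists a : nat -> C,
    locally z0 (fun z : C =>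
      @is_pseries C_AbsRing C_NormedModule a (Cminus z z0) (F z)).

(* The order of the pole is [S m]; the value [F z0] is irrelevant. *)
Definition pole_at (F : C -> C) (z0 : C) : Prop :=
  exists (m : nat) (g : C -> C),
    analytic_at g z0 /\ g z0 <> RtoC 0 /\
    locally z0 (fun z : C =>
      z <> z0 -> F z = Cdiv (g z) (Cpow (Cminus z z0) (S m))).

(* Removable singularities are not allowed, so that two continuations of the
   same function have the same poles and agree everywhere else. *)
Definition is_continuation (f F : C -> C) : Prop :=
  (forall z0 : C, analytic_at F z0 \/ pole_at F z0) /\
  (forall s : C, (1 < Re s)%R -> F s = f s).

(* The meromorphic continuation to the whole plane of a function [f] given on
   the half-plane [1 < Re s]. *)
Definition continuation (f : C -> C) : C -> C :=
  epsilon (inhabits (fun _ : C => RtoC 0)) (is_continuation f).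

(* [s] belongs to the domain of the continued function: [f] has a meromorphic
   continuation, and [s] is not one of its singularities. *)
Definition regular_at (f : C -> C) (s : C) : Prop :=
  is_continuation f (continuation f) /\ analytic_at (continuation f) s.

Definition Cexp (z : C) : C :=
  ((exp (Re z) * cos (Im z))%R, (exp (Re z) * sin (Im z))%R).

(* [x ^ s] for real [x > 0], with the real logarithm. *)
Definition rcpow (x : R) (s : C) : C := Cexp (s * RtoC (ln x))%C.

Definition CSeries (a : nat -> C) : C :=
  (Series (fun n => Re (a n)), Series (fun n => Im (a n))).

Definition zeta_series (s : C) : C :=
  CSeries (fun n => / rcpow (INR (S n)) s)%C.

(* The iterated sum is the double sum wherever the latter converges absolutely;
   when all variables but one are fixed positive integers, this is the case as
   soon as the remaining variable has real part greater than 1. *)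
Definition zeta2_G2_series (s1 s2 s3 s4 s5 s6 : C) : C :=
  CSeries (fun m' => CSeries (fun n' =>
    let m := INR (S m') in
    let n := INR (S n') in
    / (rcpow m s1 * rcpow n s2 * rcpow (m + n) s3 * rcpow (m + 2 * n) s4
       * rcpow (m + 3 * n) s5 * rcpow (2 * m + 3 * n) s6))%C).

Definition zeta : C -> C := continuation zeta_series.

Definition phi (s : C) : C := ((rcpow 2 (1 - s) - 1) * zeta s)%C.

Definition zsum (n : Z) (f : nat -> C) : C :=
  if (n <? 0)%Z then RtoC 0 else sum_n f (Z.to_nat n).

(* x (x - 1) ... (x - k + 1) / k!, with an integer upper entry: in [termB2] the
   entry [sigma + v - 2k] equals -1 when [sigma = 0] and [2k = v + 1]. *)
Fixpoint binom (x : Z) (k : nat) : R :=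
  match k with
  | O => 1%R
  | S k' => (binom x k' * IZR (x - k') / INR (S k'))%R
  end.

Definition sgn (n : Z) : R := powerRZ (-1) n.

Definition pick (j : nat) (x1 x2 x3 x4 x5 x6 x7 x8 : Z) : Z :=
  match j with
  | 1%nat => x1 | 2%nat => x2 | 3%nat => x3 | 4%nat => x4
  | 5%nat => x5 | 6%nat => x6 | 7%nat => x7 | _ => x8
  end.

(* The parameters of [I_j], for [j = 1, ..., 8]; the arguments of each are the
   quantities among p, q, r, u, v, k, sigma, rho, omega on which it depends. *)

Definition a1 (v : nat) (j : nat) : Z :=
  (pick j 1 (v + 1) 1 v (v + 1) v v (v + 1))%Z.
Definition a2 (p q r u : nat) (j : nat) : Z :=
  (pick j p u q u r u r u)%Z.
Definition a3 (p q r : nat) (j : nat) : Z :=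
  (pick j p p q q r r r r)%Z.
Definition a4 (k sigma : nat) (j : nat) : Z :=
  (pick j (2 * k + sigma) 1 (2 * k + sigma) 1 (2 * k + sigma) 1
          (2 * k + sigma) 1)%Z.
Definition a5 (k sigma : nat) (j : nat) : Z :=
  (pick j 1 (2 * k + sigma) 1 (2 * k + sigma) 1 (2 * k + sigma) 1
          (2 * k + sigma))%Z.
Definition a6 (p q : nat) (j : nat) : Z :=
  (pick j p p q q p p q q)%Z.
Definition a7 (k sigma rho : nat) (j : nat) : Z :=
  (pick j (2 * k + sigma + rho) (1 + rho) (2 * k + sigma + rho) (1 + rho)
          1 1 1 1)%Z.
Definition a8 (k sigma rho : nat) (j : nat) : Z :=
  (pick j 1 1 1 1 (2 * k + sigma + rho) (1 + rho) (2 * k + sigma + rho)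
          (1 + rho))%Z.
Definition a9 (p q : nat) (j : nat) : Z :=
  (pick j q q p p q q p p)%Z.
Definition a10 (sigma rho omega : nat) (j : nat) : Z :=
  (pick j 0 0 (sigma + rho + omega) (rho + omega) rho rho (rho + omega)
          (rho + omega))%Z.
Definition a11 (r u k sigma rho omega : nat) (j : nat) : Z :=
  (pick j (sigma - r - omega) (sigma - r - omega) (sigma - u - rho)
          (- u + 2 * k + 2 * sigma - rho - 1)
          (- r + 2 * k + 2 * sigma + rho - omega - 1)
          (- r + sigma + rho - omega) sigma sigma)%Z.
Definition a12 (u v k sigma rho : nat) (j : nat) : Z :=
  (pick j (- u - v - sigma - rho) (- u - v + 2 * k - rho - 1) 0
          (- v - sigma) 0 (- v - sigma) 0 (- v - sigma))%Z.

Definition b1 (v : nat) (j : nat) : Z :=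
  (pick j 1 (v + 1) 0 v (v + 1) v v (v + 1))%Z.
Definition b4 (sigma : nat) (j : nat) : Z :=
  (pick j (1 + sigma) 1 (1 + sigma) 1 (1 + sigma) 1 (1 + sigma) 1)%Z.
Definition b5 (sigma : nat) (j : nat) : Z :=
  (pick j 1 (1 + sigma) 1 (1 + sigma) 1 (1 + sigma) 1 (1 + sigma))%Z.
Definition b7 (sigma rho : nat) (j : nat) : Z :=
  (pick j (1 + sigma + rho) (1 + rho) (1 + sigma + rho) (1 + rho) 1 1 1 1)%Z.
Definition b8 (sigma rho : nat) (j : nat) : Z :=
  (pick j 1 1 1 1 (1 + sigma + rho) (1 + rho) (1 + sigma + rho) (1 + rho))%Z.
Definition b11 (r u sigma rho omega : nat) (j : nat) : Z :=
  (pick j (sigma - r - omega) (sigma - r - omega) (sigma - u - rho)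
          (- u + 2 * sigma - rho) (- r + 2 * sigma + rho - omega)
          (- r + sigma + rho - omega) sigma sigma)%Z.
Definition b12 (u v k sigma rho : nat) (j : nat) : Z :=
  (pick j (- u - v + 2 * k - sigma - rho - 1) (- u - v + 2 * k - rho - 1)
          0 (- v + 2 * k - sigma - 1) 0 (- v + 2 * k - sigma - 1) 0
          (- v + 2 * k - sigma - 1))%Z.

Definition weight (p q r u v : nat) (s : C) (k : nat) : C :=
  (s + INR p + INR q + INR r + INR u + INR v - 2 * INR k)%C.

Definition zeta_even (k : nat) : C := zeta (2 * INR k)%C.

Definition termA (p q r u v : nat) (s : C) (j : nat) : C :=
  (2 * sgn (p + a1 v j) *
   zsum (a2 p q r u j / 2) (fun k => zeta_even k *
   zsum (a2 p q r u j - 2 * k) (fun sigma => binom (sigma + v - 1) sigma *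
   zsum (a3 p q r j - a4 k sigma j) (fun rho =>
     binom (rho + u - a5 k sigma j) rho *
   zsum (a6 p q j - a7 k sigma rho j) (fun omega =>
     binom (omega + r - a8 k sigma rho j) omega *
     binom (p + q - 1 - omega - a7 k sigma rho j) (Z.to_nat (a9 p q j - 1)) *
     sgn (a10 sigma rho omega j) *
     powerRZ 2 (a11 r u k sigma rho omega j) *
     powerRZ 3 (a12 u v k sigma rho j) *
     zeta (weight p q r u v s k))))))%C.

Definition termB1 (p q r u v : nat) (s : C) (j : nat) : C :=
  (2 * sgn (p + b1 v j) *
   zsum (v / 2) (fun k => powerRZ 2 (- (2 * k)) * zeta_even k *
   zsum (a2 p q r u j - 1) (fun sigma => binom (sigma + v - 2 * k) sigma *
   zsum (a3 p q r j - b4 sigma j) (fun rho =>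
     binom (rho + u - b5 sigma j) rho *
   zsum (a6 p q j - b7 sigma rho j) (fun omega =>
     binom (omega + r - b8 sigma rho j) omega *
     binom (p + q - 1 - omega - b7 sigma rho j) (Z.to_nat (a9 p q j - 1)) *
     sgn (a10 sigma rho omega j) *
     powerRZ 2 (b11 r u sigma rho omega j) *
     powerRZ 3 (b12 u v k sigma rho j) *
     (zeta (weight p q r u v s k) + phi (weight p q r u v s k)))))))%C.

Definition termB2 (p q r u v : nat) (s : C) (j : nat) : C :=
  (2 * sgn (p + b1 v j) *
   zsum ((v + 1) / 2) (fun k => (1 - powerRZ 2 (- (2 * k))) * zeta_even k *
   zsum (a2 p q r u j - 1) (fun sigma => binom (sigma + v - 2 * k) sigma *
   zsum (a3 p q r j - b4 sigma j) (fun rho =>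
     binom (rho + u - b5 sigma j) rho *
   zsum (a6 p q j - b7 sigma rho j) (fun omega =>
     binom (omega + r - b8 sigma rho j) omega *
     binom (p + q - 1 - omega - b7 sigma rho j) (Z.to_nat (a9 p q j - 1)) *
     sgn (a10 sigma rho omega j) *
     powerRZ 2 (b11 r u sigma rho omega j) *
     powerRZ 3 (b12 u v k sigma rho j) *
     (zeta (weight p q r u v s k) - phi (weight p q r u v s k)))))))%C.

Definition I_sum (p q r u v : nat) (s : C) (j : nat) : C :=
  (termA p q r u v s j + termB1 p q r u v s j + termB2 p q r u v s j)%C.

(* The largest index [k] for which [zeta (weight p q r u v s k)] occurs in one
   of the [I_j]. *)
Definition kmax (p q r u v : nat) : nat :=
  (Nat.max (Nat.max (Nat.max (p / 2) (q / 2)) (Nat.max (r / 2) (u / 2)))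
     ((v + 1) / 2))%nat.

(* Main.v *)
(** Let [N] be the linear form carrying [s].  Summed first over the other
    variable, the six series are, up to sign, the sums over the six intervals of
    [m : Z] cut out by the poles of
      [R(m) = 1 / (m^p (m+N)^q (m+2N)^r (m+3N)^u (2m+3N)^v)],
    so that their signed sum is the sum over [N >= 1] of [N^(-s)] times the sum
    of [R] over the integers that are not poles.  Splitting off the factors of
    [R] one at a time gives sixteen families of partial fractions: those at
    [0, -N, -2N, -3N] yield the eight [A_j], those at [-3N/2] the eight [B_j].
    Each simple family sums to even zeta values.  With [1 / 0 = 0], the
    decomposition also holds at the poles provided that a family takes there
    the value minus its constant term; this is the term [k = 0], as
    [zeta(0) = -1/2].  When [N] is odd, [-3N/2] is a half-integer, whence the
    factor [2^(2k) - 1] and the two combinations of [zeta] and [phi].  The terms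
    [2k = v + 1] of the [B_2j] add up to a sum of residues, which vanishes.

    The identity so obtained for [Re s >= 2] is continued along a segment,
    on which all the functions are quotients of power series in one real
    variable.  The value of [zeta] at 0 follows from the second differences of
    the alternating zeta series, which converge down to [s = 0]. *)
Require Import Defs.
From Stdlib Require Import Reals ZArith Lra Lia ClassicalEpsilon.
From Coquelicot Require Import Coquelicot.

Open Scope R_scope.

(** * Finite sums and double series *)

(** The segment leading to [s] may run through poles, for instance of the functions
    [zeta (weight ...)], where the value of a continuation is arbitrary. Uniqueness is therefore
    proved for germs on punctured neighbourhoods; only at the endpoint is analyticity needed. Real
    and imaginary parts are treated separately, so real power series suffice. The substitution
    [z = N t] fixes all poles and makes the coefficients of the partial fractions independent of
    [N]; what is left are powers of [N], which combine with [N ^ (- s)] into [zeta (weight ...)]. A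
    pole of order 1 is not absolutely summable over the integers. All families are summed over the
    windows [- 3 N - M <= z <= M], which are symmetric about [- 3 N / 2]; about the other poles the
    asymmetry is bounded and disappears in the limit. The values at the poles are forced: there the
    product vanishes by [/ 0 = 0], while the families belonging to the other poles add up to its
    constant term. Families sharing a pole are not merged, because each successive splitting
    produces one of the nested binomial sums of the [I_j]. *)

Fixpoint rsum (n : nat) (f : nat -> R) : R :=
  match n with O => 0 | S n' => rsum n' f + f n' end.

Lemma rsum_ext n f g :
  (forall i, (i < n)%nat -> f i = g i) -> rsum n f = rsum n g.
Proof.
  induction n as [|n IH]; intros H; simpl; [easy|].
  rewrite IH by (intros; apply H; lia). now rewrite H by lia.
Qed.

Lemma rsum_zero n f : (forall i, (i < n)%nat -> f i = 0) -> rsum n f = 0.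
Proof.
  induction n as [|n IH]; intros H; simpl; [easy|].
  rewrite IH by (intros; apply H; lia). rewrite H by lia. ring.
Qed.

Lemma rsum_plus n f g :
  rsum n (fun i => f i + g i) = rsum n f + rsum n g.
Proof. induction n as [|n IH]; simpl; [ring|rewrite IH; ring]. Qed.

Lemma rsum_minus n f g :
  rsum n (fun i => f i - g i) = rsum n f - rsum n g.
Proof. induction n as [|n IH]; simpl; [ring|rewrite IH; ring]. Qed.

Lemma rsum_scal_l n c f : rsum n (fun i => c * f i) = c * rsum n f.
Proof. induction n as [|n IH]; simpl; [ring|rewrite IH; ring]. Qed.

Lemma rsum_scal_r n c f : rsum n (fun i => f i * c) = rsum n f * c.
Proof. induction n as [|n IH]; simpl; [ring|rewrite IH; ring]. Qed.

Lemma rsum_le n f g :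
  (forall i, (i < n)%nat -> f i <= g i) -> rsum n f <= rsum n g.
Proof.
  induction n as [|n IH]; intros H; simpl; [lra|].
  assert (f n <= g n) by (apply H; lia).
  assert (rsum n f <= rsum n g) by (apply IH; intros; apply H; lia). lra.
Qed.

Lemma rsum_nonneg n f :
  (forall i, (i < n)%nat -> 0 <= f i) -> 0 <= rsum n f.
Proof.
  intros H. rewrite <- (rsum_zero n (fun _ => 0)) by easy. now apply rsum_le.
Qed.

Lemma rsum_app n m f :
  rsum (n + m) f = rsum n f + rsum m (fun i => f (n + i)%nat).
Proof.
  induction m as [|m IH]; simpl.
  - rewrite Nat.add_0_r; ring.
  - rewrite Nat.add_succ_r; simpl. rewrite IH; ring.
Qed.

Lemma rsum_first n f : rsum (S n) f = f 0%nat + rsum n (fun i => f (S i)).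
Proof. change (S n) with (1 + n)%nat. rewrite rsum_app. simpl. ring. Qed.

Lemma rsum_swap n m (f : nat -> nat -> R) :
  rsum n (fun i => rsum m (f i)) = rsum m (fun j => rsum n (fun i => f i j)).
Proof.
  induction n as [|n IH]; simpl.
  - symmetry; now apply rsum_zero.
  - now rewrite IH, rsum_plus.
Qed.

Lemma rsum_rev n f : rsum n f = rsum n (fun i => f (n - 1 - i)%nat).
Proof.
  revert f; induction n as [|n IH]; intros f; [easy|].
  rewrite rsum_first, (IH (fun i => f (S i))). cbn [rsum].
  replace (S n - 1 - n)%nat with 0%nat by lia. rewrite Rplus_comm. f_equal.
  apply rsum_ext. intros i Hi. f_equal. lia.
Qed.

Lemma sum_n_rsum (f : nat -> R) n : sum_n f n = rsum (S n) f.
Proof.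
  induction n as [|n IH].
  - rewrite sum_O. simpl. ring.
  - rewrite sum_Sn, IH. reflexivity.
Qed.

Lemma sum_f_R0_rsum f n : sum_f_R0 f n = rsum (S n) f.
Proof. now rewrite <- sum_n_Reals, sum_n_rsum. Qed.

Lemma is_series_rsum (a : nat -> R) (l : R) :
  is_series a l <-> is_lim_seq (fun n => rsum n a) l.
Proof.
  split; intros H.
  - apply is_lim_seq_incr_1.
    apply is_lim_seq_ext with (sum_n a); [|exact H].
    intros n; apply sum_n_rsum.
  - apply is_lim_seq_incr_1 in H.
    apply (is_lim_seq_ext _ (sum_n a)) in H; [exact H|].
    intros n; now rewrite sum_n_rsum.
Qed.

Lemma Series_is_lim_rsum (a : nat -> R) :
  ex_series a -> is_lim_seq (fun n => rsum n a) (Series a).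
Proof. intros H. now apply is_series_rsum, Series_correct. Qed.

Lemma rsum_le_Series a n :
  (forall i, 0 <= a i) -> ex_series a -> rsum n a <= Series a.
Proof.
  intros Ha Hs.
  apply (is_lim_seq_le_loc (fun _ => rsum n a) (fun m => rsum m a)
           (rsum n a) (Series a)).
  - exists n. intros m Hm. replace m with (n + (m - n))%nat by lia.
    rewrite rsum_app.
    assert (0 <= rsum (m - n) (fun i => a (n + i)%nat))
      by (apply rsum_nonneg; intros; apply Ha). lra.
  - apply is_lim_seq_const.
  - now apply Series_is_lim_rsum.
Qed.

Lemma term_le_Series a n :
  (forall i, 0 <= a i) -> ex_series a -> a n <= Series a.
Proof.
  intros Ha Hs. apply Rle_trans with (rsum (S n) a); [|now apply rsum_le_Series].
  simpl. assert (0 <= rsum n a) by (apply rsum_nonneg; intros; apply Ha). lra.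
Qed.

Lemma Series_le_bound a M :
  ex_series a -> (forall n, rsum n a <= M) -> Series a <= M.
Proof.
  intros Hs H.
  apply (is_lim_seq_le (fun m => rsum m a) (fun _ => M) (Series a) M);
    [exact H|now apply Series_is_lim_rsum|apply is_lim_seq_const].
Qed.

Lemma ex_series_bound a M :
  (forall i, 0 <= a i) -> (forall n, rsum n a <= M) -> ex_series a.
Proof.
  intros Ha H.
  destruct (ex_finite_lim_seq_incr (fun n => rsum n a) M) as [l Hl].
  - intros n; simpl. specialize (Ha n). lra.
  - exact H.
  - exists l. now apply is_series_rsum.
Qed.

Lemma ex_series_le_R (a b : nat -> R) :
  (forall n, Rabs (a n) <= b n) -> ex_series b -> ex_series a.
Proof. intros H Hb. now apply (ex_series_le a b). Qed.

Lemma ex_series_plus_R (a b : nat -> R) :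
  ex_series a -> ex_series b -> ex_series (fun n => a n + b n).
Proof. intros Ha Hb. apply (ex_series_plus a b Ha Hb). Qed.

Lemma ex_series_minus_R (a b : nat -> R) :
  ex_series a -> ex_series b -> ex_series (fun n => a n - b n).
Proof. intros Ha Hb. apply (ex_series_minus a b Ha Hb). Qed.

Lemma ex_series_scal_l_R (c : R) (a : nat -> R) :
  ex_series a -> ex_series (fun n => c * a n).
Proof. intros Ha. apply (ex_series_scal c a Ha). Qed.

Lemma ex_series_zero : ex_series (fun _ : nat => 0).
Proof. apply (ex_series_bound _ 0); [intros; lra|]. intros n. now rewrite rsum_zero; [lra|]. Qed.

Lemma Series_zero : Series (fun _ : nat => 0) = 0.
Proof.
  apply is_series_unique, is_series_rsum.
  apply is_lim_seq_ext with (fun _ => 0); [|apply is_lim_seq_const].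
  intros n. now rewrite rsum_zero.
Qed.

Lemma rsum_Series m (f : nat -> nat -> R) :
  (forall i, (i < m)%nat -> ex_series (f i)) ->
  ex_series (fun n => rsum m (fun i => f i n)) /\
  Series (fun n => rsum m (fun i => f i n)) = rsum m (fun i => Series (f i)).
Proof.
  induction m as [|m IH]; intros H; simpl.
  - split; [apply ex_series_zero|apply Series_zero].
  - destruct IH as [E1 E2]; [intros; apply H; lia|].
    split; [apply ex_series_plus_R; [exact E1|apply H; lia]|].
    rewrite Series_plus, E2; [easy|exact E1|apply H; lia].
Qed.

(** * Interchange of the order of summation *)

Section Fubini.
Variable v : nat -> nat -> R.
Hypothesis v_ge0 : forall k n, 0 <= v k n.
Hypothesis rows : forall k, ex_series (v k).
Hypothesis total : ex_series (fun k => Series (v k)).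

Lemma column_ex n : ex_series (fun k => v k n).
Proof.
  apply (ex_series_le_R _ (fun k => Series (v k))); [|exact total].
  intros k. rewrite Rabs_pos_eq by apply v_ge0.
  now apply (term_le_Series (v k) n).
Qed.

(** Finitely many columns may be added row by row, and each row then contributes at most its full
    sum. *)
Lemma column_partial n :
  rsum n (fun j => Series (fun k => v k j)) <= Series (fun k => Series (v k)).
Proof.
  destruct (rsum_Series n (fun j k => v k j)) as [_ E].
  { intros; apply column_ex. }
  rewrite <- E. apply Series_le; [|exact total].
  intros k. split.
  - apply rsum_nonneg; intros; apply v_ge0.
  - apply rsum_le_Series; [apply v_ge0|apply rows].
Qed.

Lemma Series_nonneg a : (forall n, 0 <= a n) -> ex_series a -> 0 <= Series a.
Proof.
  intros H E. apply Rle_trans with (a 0%nat); [apply H|now apply term_le_Series].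
Qed.

Lemma column_total : ex_series (fun n => Series (fun k => v k n)).
Proof.
  apply (ex_series_bound _ (Series (fun k => Series (v k)))).
  - intros n. apply Series_nonneg; [intros; apply v_ge0|apply column_ex].
  - apply column_partial.
Qed.

Lemma column_le :
  Series (fun n => Series (fun k => v k n)) <= Series (fun k => Series (v k)).
Proof. apply Series_le_bound; [apply column_total|apply column_partial]. Qed.
End Fubini.

(** The inequality [column_le], applied to [v] and to its transpose. *)
Lemma Fubini_nonneg (v : nat -> nat -> R) :
  (forall k n, 0 <= v k n) -> (forall k, ex_series (v k)) ->
  ex_series (fun k => Series (v k)) ->
  Series (fun n => Series (fun k => v k n)) = Series (fun k => Series (v k)).
Proof.
  intros H0 H1 H2. apply Rle_antisym.
  - now apply column_le.
  - apply (column_le (fun n k => v k n)).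
    + intros; apply H0.
    + intros n. now apply column_ex.
    + now apply column_total.
Qed.

Lemma Fubini_abs (u v : nat -> nat -> R) :
  (forall k n, Rabs (u k n) <= v k n) -> (forall k, ex_series (v k)) ->
  ex_series (fun k => Series (v k)) ->
  ex_series (fun k => Series (u k)) /\
  ex_series (fun n => Series (fun k => u k n)) /\
  Series (fun n => Series (fun k => u k n)) = Series (fun k => Series (u k)).
Proof.
  intros H0 H1 H2.
  assert (Hv : forall k n, 0 <= v k n).
  { intros k n. apply Rle_trans with (2 := H0 k n), Rabs_pos. }
  assert (Hu : forall k n, - v k n <= u k n <= v k n).
  { intros k n. apply Rabs_le_between, H0. }
  assert (Eu : forall k, ex_series (u k)).
  { intros k. apply (ex_series_le_R _ (v k)); [apply H0|apply H1]. }
  assert (Cv := column_ex v Hv H1 H2).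
  assert (Cu : forall n, ex_series (fun k => u k n)).
  { intros n. apply (ex_series_le_R _ (fun k => v k n)); [intros; apply H0|apply Cv]. }
  (* [u = w - v] with [w] and [v] nonnegative, which reduces the signed case to [Fubini_nonneg]. *)
  pose (w := fun k n => u k n + v k n).
  assert (W0 : forall k n, 0 <= w k n) by (intros k n; unfold w; specialize (Hu k n); lra).
  assert (W1 : forall k, ex_series (w k)) by (intros; now apply ex_series_plus_R).
  assert (Eq : forall k, Series (u k) = Series (w k) - Series (v k)).
  { intros k. unfold w. rewrite Series_plus by easy. ring. }
  assert (Eq' : forall n, Series (fun k => u k n)
     = Series (fun k => w k n) - Series (fun k => v k n)).
  { intros n. unfold w. rewrite Series_plus by easy. ring. }
  assert (W2 : ex_series (fun k => Series (w k))).
  { apply (ex_series_le_R _ (fun k => 2 * Series (v k))); [|now apply ex_series_scal_l_R].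
    intros k. rewrite Rabs_pos_eq by (apply Series_nonneg; [apply W0|apply W1]).
    rewrite <- Series_scal_l. apply Series_le; [|now apply ex_series_scal_l_R].
    intros n; split; [apply W0|unfold w; specialize (Hu k n); lra]. }
  assert (D1 : ex_series (fun k => Series (w k) - Series (v k)))
    by now apply ex_series_minus_R.
  assert (D2 : ex_series (fun n => Series (fun k => w k n) - Series (fun k => v k n))).
  { apply ex_series_minus_R; now apply column_total. }
  split; [|split].
  - now apply (ex_series_ext _ _ (fun k => eq_sym (Eq k))).
  - now apply (ex_series_ext _ _ (fun k => eq_sym (Eq' k))).
  - rewrite (Series_ext _ _ Eq), (Series_ext _ _ Eq').
    rewrite !Series_minus; try easy; try now apply column_total.
    now rewrite (Fubini_nonneg w), (Fubini_nonneg v).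
Qed.

(** * Absolutely convergent power series in one real variable *)

Ltac eqR := match goal with |- ?a = ?b => change (@eq R a b) end.

(** [M] bounds the weighted [l^1] norm of the Taylor coefficients at 0. This norm is
    submultiplicative and complete, as products and infinite sums require; the bound is explicit so
    that [wiener_series] can ask for summable bounds. *)
Definition wiener (r : R) (f : R -> R) (M : R) : Prop :=
  exists a : nat -> R,
    ex_series (fun n => Rabs (a n) * r ^ n) /\
    Series (fun n => Rabs (a n) * r ^ n) <= M /\
    (forall h, Rabs h <= r -> is_series (fun n => a n * h ^ n) (f h)).

Lemma Rabs_coeff_pow_le a h r n :
  Rabs h <= r -> Rabs (a * h ^ n) <= Rabs a * r ^ n.
Proof.
  intros H. rewrite Rabs_mult, <- RPow_abs.
  apply Rmult_le_compat_l; [apply Rabs_pos|].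
  apply pow_incr. split; [apply Rabs_pos|exact H].
Qed.

Lemma wiener_abs r a h :
  Rabs h <= r -> ex_series (fun n => Rabs (a n) * r ^ n) ->
  ex_series (fun n => Rabs (a n * h ^ n)).
Proof.
  intros Hh. apply ex_series_le_R. intros n.
  rewrite Rabs_Rabsolu. now apply Rabs_coeff_pow_le.
Qed.

Lemma wiener_bound r f M h : wiener r f M -> Rabs h <= r -> Rabs (f h) <= M.
Proof.
  intros (a & E & B & S) Hh. rewrite <- (is_series_unique _ _ (S h Hh)).
  apply Rle_trans with (1 := Series_Rabs _ (wiener_abs r a h Hh E)).
  apply Rle_trans with (2 := B). apply Series_le; [|exact E].
  intros n; split; [apply Rabs_pos|now apply Rabs_coeff_pow_le].
Qed.

Lemma wiener_ext r f g M :
  (forall h, Rabs h <= r -> f h = g h) -> wiener r f M -> wiener r g M.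
Proof.
  intros H (a & E & B & S). exists a. repeat split; try easy.
  intros h Hh. rewrite <- H by easy. now apply S.
Qed.

Lemma wiener_le r f M M' : M <= M' -> wiener r f M -> wiener r f M'.
Proof. intros H (a & E & B & S). exists a. repeat split; try easy. lra. Qed.

Lemma wiener_shrink r r' f M : 0 <= r' <= r -> wiener r f M -> wiener r' f M.
Proof.
  intros H (a & E & B & S). exists a.
  assert (L : forall n, 0 <= Rabs (a n) * r' ^ n <= Rabs (a n) * r ^ n).
  { intros n. assert (0 <= r' ^ n) by now apply pow_le.
    split; [apply Rmult_le_pos; [apply Rabs_pos|easy]|].
    apply Rmult_le_compat_l; [apply Rabs_pos|now apply pow_incr]. }
  repeat split.
  - apply ex_series_le_R with (2 := E). intros n.
    rewrite Rabs_pos_eq; apply L.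
  - apply Rle_trans with (2 := B). now apply Series_le.
  - intros h Hh. apply S. lra.
Qed.

Lemma is_series_single (n0 : nat) (a : nat -> R) :
  (forall n, n <> n0 -> a n = 0) -> is_series a (a n0).
Proof.
  intros H. apply is_series_rsum.
  apply (is_lim_seq_ext_loc (fun _ => a n0)); [|apply is_lim_seq_const].
  exists (S n0). intros n Hn. replace n with (n0 + S (n - S n0))%nat by lia.
  rewrite rsum_app, rsum_first.
  rewrite (rsum_zero n0) by (intros; apply H; lia).
  rewrite rsum_zero by (intros; apply H; lia).
  rewrite Nat.add_0_r. ring.
Qed.

Lemma wiener_monomial r c n :
  wiener r (fun h => c * h ^ n) (Rabs c * r ^ n).
Proof.
  pose (a := fun k => if Nat.eq_dec k n then c else 0).
  assert (A : forall h k, k <> n -> a k * h ^ k = 0).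
  { intros h k Hk. unfold a. destruct (Nat.eq_dec k n); [easy|ring]. }
  assert (A' : forall k, k <> n -> Rabs (a k) * r ^ k = 0).
  { intros k Hk. unfold a. destruct (Nat.eq_dec k n); [easy|].
    rewrite Rabs_R0; ring. }
  assert (E := is_series_single n _ A').
  exists a. split; [|split].
  - now eexists; apply E.
  - rewrite (is_series_unique _ _ E). unfold a.
    destruct (Nat.eq_dec n n); [lra|easy].
  - intros h _. replace (c * h ^ n) with (a n * h ^ n).
    + apply (is_series_single n (fun k => a k * h ^ k)), A.
    + unfold a. now destruct (Nat.eq_dec n n).
Qed.

Lemma wiener_const r c : wiener r (fun _ => c) (Rabs c).
Proof.
  apply wiener_le with (Rabs c * r ^ 0); [simpl; lra|].
  apply wiener_ext with (2 := wiener_monomial r c 0). intros; simpl; ring.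
Qed.

Lemma wiener_shift r t0 : 0 <= r -> wiener r (fun h => t0 + h) (Rabs t0 + r).
Proof.
  intros Hr.
  pose (a := fun k => match k with O => t0 | S O => 1 | _ => 0 end).
  assert (T : forall b : nat -> R, (forall n, b (S (S n)) = 0) -> is_series b (b 0%nat + b 1%nat)).
  { intros b Hb. apply is_series_rsum.
    apply (is_lim_seq_ext_loc (fun _ => b 0%nat + b 1%nat)); [|apply is_lim_seq_const].
    exists 2%nat. intros n Hn. replace n with (2 + (n - 2))%nat by lia.
    rewrite rsum_app, (rsum_zero (n - 2)) by (intros; apply Hb). simpl. ring. }
  assert (E := T (fun n => Rabs (a n) * r ^ n)).
  exists a. split; [|split].
  - eexists. apply E. intros n; simpl. rewrite Rabs_R0; ring.
  - rewrite (is_series_unique _ _ (E ltac:(intros n; simpl; rewrite Rabs_R0; ring))).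
    simpl. rewrite Rabs_R1. lra.
  - intros h _. replace (t0 + h) with (a 0%nat * h ^ 0 + a 1%nat * h ^ 1) by (simpl; ring).
    apply (T (fun n => a n * h ^ n)). intros n; simpl; ring.
Qed.

Lemma wiener_plus r f g M N :
  0 <= r -> wiener r f M -> wiener r g N -> wiener r (fun h => f h + g h) (M + N).
Proof.
  intros Hr (a & E & B & S) (b & E' & B' & S').
  assert (L : forall n, 0 <= Rabs (a n + b n) * r ^ n
                        <= Rabs (a n) * r ^ n + Rabs (b n) * r ^ n).
  { intros n. assert (0 <= r ^ n) by now apply pow_le.
    split; [apply Rmult_le_pos; [apply Rabs_pos|easy]|].
    rewrite <- Rmult_plus_distr_r.
    apply Rmult_le_compat_r; [easy|apply Rabs_triang]. }
  assert (E2 := ex_series_plus_R _ _ E E').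
  exists (fun n => a n + b n). split; [|split].
  - apply ex_series_le_R with (2 := E2). intros n. rewrite Rabs_pos_eq; apply L.
  - apply Rle_trans with (1 := Series_le _ _ L E2). rewrite Series_plus by easy. lra.
  - intros h Hh. apply is_series_ext with (fun n => a n * h ^ n + b n * h ^ n).
    + intros n. change (a n * h ^ n + b n * h ^ n = (a n + b n) * h ^ n). ring.
    + apply (is_series_plus _ _ _ _ (S h Hh) (S' h Hh)).
Qed.

Lemma wiener_mult r f g M N :
  0 <= r -> wiener r f M -> wiener r g N -> wiener r (fun h => f h * g h) (M * N).
Proof.
  intros Hr (a & E & B & S) (b & E' & B' & S').
  pose (c := fun n => sum_f_R0 (fun k => a k * b (n - k)%nat) n).
  assert (Abs : forall d : nat -> R, ex_series (fun n => Rabs (d n) * r ^ n) ->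
     ex_series (fun n => Rabs (Rabs (d n) * r ^ n))).
  { intros d. apply ex_series_ext. intros n. symmetry; apply Rabs_pos_eq.
    apply Rmult_le_pos; [apply Rabs_pos|now apply pow_le]. }
  assert (Cauchy : forall (a b : nat -> R) h n,
     sum_f_R0 (fun k => (a k * h ^ k) * (b (n - k)%nat * h ^ (n - k))) n
     = sum_f_R0 (fun k => a k * b (n - k)%nat) n * h ^ n).
  { intros a' b' h n. rewrite !sum_f_R0_rsum, <- rsum_scal_r. apply rsum_ext.
    intros i Hi. replace (h ^ n) with (h ^ i * h ^ (n - i)); [ring|].
    rewrite <- pow_add. f_equal. lia. }
  assert (P := is_series_mult _ _ _ _ (Series_correct _ E) (Series_correct _ E')
                 (Abs a E) (Abs b E')).
  assert (L : forall n, 0 <= Rabs (c n) * r ^ n <=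
     sum_f_R0 (fun k => (Rabs (a k) * r ^ k) * (Rabs (b (n - k)%nat) * r ^ (n - k))) n).
  { intros n. assert (0 <= r ^ n) by now apply pow_le.
    split; [apply Rmult_le_pos; [apply Rabs_pos|easy]|].
    rewrite (Cauchy (fun k => Rabs (a k)) (fun k => Rabs (b k))).
    apply Rmult_le_compat_r; [easy|]. unfold c.
    apply Rle_trans with (1 := Rsum_abs _ _). right. apply sum_eq.
    intros i _. apply Rabs_mult. }
  exists c. split; [|split].
  - apply ex_series_le_R with (2 := ex_intro _ _ P). intros n.
    rewrite Rabs_pos_eq; apply L.
  - apply Rle_trans with (1 := Series_le _ _ L (ex_intro _ _ P)).
    rewrite (is_series_unique _ _ P).
    apply Rmult_le_compat; try easy; apply Series_nonneg; try easy; intros n;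
      (apply Rmult_le_pos; [apply Rabs_pos|now apply pow_le]).
  - intros h Hh.
    apply is_series_ext with
      (fun n => sum_f_R0 (fun k => (a k * h ^ k) * (b (n - k)%nat * h ^ (n - k))) n).
    + intros n. apply Cauchy.
    + apply (is_series_mult _ _ _ _ (S h Hh) (S' h Hh)); now apply wiener_abs with r.
Qed.

Lemma wiener_scal r f c M :
  0 <= r -> wiener r f M -> wiener r (fun h => c * f h) (Rabs c * M).
Proof. intros Hr H. apply wiener_mult; [easy|apply wiener_const|easy]. Qed.

Lemma wiener_pow r f M n :
  0 <= r -> wiener r f M -> wiener r (fun h => f h ^ n) (M ^ n).
Proof.
  intros Hr H. induction n as [|n IH]; simpl.
  - apply wiener_le with (Rabs 1); [rewrite Rabs_R1; lra|apply wiener_const].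
  - now apply wiener_mult.
Qed.

(** Completeness of the norm: the coefficients of equal degree are added over [k], and the absolute
    convergence of the double array at radius [r] allows either order of summation at each [h]. *)
Lemma wiener_series r (f : nat -> R -> R) (M : nat -> R) :
  0 <= r -> (forall k, wiener r (f k) (M k)) -> ex_series M ->
  wiener r (fun h => Series (fun k => f k h)) (Series M).
Proof.
  intros Hr H HM.
  pose (a := fun k => proj1_sig (constructive_indefinite_description _ (H k))).
  assert (Ha : forall k, ex_series (fun n => Rabs (a k n) * r ^ n) /\
    Series (fun n => Rabs (a k n) * r ^ n) <= M k /\
    (forall h, Rabs h <= r -> is_series (fun n => a k n * h ^ n) (f k h))).
  { intros k. unfold a. now destruct (constructive_indefinite_description _ (H k)). }
  pose (v := fun k n => Rabs (a k n) * r ^ n).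
  assert (V0 : forall k n, 0 <= v k n).
  { intros k n. apply Rmult_le_pos; [apply Rabs_pos|now apply pow_le]. }
  assert (V1 : forall k, ex_series (v k)) by apply Ha.
  assert (V2 : ex_series (fun k => Series (v k))).
  { apply ex_series_le_R with (2 := HM). intros k.
    rewrite Rabs_pos_eq by (now apply Series_nonneg). apply Ha. }
  assert (C := column_ex v V0 V1 V2).
  assert (L : forall n, 0 <= Rabs (Series (fun k => a k n)) * r ^ n
                        <= Series (fun k => v k n)).
  { intros n. assert (P : 0 <= r ^ n) by now apply pow_le.
    split; [apply Rmult_le_pos; [apply Rabs_pos|easy]|].
    rewrite <- (Rabs_pos_eq (r ^ n)) by easy. rewrite <- Rabs_mult, <- Series_scal_r.
    assert (T : forall k, Rabs (a k n * r ^ n) = v k n).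
    { intros k. unfold v. now rewrite Rabs_mult, (Rabs_pos_eq (r ^ n)). }
    apply Rle_trans with (1 := Series_Rabs (fun k => a k n * r ^ n)
       (ex_series_ext _ _ (fun k => eq_sym (T k)) (C n))).
    rewrite (Series_ext _ _ T). lra. }
  exists (fun n => Series (fun k => a k n)). split; [|split].
  - apply ex_series_le_R with (2 := column_total v V0 V1 V2).
    intros n. rewrite Rabs_pos_eq; apply L.
  - apply Rle_trans with (1 := Series_le _ _ L (column_total v V0 V1 V2)).
    rewrite Fubini_nonneg by easy. apply Series_le; [|easy].
    intros k. split; [now apply Series_nonneg|apply Ha].
  - intros h Hh.
    destruct (Fubini_abs (fun k n => a k n * h ^ n) v) as (F1 & F2 & F3); try easy.
    { intros k n. now apply Rabs_coeff_pow_le. }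
    rewrite (Series_ext (fun k => f k h) (fun k => Series (fun n => a k n * h ^ n))).
    2:{ intros k. symmetry. now apply is_series_unique, Ha. }
    rewrite <- F3. apply is_series_ext with (fun n => Series (fun k => a k n * h ^ n)).
    + intros n. apply Series_scal_r.
    + now apply Series_correct.
Qed.

Lemma exp_is_series x : is_series (fun n => x ^ n / INR (fact n)) (exp x).
Proof.
  apply is_series_ext with (2 := is_exp_Reals x). intros n.
  rewrite pow_n_pow. change (scal ?u ?w) with (u * w). reflexivity.
Qed.

Lemma ex_series_exp x : ex_series (fun n => x ^ n / INR (fact n)).
Proof. eexists; apply exp_is_series. Qed.

Lemma wiener_exp r c : 0 <= r -> wiener r (fun h => exp (c * h)) (exp (Rabs c * r)).
Proof.
  intros Hr. exists (fun n => c ^ n / INR (fact n)).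
  assert (T : forall n, (Rabs c * r) ^ n / INR (fact n) = Rabs (c ^ n / INR (fact n)) * r ^ n).
  { intros n. rewrite Rpow_mult_distr. unfold Rdiv.
    rewrite Rabs_mult, RPow_abs, (Rabs_pos_eq (/ _)); [ring|].
    left. apply Rinv_0_lt_compat, INR_fact_lt_0. }
  assert (E := is_series_ext _ _ _ T (exp_is_series (Rabs c * r))).
  split; [|split].
  - eexists; apply E.
  - right. now apply is_series_unique.
  - intros h _. apply is_series_ext with (2 := exp_is_series (c * h)).
    intros n. eqR. rewrite Rpow_mult_distr. unfold Rdiv. ring.
Qed.

(** Every later term has at least [n + 1] factors [h], each of which gains [Rabs h / r] over the
    majorant at radius [r]. The case [n = 0] is continuity at 0; with [n] the first nonzero
    coefficient, zeros are isolated. *)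
Lemma wiener_leading r f M a0 n :
  0 < r ->
  (exists a, ex_series (fun k => Rabs (a k) * r ^ k) /\
    Series (fun k => Rabs (a k) * r ^ k) <= M /\
    (forall h, Rabs h <= r -> is_series (fun k => a k * h ^ k) (f h)) /\
    a n = a0 /\ (forall k, (k < n)%nat -> a k = 0)) ->
  forall h, Rabs h <= r -> Rabs (f h - a0 * h ^ n) <= (Rabs h / r) ^ S n * M.
Proof.
  intros Hr (a & E & B & S & An & A0) h Hh.
  assert (Q : 0 <= Rabs h / r <= 1).
  { split.
    - apply Rmult_le_pos; [apply Rabs_pos|]. left; now apply Rinv_0_lt_compat.
    - apply Rmult_le_reg_r with r; [easy|]. unfold Rdiv.
      rewrite Rmult_assoc, Rinv_l by lra. lra. }
  pose (b := fun k => if Nat.eq_dec k n then 0 else a k * h ^ k).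
  assert (Sb : is_series b (f h - a0 * h ^ n)).
  { pose (d := fun k => if Nat.eq_dec k n then a k * h ^ k else 0).
    assert (Sd : is_series d (a0 * h ^ n)).
    { replace (a0 * h ^ n) with (d n).
      - apply is_series_single. intros k Hk. unfold d.
        destruct (Nat.eq_dec k n); [now elim Hk|reflexivity].
      - unfold d. destruct (Nat.eq_dec n n); [now rewrite An|easy]. }
    apply is_series_ext with (2 := is_series_minus _ _ _ _ (S h Hh) Sd).
    intros k. change (a k * h ^ k - d k = b k). unfold b, d.
    destruct (Nat.eq_dec k n); ring. }
  assert (L : forall k, Rabs (b k) <= (Rabs h / r) ^ (1 + n) * (Rabs (a k) * r ^ k)).
  { intros k. unfold b.
    assert (P : 0 <= (Rabs h / r) ^ (1 + n) * (Rabs (a k) * r ^ k)).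
    { apply Rmult_le_pos; [apply pow_le; lra|].
      apply Rmult_le_pos; [apply Rabs_pos|apply pow_le; lra]. }
    destruct (Nat.eq_dec k n); [now rewrite Rabs_R0|].
    destruct (Nat.lt_ge_cases k n) as [Hk|Hk].
    { rewrite (A0 k Hk), Rmult_0_l, Rabs_R0 in *. exact P. }
    rewrite Rabs_mult, <- RPow_abs.
    replace (Rabs h ^ k) with ((Rabs h / r) ^ k * r ^ k).
    2:{ rewrite <- Rpow_mult_distr. f_equal. field. lra. }
    replace k with (1 + n + (k - (1 + n)))%nat at 2 by lia. rewrite pow_add.
    assert ((Rabs h / r) ^ (k - (1 + n)) <= 1).
    { rewrite <- (pow1 (k - (1 + n))). now apply pow_incr. }
    assert (0 <= (Rabs h / r) ^ (1 + n)) by (apply pow_le; lra).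
    assert (0 <= Rabs (a k) * r ^ k).
    { apply Rmult_le_pos; [apply Rabs_pos|apply pow_le; lra]. }
    apply Rle_trans with ((Rabs h / r) ^ (1 + n) * (Rabs h / r) ^ (k - (1 + n)) * (Rabs (a k) * r ^ k)); [right; ring|].
    apply Rmult_le_compat_r; [easy|].
    rewrite <- (Rmult_1_r ((Rabs h / r) ^ (1 + n))) at 2.
    now apply Rmult_le_compat_l. }
  assert (E2 := ex_series_scal_l_R ((Rabs h / r) ^ (1 + n)) _ E).
  rewrite <- (is_series_unique _ _ Sb).
  apply Rle_trans with (1 := Series_Rabs b (ex_series_le_R _ _
    (fun k => eq_ind_r (fun x => x <= _) (L k) (Rabs_Rabsolu (b k))) E2)).
  apply Rle_trans with (Series (fun k => (Rabs h / r) ^ (1 + n) * (Rabs (a k) * r ^ k))).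
  - apply Series_le; [|exact E2]. intros k. split; [apply Rabs_pos|apply L].
  - rewrite Series_scal_l. apply Rmult_le_compat_l; [apply pow_le; lra|exact B].
Qed.

Lemma wiener_continuous_0 r f M h :
  0 < r -> wiener r f M -> Rabs h <= r -> Rabs (f h - f 0) <= Rabs h / r * M.
Proof.
  intros Hr (a & E & B & S) Hh.
  assert (H := wiener_leading r f M (a 0%nat) 0 Hr).
  assert (F0 : f 0 = a 0%nat).
  { assert (Z := S 0). rewrite Rabs_R0 in Z. specialize (Z (Rlt_le _ _ Hr)).
    assert (Z' := is_series_single 0 (fun n => a n * 0 ^ n)).
    rewrite <- (is_series_unique _ _ Z), (is_series_unique _ _ (Z' ltac:(intros n Hn; simpl;
      destruct n; [easy|rewrite pow_ne_zero by easy; ring]))).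
    simpl; ring. }
  assert (N : forall k, (k < 0)%nat -> a k = 0) by (intros k Hk; exfalso; lia).
  assert (X := H (ex_intro _ a (conj E (conj B (conj S (conj eq_refl N))))) h Hh).
  simpl in X. rewrite F0. rewrite !Rmult_1_r in X. exact X.
Qed.

Lemma wiener_isolated r f M :
  0 < r -> wiener r f M ->
  (forall h, Rabs h <= r -> f h = 0) \/
  (exists e, 0 < e /\ forall h, 0 < Rabs h < e -> f h <> 0).
Proof.
  intros Hr (a & E & B & S).
  destruct (excluded_middle_informative (exists n, a n <> 0)) as [Hn|Hn].
  - right.
    assert (Least : exists n, a n <> 0 /\ forall k, (k < n)%nat -> a k = 0).
    { destruct Hn as [n Hn]. revert Hn.
      induction n as [n IH] using (well_founded_induction Wf_nat.lt_wf). intros Hn.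
      destruct (excluded_middle_informative (exists k, (k < n)%nat /\ a k <> 0)) as [[k [K1 K2]]|H].
      - now apply (IH k).
      - exists n. split; [easy|]. intros k Hk.
        destruct (Req_dec (a k) 0); [easy|]. exfalso; eauto. }
    destruct Least as (n & An & A0).
    assert (H := wiener_leading r f M (a n) n Hr
      (ex_intro _ a (conj E (conj B (conj S (conj eq_refl A0)))))).
    assert (M0 : 0 <= M).
    { apply Rle_trans with (2 := B). apply Series_nonneg; [|easy].
      intros k. apply Rmult_le_pos; [apply Rabs_pos|apply pow_le; lra]. }
    assert (Pa := Rabs_pos_lt _ An).
    (* For [Rabs h < Rabs (a n) / K] the remainder is smaller than the leading term; the summand 1
       keeps [K] positive when [M = 0]. *)
    pose (K := M / r ^ (1 + n) + 1).
    assert (Pr : 0 < r ^ (1 + n)) by now apply pow_lt.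
    assert (K0 : 0 < K).
    { unfold K. assert (0 <= M / r ^ (1 + n)); [|lra].
      apply Rmult_le_pos; [easy|]. left; now apply Rinv_0_lt_compat. }
    exists (Rmin r (Rabs (a n) / K)). split.
    { apply Rmin_glb_lt; [easy|]. now apply Rdiv_lt_0_compat. }
    intros h [H1 H2] Hf.
    assert (H3 : Rabs h < r) by (apply Rlt_le_trans with (1 := H2), Rmin_l).
    assert (H4 : Rabs h < Rabs (a n) / K) by (apply Rlt_le_trans with (1 := H2), Rmin_r).
    specialize (H h (Rlt_le _ _ H3)). rewrite Hf in H.
    replace (0 - a n * h ^ n) with (- (a n * h ^ n)) in H by ring.
    rewrite Rabs_Ropp, Rabs_mult, <- RPow_abs in H.
    assert (Ph : 0 < Rabs h ^ n) by now apply pow_lt.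
    assert (H5 : Rabs (a n) <= Rabs h * (M / r ^ (1 + n))).
    { apply Rmult_le_reg_r with (Rabs h ^ n); [easy|].
      apply Rle_trans with (1 := H). right. unfold Rdiv.
      rewrite Rpow_mult_distr, pow_inv. simpl. ring. }
    assert (H6 : Rabs h * K < Rabs (a n)).
    { apply Rmult_lt_compat_r with (r := K) in H4; [|easy].
      unfold Rdiv in H4. rewrite Rmult_assoc, Rinv_l in H4 by lra. lra. }
    unfold K in H6. lra.
  - left. intros h Hh. rewrite <- (is_series_unique _ _ (S h Hh)).
    rewrite <- Series_zero. apply Series_ext. intros n.
    destruct (Req_dec (a n) 0) as [Z|Z]; [rewrite Z; ring|]. exfalso; eauto.
Qed.

(** * Germs of analytic and meromorphic functions of a real variable *)

Definition an_at (f : R -> R) (t0 : R) : Prop :=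
  exists r M, 0 < r /\ wiener r (fun x => f (t0 + x)) M.

(** [m] is only an upper bound for the order of the pole, so that sums and products need not take
    account of cancellation; the value [f t0] is left free. *)
Definition mer_at (f : R -> R) (t0 : R) : Prop :=
  exists m r M g, 0 < r /\ wiener r g M /\
    forall x, 0 < Rabs x <= r -> f (t0 + x) * x ^ m = g x.

Definition vanishes_around (f : R -> R) (t0 : R) : Prop :=
  exists e, 0 < e /\ forall x, 0 < Rabs x < e -> f (t0 + x) = 0.

Lemma an_mer f t0 : an_at f t0 -> mer_at f t0.
Proof.
  intros (r & M & Hr & H). exists 0%nat, r, M, (fun x => f (t0 + x)).
  repeat split; try easy. intros x _. simpl; ring.
Qed.

Lemma an_ext f g t0 : (forall t, f t = g t) -> an_at f t0 -> an_at g t0.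
Proof.
  intros E (r & M & Hr & H). exists r, M. split; [easy|].
  now apply wiener_ext with (2 := H).
Qed.

Lemma an_const c t0 : an_at (fun _ => c) t0.
Proof. exists 1, (Rabs c). split; [lra|apply wiener_const]. Qed.

Lemma an_binop (op : R -> R -> R) (opM : R -> R -> R) f g t0 :
  (forall r f g M N, 0 <= r -> wiener r f M -> wiener r g N ->
     wiener r (fun h => op (f h) (g h)) (opM M N)) ->
  an_at f t0 -> an_at g t0 -> an_at (fun t => op (f t) (g t)) t0.
Proof.
  intros Hop (r & M & Hr & H) (r' & M' & Hr' & H').
  assert (0 < Rmin r r') by now apply Rmin_glb_lt.
  exists (Rmin r r'), (opM M M'). split; [easy|].
  apply Hop; [lra| |].
  - apply wiener_shrink with (2 := H). split; [lra|apply Rmin_l].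
  - apply wiener_shrink with (2 := H'). split; [lra|apply Rmin_r].
Qed.

Lemma an_plus f g t0 : an_at f t0 -> an_at g t0 -> an_at (fun t => f t + g t) t0.
Proof. apply (an_binop Rplus Rplus). intros; now apply wiener_plus. Qed.

Lemma an_mult f g t0 : an_at f t0 -> an_at g t0 -> an_at (fun t => f t * g t) t0.
Proof. apply (an_binop Rmult Rmult). intros; now apply wiener_mult. Qed.

Lemma mer_mult f g t0 : mer_at f t0 -> mer_at g t0 -> mer_at (fun t => f t * g t) t0.
Proof.
  intros (m & r & M & u & Hr & H & E) (m' & r' & M' & u' & Hr' & H' & E').
  assert (P : 0 < Rmin r r') by now apply Rmin_glb_lt.
  exists (m + m')%nat, (Rmin r r'), (M * M'), (fun x => u x * u' x).
  split; [easy|]. split.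
  - apply wiener_mult; [lra| |].
    + apply wiener_shrink with (2 := H). split; [lra|apply Rmin_l].
    + apply wiener_shrink with (2 := H'). split; [lra|apply Rmin_r].
  - intros x [X1 X2]. assert (Rmin r r' <= r) by apply Rmin_l.
    assert (Rmin r r' <= r') by apply Rmin_r.
    rewrite <- E, <- E' by lra. rewrite pow_add. ring.
Qed.

Lemma mer_plus f g t0 : mer_at f t0 -> mer_at g t0 -> mer_at (fun t => f t + g t) t0.
Proof.
  intros (m & r & M & u & Hr & H & E) (m' & r' & M' & u' & Hr' & H' & E').
  assert (P : 0 < Rmin r r') by now apply Rmin_glb_lt.
  assert (W : forall k, exists N, wiener (Rmin r r') (fun x => x ^ k) N).
  { intros k. eexists. apply wiener_ext with (2 := wiener_monomial _ 1 k).
    intros; simpl; ring. }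
  destruct (W m) as [N HN], (W m') as [N' HN'].
  exists (m + m')%nat, (Rmin r r'), (M * N' + M' * N),
    (fun x => u x * x ^ m' + u' x * x ^ m).
  split; [easy|]. split.
  - apply wiener_plus; [lra| |]; apply wiener_mult; try easy; try lra.
    + apply wiener_shrink with (2 := H). split; [lra|apply Rmin_l].
    + apply wiener_shrink with (2 := H'). split; [lra|apply Rmin_r].
  - intros x [X1 X2]. assert (Rmin r r' <= r) by apply Rmin_l.
    assert (Rmin r r' <= r') by apply Rmin_r.
    rewrite <- E, <- E' by lra. rewrite pow_add. ring.
Qed.

Lemma mer_const c t0 : mer_at (fun _ => c) t0.
Proof. apply an_mer, an_const. Qed.

Lemma mer_ext f g t0 : (forall t, f t = g t) -> mer_at f t0 -> mer_at g t0.
Proof.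
  intros E (m & r & M & u & Hr & H & F). exists m, r, M, u.
  split; [easy|]. split; [easy|]. intros x Hx. now rewrite <- E, F.
Qed.

Lemma mer_dichotomy f t0 : mer_at f t0 ->
  vanishes_around f t0 \/
  exists e, 0 < e /\ forall x, 0 < Rabs x < e -> f (t0 + x) <> 0.
Proof.
  intros (m & r & M & u & Hr & H & F).
  destruct (wiener_isolated r u M Hr H) as [Z|(e & He & Z)].
  - left. exists r. split; [easy|]. intros x Hx.
    apply Rmult_eq_reg_r with (x ^ m).
    + rewrite F by lra. rewrite Z by lra. ring.
    + apply pow_nonzero. intros X. rewrite X, Rabs_R0 in Hx. lra.
  - right. exists (Rmin e r). split; [now apply Rmin_glb_lt|]. intros x Hx Zx.
    assert (Rmin e r <= r) by apply Rmin_r.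
    assert (Rmin e r <= e) by apply Rmin_l.
    apply (Z x); [lra|]. rewrite <- F by lra. rewrite Zx. ring.
Qed.

(** Connectedness: at the supremum of the points up to which [f] vanishes locally, zeros accumulate
    from the left. The dichotomy then forces vanishing around this point, hence also beyond it. *)
Lemma identity_theorem f A B :
  A <= B -> (forall t, A <= t <= B -> mer_at f t) -> vanishes_around f A ->
  vanishes_around f B.
Proof.
  intros AB Hm HA.
  pose (E := fun t => A <= t <= B /\ forall u, A <= u <= t -> vanishes_around f u).
  assert (EA : E A).
  { split; [lra|]. intros u Hu. now replace u with A by lra. }
  destruct (completeness E) as [L [L1 L2]].
  { exists B. intros t [Ht _]. lra. }
  { now exists A. }
  assert (AL := L1 A EA).
  assert (LB : L <= B) by (apply L2; intros t [Ht _]; lra).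
  assert (Below : forall u, u < L -> exists t, E t /\ u < t).
  { intros u Hu. destruct (excluded_middle_informative (exists t, E t /\ u < t)) as [X|X]; [easy|].
    exfalso. assert (L <= u); [|lra]. apply L2. intros t Et.
    destruct (Rle_dec t u); [easy|]. exfalso; apply X. exists t; split; [easy|lra]. }
  assert (VL : vanishes_around f L).
  { destruct (mer_dichotomy f L (Hm L (conj AL LB))) as [V|(e & He & N)]; [easy|].
    destruct (Below (L - e)) as (t & Et & Ht); [lra|].
    assert (TL := L1 t Et). destruct Et as [Et1 Et2].
    assert (Vt := Et2 t (conj (proj1 Et1) (Rle_refl t))).
    destruct (Req_dec t L) as [->|TN]; [easy|].
    destruct Vt as (d & Hd & Z). exfalso.
    (* [t + x] lies strictly between [t] and [L], so it is a zero of [f] at distance less than [e]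
       from [L]. *)
    pose (x := Rmin (d / 2) ((L - t) / 2)).
    assert (X1 : 0 < x) by (apply Rmin_glb_lt; lra).
    assert (X2 : x <= d / 2) by apply Rmin_l.
    assert (X3 : x <= (L - t) / 2) by apply Rmin_r.
    apply (N (t + x - L)).
    - rewrite Rabs_left by lra. lra.
    - replace (L + (t + x - L)) with (t + x) by ring. apply Z.
      rewrite Rabs_pos_eq; lra. }
  assert (Upto : forall u, A <= u <= L -> vanishes_around f u).
  { intros u Hu. destruct (Req_dec u L) as [->|UL]; [easy|].
    destruct (Below u) as (t & Et & Ht); [lra|]. apply Et. lra. }
  destruct (Req_dec L B) as [<-|LN]; [easy|]. exfalso.
  destruct VL as (e & He & Z).
  pose (s := Rmin (L + e / 2) B).
  assert (S1 : L < s) by (apply Rmin_glb_lt; lra).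
  assert (S2 : s <= L + e / 2) by apply Rmin_l.
  assert (S3 : s <= B) by apply Rmin_r.
  assert (Es : E s).
  { split; [lra|]. intros u Hu. destruct (Rle_dec u L) as [UL|UL]; [apply Upto; lra|].
    exists (Rmin (u - L) (L + e - u)). split; [apply Rmin_glb_lt; lra|].
    intros x Hx. assert (Rmin (u - L) (L + e - u) <= u - L) by apply Rmin_l.
    assert (Rmin (u - L) (L + e - u) <= L + e - u) by apply Rmin_r.
    assert (X := Rabs_def2 x (Rmin (u - L) (L + e - u)) (proj2 Hx)).
    replace (u + x) with (L + (u + x - L)) by ring. apply Z.
    rewrite Rabs_pos_eq; lra. }
  assert (X := L1 s Es). lra.
Qed.

Lemma an_limit f t0 eps : an_at f t0 -> 0 < eps ->
  exists d, 0 < d /\ forall x, Rabs x < d -> Rabs (f (t0 + x) - f t0) < eps.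
Proof.
  intros (r & M & Hr & H) He.
  assert (M0 : 0 <= M).
  { apply Rle_trans with (2 := wiener_bound r _ M 0 H ltac:(rewrite Rabs_R0; lra)).
    apply Rabs_pos. }
  assert (P : 0 < eps * r / (M + 1)).
  { apply Rdiv_lt_0_compat; [now apply Rmult_lt_0_compat|lra]. }
  exists (Rmin r (eps * r / (M + 1))). split; [now apply Rmin_glb_lt|].
  intros x Hx.
  assert (X1 : Rabs x < r) by (apply Rlt_le_trans with (1 := Hx), Rmin_l).
  assert (X2 : Rabs x < eps * r / (M + 1)) by (apply Rlt_le_trans with (1 := Hx), Rmin_r).
  assert (C := wiener_continuous_0 r _ M x Hr H (Rlt_le _ _ X1)).
  cbv beta in C. rewrite Rplus_0_r in C. apply Rle_lt_trans with (1 := C).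
  assert (X3 : Rabs x * (M + 1) < eps * r).
  { replace (eps * r) with (eps * r / (M + 1) * (M + 1)) by (field; lra).
    apply Rmult_lt_compat_r; lra. }
  replace (Rabs x / r * M) with (Rabs x * M / r) by (field; lra).
  apply Rmult_lt_reg_r with r; [easy|].
  replace (Rabs x * M / r * r) with (Rabs x * M) by (field; lra).
  assert (0 <= Rabs x) by apply Rabs_pos. lra.
Qed.

Lemma vanishes_an f t0 : vanishes_around f t0 -> an_at f t0 -> f t0 = 0.
Proof.
  intros (e & He & Z) Ha. destruct (Req_dec (f t0) 0) as [|N]; [easy|]. exfalso.
  destruct (an_limit f t0 (Rabs (f t0)) Ha (Rabs_pos_lt _ N)) as (d & Hd & C).
  pose (x := Rmin e d / 2).
  assert (0 < Rmin e d) by now apply Rmin_glb_lt.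
  assert (Rmin e d <= e) by apply Rmin_l.
  assert (Rmin e d <= d) by apply Rmin_r.
  assert (X : Rabs x = x) by (apply Rabs_pos_eq; unfold x; lra).
  specialize (C x ltac:(rewrite X; unfold x; lra)).
  rewrite Z in C by (rewrite X; unfold x; lra).
  rewrite Rminus_0_l, Rabs_Ropp in C. lra.
Qed.

(** * Exponential, cosine and sine of affine arguments *)

Lemma an_exp_affine a b t0 : an_at (fun t => exp (a + b * t)) t0.
Proof.
  exists 1. eexists. split; [lra|].
  apply wiener_ext with (fun h => exp (a + b * t0) * exp (b * h)).
  - intros h _. rewrite <- exp_plus. f_equal. ring.
  - apply wiener_scal; [lra|]. apply wiener_exp. lra.
Qed.

Lemma cos_is_series x : is_series (fun i => cos_n i * (x²) ^ i) (cos x).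
Proof.
  unfold cos. destruct (exist_cos x²) as [l Hl]. now apply is_series_Reals.
Qed.

Lemma sin_is_series x : is_series (fun i => x * (sin_n i * (x²) ^ i)) (sin x).
Proof.
  unfold sin. destruct (exist_sin x²) as [l Hl].
  apply is_series_Reals in Hl. exact (is_series_scal_l x _ _ Hl).
Qed.

(** A common majorant for [an_cos_linear]: the cosine series has these terms in absolute value, and
    the sine series is bounded by them times [Rabs b], because [(2 i + 1)! >= (2 i)!]. *)
Lemma ex_series_exp_even x : 0 <= x -> ex_series (fun i => x ^ (2 * i) / INR (fact (2 * i))).
Proof.
  intros Hx. apply (ex_series_bound _ (exp x)).
  - intros i. apply Rmult_le_pos; [now apply pow_le|].
    left; apply Rinv_0_lt_compat, INR_fact_lt_0.
  - intros n. rewrite <- (is_series_unique _ _ (exp_is_series x)).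
    assert (P : forall i, 0 <= x ^ i / INR (fact i)).
    { intros i. apply Rmult_le_pos; [now apply pow_le|].
      left; apply Rinv_0_lt_compat, INR_fact_lt_0. }
    apply Rle_trans with (2 := rsum_le_Series _ (2 * n) P (ex_series_exp x)).
    induction n as [|n IH]; [simpl; lra|].
    replace (2 * S n)%nat with (S (S (2 * n))) by lia. cbn [rsum].
    assert (X := P (S (2 * n))). lra.
Qed.

Lemma an_cos_linear b t0 : an_at (fun t => cos (b * t)) t0.
Proof.
  assert (W : exists M, wiener 1 (fun h => cos (b * h)) M).
  { eexists. apply wiener_ext with
      (fun h => Series (fun i => (cos_n i * (b²) ^ i) * h ^ (2 * i))).
    - intros h _. rewrite <- (is_series_unique _ _ (cos_is_series (b * h))).
      apply Series_ext. intros i. rewrite Rsqr_mult, Rpow_mult_distr, pow_mult.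
      unfold Rsqr. simpl. rewrite Rmult_1_r. ring.
    - apply wiener_series; [lra|intros k; apply wiener_monomial|].
      apply ex_series_le_R with (2 := ex_series_exp_even (Rabs b) (Rabs_pos b)).
      intros n. rewrite pow1, Rmult_1_r, Rabs_Rabsolu. unfold cos_n.
      unfold Rdiv. rewrite !Rabs_mult, pow_1_abs, Rmult_1_l.
      rewrite (Rabs_pos_eq (/ _)) by (left; apply Rinv_0_lt_compat, INR_fact_lt_0).
      rewrite <- RPow_abs, Rabs_pos_eq by apply Rle_0_sqr. rewrite pow_mult.
      rewrite <- Rsqr_pow2, <- Rsqr_abs. right; ring. }
  assert (W' : exists M, wiener 1 (fun h => sin (b * h)) M).
  { eexists. apply wiener_ext with
      (fun h => Series (fun i => (b * (sin_n i * (b²) ^ i)) * h ^ (S (2 * i)))).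
    - intros h _. rewrite <- (is_series_unique _ _ (sin_is_series (b * h))).
      apply Series_ext. intros i. rewrite Rsqr_mult, Rpow_mult_distr.
      cbn [pow]. rewrite pow_mult.
      unfold Rsqr. simpl. rewrite Rmult_1_r. ring.
    - apply wiener_series; [lra|intros k; apply wiener_monomial|].
      apply ex_series_le_R with
        (2 := ex_series_scal_l_R (Rabs b) _ (ex_series_exp_even (Rabs b) (Rabs_pos b))).
      intros n. rewrite pow1, Rmult_1_r, Rabs_Rabsolu. unfold sin_n.
      unfold Rdiv. rewrite !Rabs_mult, pow_1_abs, Rmult_1_l.
      apply Rmult_le_compat_l; [apply Rabs_pos|].
      rewrite (Rabs_pos_eq (/ _)) by (left; apply Rinv_0_lt_compat, INR_fact_lt_0).
      rewrite <- RPow_abs, Rabs_pos_eq by apply Rle_0_sqr. rewrite pow_mult.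
      rewrite <- Rsqr_pow2, <- Rsqr_abs. rewrite Rmult_comm.
      apply Rmult_le_compat_l; [apply pow_le, Rle_0_sqr|].
      apply Rinv_le_contravar; [apply INR_fact_lt_0|].
      apply le_INR, fact_le. lia. }
  destruct W as [M HM], W' as [M' HM'].
  exists 1. eexists. split; [lra|].
  (* The addition formula moves the centre of the expansion from 0 to [t0]. *)
  apply wiener_ext with
    (fun h => cos (b * t0) * cos (b * h) + (- sin (b * t0)) * sin (b * h)).
  - intros h _. rewrite Rmult_plus_distr_l, cos_plus. ring.
  - apply wiener_plus; [lra| |]; (apply wiener_scal; [lra|]); eassumption.
Qed.

Lemma an_cos_affine a b t0 : an_at (fun t => cos (a + b * t)) t0.
Proof.
  destruct (Req_dec b 0) as [->|Hb].
  - apply an_ext with (fun _ => cos (a + 0)); [intros; f_equal; ring|apply an_const].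
  (* For [b <> 0] the phase [a] is absorbed into the base point. *)
  - destruct (an_cos_linear b (t0 + a / b)) as (r & M & Hr & H).
    exists r, M. split; [easy|]. apply wiener_ext with (2 := H).
    intros h _. f_equal. field. easy.
Qed.

Lemma an_sin_affine a b t0 : an_at (fun t => sin (a + b * t)) t0.
Proof.
  apply an_ext with (fun t => cos ((a - PI / 2) + b * t)); [|apply an_cos_affine].
  intros t. rewrite <- (Rplus_0_l (sin _)), <- (cos_shift (a + b * t)).
  rewrite Rplus_0_l. rewrite <- cos_neg. f_equal. ring.
Qed.

(** * Meromorphic functions restricted to a real line *)

Definition line (z0 w : C) (t : R) : C := (z0 + RtoC t * w)%C.

Definition Can_at (f : R -> C) (t0 : R) : Prop :=
  an_at (fun t => Re (f t)) t0 /\ an_at (fun t => Im (f t)) t0.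

Definition Cmer_at (f : R -> C) (t0 : R) : Prop :=
  mer_at (fun t => Re (f t)) t0 /\ mer_at (fun t => Im (f t)) t0.

Lemma Re_is_series (a : nat -> C) (l : C) :
  @is_series C_AbsRing C_NormedModule a l ->
  is_series (fun n => Re (a n)) (Re l) /\ is_series (fun n => Im (a n)) (Im l).
Proof.
  intros H.
  assert (E1 : forall n, Re (sum_n a n) = sum_n (fun n => Re (a n)) n).
  { induction n as [|n IH]; [now rewrite !sum_O|]. rewrite !sum_Sn, <- IH. reflexivity. }
  assert (E2 : forall n, Im (sum_n a n) = sum_n (fun n => Im (a n)) n).
  { induction n as [|n IH]; [now rewrite !sum_O|]. rewrite !sum_Sn, <- IH. reflexivity. }
  split.
  - apply filterlim_ext with (1 := E1).
    apply (filterlim_comp _ _ _ (sum_n a) Re _ _ _ H).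
    apply (filterlim_filter_le_2 (F := Hierarchy.locally l) Re (G := Hierarchy.locally (Re l))).
    + easy.
    + apply (continuous_fst (U := R_UniformSpace) (V := R_UniformSpace) (fst l) (snd l)).
  - apply filterlim_ext with (1 := E2).
    apply (filterlim_comp _ _ _ (sum_n a) Im _ _ _ H).
    apply (continuous_snd (U := R_UniformSpace) (V := R_UniformSpace) (fst l) (snd l)).
Qed.

Lemma pow_n_Cpow (z : C) n : @pow_n C_Ring z n = Cpow z n.
Proof. induction n as [|n IH]; [easy|]. simpl. now rewrite IH. Qed.

Lemma Cpow_mult_R (x : R) (w : C) n : Cpow (RtoC x * w) n = (RtoC (x ^ n) * Cpow w n)%C.
Proof.
  induction n as [|n IH]; simpl; [ring|]. rewrite IH, RtoC_mult. ring.
Qed.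

Lemma line_shift z0 w t0 x : line z0 w (t0 + x) = (line z0 w t0 + RtoC x * w)%C.
Proof. unfold line. rewrite RtoC_plus. ring. Qed.

Lemma line_near z0 w t0 (P : C -> Prop) :
  locally (line z0 w t0) P ->
  exists d, 0 < d /\ forall x, Rabs x < d -> P (line z0 w (t0 + x)).
Proof.
  intros [e He].
  pose (K := Rabs (Re w) + Rabs (Im w) + 1).
  assert (K1 : 0 <= Rabs (Re w)) by apply Rabs_pos.
  assert (K2 : 0 <= Rabs (Im w)) by apply Rabs_pos.
  exists (e / K). split; [apply Rdiv_lt_0_compat; [apply e|unfold K; lra]|].
  intros x Hx. apply He. rewrite line_shift.
  assert (X : Rabs x * K < e).
  { replace (pos e) with (e / K * K) by (field; unfold K; lra).
    apply Rmult_lt_compat_r; [unfold K; lra|easy]. }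
  assert (X0 := Rabs_pos x). unfold K in X.
  assert (Y1 : 0 <= Rabs x * Rabs (Re w)) by now apply Rmult_le_pos.
  assert (Y2 : 0 <= Rabs x * Rabs (Im w)) by now apply Rmult_le_pos.
  split.
  - change (Rabs (Re (line z0 w t0) + (x * Re w - 0 * Im w) - Re (line z0 w t0)) < e).
    replace (Re (line z0 w t0) + (x * Re w - 0 * Im w) - Re (line z0 w t0))
      with (x * Re w) by ring.
    rewrite Rabs_mult. lra.
  - change (Rabs (Im (line z0 w t0) + (x * Im w + 0 * Re w) - Im (line z0 w t0)) < e).
    replace (Im (line z0 w t0) + (x * Im w + 0 * Re w) - Im (line z0 w t0))
      with (x * Im w) by ring.
    rewrite Rabs_mult. lra.
Qed.

(** Mere convergence is given. At [d / 2] it bounds the radius of convergence from below, and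
    therefore at [d / 4] it is absolute. *)
Lemma wiener_of_power_series (b : nat -> R) (f : R -> R) d :
  0 < d -> (forall x, Rabs x < d -> is_series (fun n => b n * x ^ n) (f x)) ->
  exists r M, 0 < r /\ wiener r f M.
Proof.
  intros Hd H. exists (d / 4).
  assert (C : Rbar_lt (Rabs (d / 4)) (CV_radius b)).
  { apply Rbar_not_le_lt. intros X. apply (CV_disk_outside b (d / 2)).
    - apply Rbar_le_lt_trans with (1 := X). simpl. rewrite !Rabs_pos_eq; lra.
    - apply (ex_series_lim_0 (fun n => b n * (d / 2) ^ n)).
      exists (f (d / 2)). apply H. rewrite Rabs_pos_eq; lra. }
  assert (E : ex_series (fun n => Rabs (b n) * (d / 4) ^ n)).
  { apply ex_series_ext with (2 := CV_disk_inside b (d / 4) C).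
    intros n. rewrite Rabs_mult. f_equal. apply Rabs_pos_eq, pow_le. lra. }
  eexists. split; [lra|]. exists b. split; [exact E|]. split; [apply Rle_refl|].
  intros h Hh. apply H. lra.
Qed.

Lemma analytic_line F z0 w t0 :
  analytic_at F (line z0 w t0) -> Can_at (fun t => F (line z0 w t)) t0.
Proof.
  intros [a Ha]. destruct (line_near _ _ _ _ Ha) as (d & Hd & L).
  assert (S : forall x, Rabs x < d ->
     @is_series C_AbsRing C_NormedModule
       (fun n => RtoC (x ^ n) * (Cpow w n * a n))%C (F (line z0 w (t0 + x)))).
  { intros x Hx. apply is_series_ext with (2 := L x Hx). intros n.
    rewrite pow_n_Cpow. change (scal ?u ?v) with (Cmult u v).
    rewrite line_shift.
    replace (line z0 w t0 + RtoC x * w - line z0 w t0)%C with (RtoC x * w)%C by ring.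
    rewrite Cpow_mult_R. now rewrite Cmult_assoc. }
  split.
  - apply (wiener_of_power_series (fun n => Re (Cpow w n * a n)%C) _ d Hd).
    intros x Hx. apply is_series_ext with (2 := proj1 (Re_is_series _ _ (S x Hx))).
    intros n. generalize (Cpow w n * a n)%C. intros c. unfold Re; simpl. ring.
  - apply (wiener_of_power_series (fun n => Im (Cpow w n * a n)%C) _ d Hd).
    intros x Hx. apply is_series_ext with (2 := proj2 (Re_is_series _ _ (S x Hx))).
    intros n. generalize (Cpow w n * a n)%C. intros c. unfold Im; simpl. ring.
Qed.

Lemma Can_Cmer f t0 : Can_at f t0 -> Cmer_at f t0.
Proof. intros [H1 H2]; split; now apply an_mer. Qed.

Lemma Cpow_neq_0 (z : C) n : z <> RtoC 0 -> Cpow z n <> RtoC 0.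
Proof.
  intros Hz. induction n as [|n IH]; simpl; [apply C1_nz|]. now apply Cmult_neq_0.
Qed.

(** Along the line the distance to the pole is [x * w] with [x] real, so a pole in [z] becomes a
    pole of the same order in the real parameter, up to the constant [w ^ (m + 1)]. *)
Lemma pole_line_eq F g m z0 w t0 :
  w <> RtoC 0 ->
  locally (line z0 w t0) (fun z : C => z <> line z0 w t0 ->
     F z = Cdiv (g z) (Cpow (Cminus z (line z0 w t0)) (S m))) ->
  exists d, 0 < d /\ forall x, 0 < Rabs x < d ->
    (F (line z0 w (t0 + x)) * RtoC (x ^ S m)
       = g (line z0 w (t0 + x)) * / Cpow w (S m))%C.
Proof.
  intros Hw H. destruct (line_near _ _ _ _ H) as (d & Hd & L).
  exists d. split; [easy|]. intros x [X1 X2].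
  assert (Xn : x <> 0) by (intros E; rewrite E, Rabs_R0 in X1; lra).
  assert (Xc : RtoC x <> RtoC 0) by (intros E; now apply RtoC_inj in E).
  assert (D : (line z0 w (t0 + x) - line z0 w t0)%C = (RtoC x * w)%C)
    by (rewrite line_shift; ring).
  rewrite L; try easy.
  - rewrite D, Cpow_mult_R. field. split; [now apply Cpow_neq_0|].
    intros E. apply RtoC_inj in E. revert E. now apply pow_nonzero.
  - intros E. rewrite E in D. apply (Cmult_neq_0 _ _ Xc Hw). rewrite <- D. ring.
Qed.

Lemma meromorphic_line F z0 w t0 :
  w <> RtoC 0 ->
  analytic_at F (line z0 w t0) \/ pole_at F (line z0 w t0) ->
  Cmer_at (fun t => F (line z0 w t)) t0.
Proof.
  intros Hw [H|(m & g & Hg & _ & H)]; [now apply Can_Cmer, analytic_line|].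
  destruct (pole_line_eq F g m z0 w t0 Hw H) as (d & Hd & E).
  destruct (analytic_line _ _ _ _ Hg) as [G1 G2].
  set (c := (/ Cpow w (S m))%C) in *.
  assert (A1 : an_at (fun t => Re (g (line z0 w t)) * Re c + - Im c * Im (g (line z0 w t))) t0).
  { apply an_plus; apply an_mult; try easy; apply an_const. }
  assert (A2 : an_at (fun t => Re (g (line z0 w t)) * Im c + Re c * Im (g (line z0 w t))) t0).
  { apply an_plus; apply an_mult; try easy; apply an_const. }
  destruct A1 as (r1 & M1 & R1 & W1), A2 as (r2 & M2 & R2 & W2).
  split.
  - assert (Rmin (d / 2) r1 <= d / 2) by apply Rmin_l.
    assert (Rmin (d / 2) r1 <= r1) by apply Rmin_r.
    assert (0 < Rmin (d / 2) r1) by (apply Rmin_glb_lt; lra).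
    eexists (S m), (Rmin (d / 2) r1), M1, _. split; [easy|].
    split; [apply wiener_shrink with (2 := W1); lra|].
    intros x Hx. specialize (E x ltac:(lra)). apply (f_equal Re) in E.
    transitivity (Re (F (line z0 w (t0 + x)) * RtoC (x ^ S m))%C); [unfold Re; cbn; ring|].
    rewrite E. unfold Re, Im; cbn; ring.
  - assert (Rmin (d / 2) r2 <= d / 2) by apply Rmin_l.
    assert (Rmin (d / 2) r2 <= r2) by apply Rmin_r.
    assert (0 < Rmin (d / 2) r2) by (apply Rmin_glb_lt; lra).
    eexists (S m), (Rmin (d / 2) r2), M2, _. split; [easy|].
    split; [apply wiener_shrink with (2 := W2); lra|].
    intros x Hx. specialize (E x ltac:(lra)). apply (f_equal Im) in E.
    transitivity (Im (F (line z0 w (t0 + x)) * RtoC (x ^ S m))%C); [unfold Im; cbn; ring|].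
    rewrite E. unfold Re, Im; cbn; ring.
Qed.

Lemma Can_ext f g t0 : (forall t, f t = g t) -> Can_at f t0 -> Can_at g t0.
Proof.
  intros E [H1 H2]. split.
  - apply an_ext with (2 := H1). intros t; now rewrite E.
  - apply an_ext with (2 := H2). intros t; now rewrite E.
Qed.

Lemma Cmer_ext f g t0 : (forall t, f t = g t) -> Cmer_at f t0 -> Cmer_at g t0.
Proof.
  intros E [H1 H2]. split.
  - apply mer_ext with (2 := H1). intros t; now rewrite E.
  - apply mer_ext with (2 := H2). intros t; now rewrite E.
Qed.

Lemma Can_const c t0 : Can_at (fun _ => c) t0.
Proof. split; apply an_const. Qed.

Lemma Can_plus f g t0 : Can_at f t0 -> Can_at g t0 -> Can_at (fun t => f t + g t)%C t0.
Proof.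
  intros [H1 H2] [H3 H4]. split.
  - now apply (an_plus (fun t => Re (f t)) (fun t => Re (g t))).
  - now apply (an_plus (fun t => Im (f t)) (fun t => Im (g t))).
Qed.

Lemma Can_mult f g t0 : Can_at f t0 -> Can_at g t0 -> Can_at (fun t => f t * g t)%C t0.
Proof.
  intros [H1 H2] [H3 H4]. split.
  - apply an_ext with (fun t => Re (f t) * Re (g t) + (-1) * (Im (f t) * Im (g t))).
    + intros t. unfold Re, Im; cbn; ring.
    + apply an_plus; [now apply an_mult|].
      apply an_mult; [apply an_const|now apply an_mult].
  - apply an_ext with (fun t => Re (f t) * Im (g t) + Im (f t) * Re (g t)).
    + intros t. unfold Re, Im; cbn; ring.
    + apply an_plus; now apply an_mult.
Qed.

Lemma Cmer_const c t0 : Cmer_at (fun _ => c) t0.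
Proof. split; apply mer_const. Qed.

Lemma Cmer_plus f g t0 : Cmer_at f t0 -> Cmer_at g t0 -> Cmer_at (fun t => f t + g t)%C t0.
Proof.
  intros [H1 H2] [H3 H4]. split.
  - now apply (mer_plus (fun t => Re (f t)) (fun t => Re (g t))).
  - now apply (mer_plus (fun t => Im (f t)) (fun t => Im (g t))).
Qed.

Lemma Cmer_mult f g t0 : Cmer_at f t0 -> Cmer_at g t0 -> Cmer_at (fun t => f t * g t)%C t0.
Proof.
  intros [H1 H2] [H3 H4]. split.
  - apply mer_ext with (fun t => Re (f t) * Re (g t) + (-1) * (Im (f t) * Im (g t))).
    + intros t. unfold Re, Im; cbn; ring.
    + apply mer_plus; [now apply mer_mult|].
      apply mer_mult; [apply mer_const|now apply mer_mult].
  - apply mer_ext with (fun t => Re (f t) * Im (g t) + Im (f t) * Re (g t)).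
    + intros t. unfold Re, Im; cbn; ring.
    + apply mer_plus; now apply mer_mult.
Qed.

Lemma Can_rcpow_line x z0 w t0 : Can_at (fun t => rcpow x (line z0 w t)) t0.
Proof.
  set (l := ln x). split.
  - apply an_ext with (fun t => exp (Re z0 * l + (Re w * l) * t) * cos (Im z0 * l + (Im w * l) * t)).
    + intros t. unfold rcpow, Cexp, line, Re, Im; cbn. fold l. f_equal; f_equal; ring.
    + apply an_mult; [apply an_exp_affine|apply an_cos_affine].
  - apply an_ext with (fun t => exp (Re z0 * l + (Re w * l) * t) * sin (Im z0 * l + (Im w * l) * t)).
    + intros t. unfold rcpow, Cexp, line, Re, Im; cbn. fold l. f_equal; f_equal; ring.
    + apply an_mult; [apply an_exp_affine|apply an_sin_affine].
Qed.

Lemma Cidentity_theorem f A B :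
  A <= B -> (forall t, A <= t <= B -> Cmer_at f t) ->
  (exists e, 0 < e /\ forall x, 0 < Rabs x < e -> f (A + x) = RtoC 0) ->
  exists e, 0 < e /\ forall x, 0 < Rabs x < e -> f (B + x) = RtoC 0.
Proof.
  intros AB H (e & He & Z).
  destruct (identity_theorem (fun t => Re (f t)) A B AB) as (e1 & P1 & Z1).
  - intros t Ht. now apply H.
  - exists e. split; [easy|]. intros x Hx. now rewrite Z.
  - destruct (identity_theorem (fun t => Im (f t)) A B AB) as (e2 & P2 & Z2).
    + intros t Ht. now apply H.
    + exists e. split; [easy|]. intros x Hx. now rewrite Z.
    + exists (Rmin e1 e2). split; [now apply Rmin_glb_lt|]. intros x Hx.
      assert (Rmin e1 e2 <= e1) by apply Rmin_l.
      assert (Rmin e1 e2 <= e2) by apply Rmin_r.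
      specialize (Z1 x ltac:(lra)). specialize (Z2 x ltac:(lra)).
      destruct (f (B + x)) as [a b]. unfold Re, Im in *; simpl in *. now subst.
Qed.

Lemma Cidentity_value f A B :
  A <= B -> (forall t, A <= t <= B -> Cmer_at f t) -> Can_at f B ->
  (exists e, 0 < e /\ forall x, 0 < Rabs x < e -> f (A + x) = RtoC 0) ->
  f B = RtoC 0.
Proof.
  intros AB H [H1 H2] Z.
  destruct (Cidentity_theorem f A B AB H Z) as (e & He & Z').
  assert (Z1 : Re (f B) = 0).
  { apply (vanishes_an (fun t => Re (f t))); [|easy].
    exists e; split; [easy|]. intros x Hx. now rewrite Z'. }
  assert (Z2 : Im (f B) = 0).
  { apply (vanishes_an (fun t => Im (f t))); [|easy].
    exists e; split; [easy|]. intros x Hx. now rewrite Z'. }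
  destruct (f B) as [a b]. unfold Re, Im in *; simpl in *. now subst.
Qed.

(** * The value of the continued zeta function at 0 *)

Definition dirichlet (x : R) (n : nat) : R := / Rpower (INR (S n)) x.

Definition zr (x : R) : R := Series (dirichlet x).

Lemma INR_S_pos n : 0 < INR (S n).
Proof. apply lt_0_INR; lia. Qed.

Lemma ex_series_inv_sqr : ex_series (fun n => / INR (S n) ^ 2).
Proof.
  apply (ex_series_bound _ 2).
  - intros i. left. apply Rinv_0_lt_compat, pow_lt, INR_S_pos.
  - intros n. destruct n as [|n]; [simpl; lra|].
    apply Rle_trans with (2 - / INR (S n)).
    + induction n as [|n IH]; [simpl; lra|]. cbn [rsum] in *.
      assert (P := INR_S_pos n). rewrite (S_INR (S n)) in *.
      set (y := INR (S n)) in *.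
      assert (X : / (y + 1) ^ 2 <= / y - / (y + 1)).
      { replace (/ y - / (y + 1)) with (/ (y * (y + 1))) by (field; lra).
        apply Rinv_le_contravar; [apply Rmult_lt_0_compat; lra|nra]. }
      lra.
    + assert (0 < / INR (S n)) by apply Rinv_0_lt_compat, INR_S_pos. lra.
Qed.

Lemma dirichlet_pos x n : 0 < dirichlet x n.
Proof. apply Rinv_0_lt_compat. unfold Rpower. apply exp_pos. Qed.

Lemma dirichlet_le x n : 2 <= x -> dirichlet x n <= / INR (S n) ^ 2.
Proof.
  intros Hx. unfold dirichlet. rewrite <- Rpower_pow by apply INR_S_pos.
  apply Rinv_le_contravar; [apply exp_pos|].
  apply Rle_Rpower; [|simpl; lra]. rewrite S_INR. assert (H := pos_INR n). lra.
Qed.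

Lemma ex_dirichlet x : 2 <= x -> ex_series (dirichlet x).
Proof.
  intros Hx. apply ex_series_le_R with (2 := ex_series_inv_sqr). intros n.
  rewrite Rabs_pos_eq by (left; apply dirichlet_pos). now apply dirichlet_le.
Qed.

Lemma rcpow_real y x : rcpow y (RtoC x) = RtoC (Rpower y x).
Proof.
  unfold rcpow, Cexp, Rpower, RtoC, Re, Im; cbn.
  replace (x * 0 + 0 * ln y) with 0 by ring. rewrite cos_0, sin_0.
  f_equal; [|ring]. rewrite Rmult_1_r. f_equal. ring.
Qed.

Lemma CSeries_real (a : nat -> R) : CSeries (fun n => RtoC (a n)) = RtoC (Series a).
Proof.
  unfold CSeries, RtoC. f_equal.
  transitivity (Series (fun _ => 0)); [now apply Series_ext|apply Series_zero].
Qed.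

Lemma CSeries_ext (a b : nat -> C) : (forall n, a n = b n) -> CSeries a = CSeries b.
Proof.
  intros H. unfold CSeries. f_equal; apply Series_ext; intros n; now rewrite H.
Qed.

Lemma zeta_series_real x : zeta_series (RtoC x) = RtoC (zr x).
Proof.
  unfold zeta_series, zr. rewrite <- CSeries_real. apply CSeries_ext. intros n.
  rewrite rcpow_real. unfold dirichlet. rewrite RtoC_inv; [easy|].
  apply Rgt_not_eq, exp_pos.
Qed.

Lemma Series_split_parity (a : nat -> R) :
  (forall n, 0 <= a n) -> ex_series a ->
  ex_series (fun j => a (2 * j)%nat) /\ ex_series (fun j => a (S (2 * j))) /\
  Series a = Series (fun j => a (2 * j)%nat) + Series (fun j => a (S (2 * j))).
Proof.
  intros Ha E.
  assert (D : forall n, rsum (2 * n) a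
     = rsum n (fun j => a (2 * j)%nat) + rsum n (fun j => a (S (2 * j)))).
  { induction n as [|n IH]; [simpl; ring|].
    replace (2 * S n)%nat with (S (S (2 * n))) by lia. cbn [rsum]. rewrite IH. ring. }
  assert (B : forall n, rsum (2 * n) a <= Series a) by (intros; now apply rsum_le_Series).
  assert (E1 : ex_series (fun j => a (2 * j)%nat)).
  { apply (ex_series_bound _ (Series a)); [easy|]. intros n. apply Rle_trans with (2 := B n).
    rewrite D. assert (0 <= rsum n (fun j => a (S (2 * j)))) by now apply rsum_nonneg. lra. }
  assert (E2 : ex_series (fun j => a (S (2 * j)))).
  { apply (ex_series_bound _ (Series a)); [easy|]. intros n. apply Rle_trans with (2 := B n).
    rewrite D. assert (0 <= rsum n (fun j => a (2 * j)%nat)) by now apply rsum_nonneg. lra. }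
  split; [easy|]. split; [easy|].
  assert (L1 := Series_is_lim_rsum _ E).
  apply (is_lim_seq_subseq _ _ (fun n => (2 * n)%nat)) in L1.
  2:{ intros P [N HN]. exists N. intros n Hn. apply HN. lia. }
  assert (L2 := is_lim_seq_plus' _ _ _ _ (Series_is_lim_rsum _ E1) (Series_is_lim_rsum _ E2)).
  apply is_lim_seq_ext with (v := fun n => rsum (2 * n) a) in L2; [|now intros n; rewrite D].
  apply is_lim_seq_unique in L1. apply is_lim_seq_unique in L2.
  rewrite L1 in L2. now inversion L2.
Qed.

Lemma dirichlet_double x j : dirichlet x (S (2 * j)) = / Rpower 2 x * dirichlet x j.
Proof.
  unfold dirichlet. rewrite <- Rinv_mult. f_equal.
  rewrite Rpower_mult_distr; [|lra|apply INR_S_pos]. f_equal.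
  rewrite !S_INR, mult_INR. simpl. ring.
Qed.

(** Index [n] stands for the integer [n + 1], so the even indices are the odd integers. *)
Lemma Series_dirichlet_odd x : 2 <= x ->
  ex_series (fun j => dirichlet x (2 * j)%nat) /\
  Series (fun j => dirichlet x (2 * j)%nat) = (1 - / Rpower 2 x) * zr x.
Proof.
  intros Hx.
  destruct (Series_split_parity (dirichlet x)) as (E1 & E2 & E3).
  - intros n. left; apply dirichlet_pos.
  - now apply ex_dirichlet.
  - split; [easy|]. rewrite (Series_ext (fun j => dirichlet x (S (2 * j)))
      (fun j => / Rpower 2 x * dirichlet x j)) in E3 by apply dirichlet_double.
    rewrite Series_scal_l in E3. fold (zr x) in E3. lra.
Qed.

(** * The alternating zeta series near 0 *)

Definition exp_tail (x : R) : R := exp x - 1 - x.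

Lemma exp_tail_is_series x :
  is_series (fun j => x ^ (2 + j) / INR (fact (2 + j))) (exp_tail x).
Proof.
  apply (is_series_incr_n (fun n => x ^ n / INR (fact n)) 2 (exp_tail x)); [lia|].
  replace (plus (exp_tail x) _) with (exp x); [apply exp_is_series|].
  rewrite sum_n_rsum. change (exp x = exp_tail x + rsum 2 (fun n => x ^ n / INR (fact n))).
  unfold exp_tail. simpl. field.
Qed.

Lemma exp_tail_majorant y : 0 <= y ->
  Series (fun j => y ^ (2 + j) / INR (fact (2 + j))) <= y ^ 2 * exp y.
Proof.
  intros Hy. rewrite <- (is_series_unique _ _ (exp_is_series y)), <- Series_scal_l.
  apply Series_le; [|apply ex_series_scal_l_R, ex_series_exp].
  intros n. rewrite pow_add.
  assert (0 <= y ^ 2) by now apply pow_le. assert (0 <= y ^ n) by now apply pow_le.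
  assert (F1 := INR_fact_lt_0 n).
  assert (F2 : / INR (fact (2 + n)) <= / INR (fact n)).
  { apply Rinv_le_contravar; [easy|]. apply le_INR, fact_le. lia. }
  assert (F3 : 0 < / INR (fact (2 + n))) by apply Rinv_0_lt_compat, INR_fact_lt_0.
  unfold Rdiv. split.
  - apply Rmult_le_pos; [now apply Rmult_le_pos|lra].
  - rewrite <- Rmult_assoc. apply Rmult_le_compat_l; [now apply Rmult_le_pos|easy].
Qed.

Lemma wiener_exp_tail r t0 c :
  0 <= r ->
  wiener r (fun h => exp_tail (c * (t0 + h)))
    ((Rabs c * (Rabs t0 + r)) ^ 2 * exp (Rabs c * (Rabs t0 + r))).
Proof.
  intros Hr. set (S := Rabs c * (Rabs t0 + r)).
  assert (S0 : 0 <= S).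
  { apply Rmult_le_pos; [apply Rabs_pos|]. assert (H := Rabs_pos t0). lra. }
  apply wiener_le with (1 := exp_tail_majorant S S0).
  apply wiener_ext with
    (fun h => Series (fun j => / INR (fact (2 + j)) * (c * (t0 + h)) ^ (2 + j))).
  - intros h _. rewrite <- (is_series_unique _ _ (exp_tail_is_series (c * (t0 + h)))).
    apply Series_ext. intros j. unfold Rdiv; ring.
  - apply wiener_series; [easy| |exists (exp_tail S); apply exp_tail_is_series].
    intros k. apply wiener_le with (Rabs (/ INR (fact (2 + k))) * S ^ (2 + k)).
    + right. rewrite Rabs_pos_eq; [unfold Rdiv; ring|].
      left. apply Rinv_0_lt_compat, INR_fact_lt_0.
    + apply wiener_scal; [easy|]. apply wiener_pow; [easy|].
      apply wiener_scal; [easy|]. now apply wiener_shift.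
Qed.

Lemma exp_tail_bound x : Rabs (exp_tail x) <= x ^ 2 * exp (Rabs x).
Proof.
  assert (H := wiener_bound 0 _ _ 0 (wiener_exp_tail 0 x 1 (Rle_refl 0))).
  rewrite Rabs_R1, !Rplus_0_r, !Rmult_1_l in H.
  rewrite <- (pow2_abs x). apply H. rewrite Rabs_R0; lra.
Qed.

(* Second difference of [n^-t] over [n = 2j+1, 2j+2, 2j+3]; its sum over [j]
   converges for [t > -1] and equals [2 (1 - 2^(1-t)) zeta(t) - 1] for [t > 1]. *)
Definition second_diff (j : nat) (t : R) : R :=
  dirichlet t (2 * j) - 2 * dirichlet t (S (2 * j)) + dirichlet t (S (S (2 * j))).

Definition eta_tail (t : R) : R := Series (fun j => second_diff j t).

Lemma ln_le_minus_1 y : 0 < y -> ln y <= y - 1.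
Proof.
  intros Hy. assert (H := exp_ineq1_le (ln y)). rewrite exp_ln in H by easy. lra.
Qed.

Lemma exp_le_compat x y : x <= y -> exp x <= exp y.
Proof. intros [H| ->]; [left; now apply exp_increasing|apply Rle_refl]. Qed.

Lemma ln_sub_le a b : 0 < a -> 0 < b -> ln a - ln b <= a / b - 1.
Proof.
  intros Ha Hb. rewrite <- ln_div by easy. now apply ln_le_minus_1, Rdiv_lt_0_compat.
Qed.

(** With [k = j + 1] and the middle power [(2 k) ^ (- t)] taken out, the two neighbours become
    [exp (a t)] and [exp (b t)]. The constants cancel and the linear parts combine to
    [a + b = - ln (1 - 1 / (4 k ^ 2))]; since [exp_tail] is of second order, all that remains is of
    order [1 / k ^ 2]. *)
Lemma second_diff_eq j : exists L a b,
  let q := / INR (S j) in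
  0 <= L /\ Rabs a <= q /\ Rabs b <= q /\ Rabs (a + b) <= q ^ 2 /\
  forall t, second_diff j t
    = exp (- L * t) * (exp_tail (a * t) + exp_tail (b * t) + (a + b) * t).
Proof.
  set (k := INR (S j)). assert (K : 1 <= k).
  { unfold k. rewrite S_INR. assert (H := pos_INR j). lra. }
  exists (ln (2 * k)), (ln (2 * k) - ln (2 * k - 1)), (ln (2 * k) - ln (2 * k + 1)).
  assert (I : 0 < / k) by (apply Rinv_0_lt_compat; lra).
  assert (A1 : ln (2 * k - 1) <= ln (2 * k)) by (apply ln_le; lra).
  assert (A2 : ln (2 * k) <= ln (2 * k + 1)) by (apply ln_le; lra).
  assert (B1 : ln (2 * k) - ln (2 * k - 1) <= / k).
  { eapply Rle_trans; [apply ln_sub_le; lra|].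
    replace (2 * k / (2 * k - 1) - 1) with (/ (2 * k - 1)) by (field; lra).
    apply Rinv_le_contravar; lra. }
  assert (B2 : ln (2 * k + 1) - ln (2 * k) <= / k).
  { eapply Rle_trans; [apply ln_sub_le; lra|].
    replace ((2 * k + 1) / (2 * k) - 1) with (/ (2 * k)) by (field; lra).
    apply Rinv_le_contravar; lra. }
  assert (C : 0 <= ln (2 * k) - ln (2 * k - 1) + (ln (2 * k) - ln (2 * k + 1)) <= (/ k) ^ 2).
  { replace (ln (2 * k) - ln (2 * k - 1) + (ln (2 * k) - ln (2 * k + 1)))
      with ((ln (2 * k) + ln (2 * k)) - (ln (2 * k - 1) + ln (2 * k + 1))) by ring.
    rewrite <- !ln_mult by lra. split.
    - assert (ln ((2 * k - 1) * (2 * k + 1)) <= ln (2 * k * (2 * k))); [|lra].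
      apply ln_le; nra.
    - eapply Rle_trans; [apply ln_sub_le; nra|].
      replace (2 * k * (2 * k) / ((2 * k - 1) * (2 * k + 1)) - 1)
        with (/ ((2 * k - 1) * (2 * k + 1))) by (field; lra).
      rewrite pow_inv. apply Rinv_le_contravar; nra. }
  split; [rewrite <- ln_1; apply ln_le; lra|].
  split; [apply Rabs_le; lra|]. split; [apply Rabs_le; lra|].
  split; [rewrite Rabs_pos_eq; lra|].
  intros t. unfold second_diff, dirichlet, Rpower.
  replace (INR (S (2 * j))) with (2 * k - 1)
    by (unfold k; rewrite !S_INR, mult_INR; simpl; ring).
  replace (INR (S (S (2 * j)))) with (2 * k)
    by (unfold k; rewrite !S_INR, mult_INR; simpl; ring).
  replace (INR (S (S (S (2 * j))))) with (2 * k + 1)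
    by (unfold k; rewrite !S_INR, mult_INR; simpl; ring).
  rewrite <- !exp_Ropp. unfold exp_tail.
  transitivity (exp (- ln (2 * k) * t) * exp ((ln (2 * k) - ln (2 * k - 1)) * t)
    + exp (- ln (2 * k) * t) * exp ((ln (2 * k) - ln (2 * k + 1)) * t)
    - 2 * exp (- ln (2 * k) * t)); [|ring].
  rewrite <- !exp_plus.
  replace (- ln (2 * k) * t + (ln (2 * k) - ln (2 * k - 1)) * t)
    with (- (t * ln (2 * k - 1))) by ring.
  replace (- ln (2 * k) * t + (ln (2 * k) - ln (2 * k + 1)) * t)
    with (- (t * ln (2 * k + 1))) by ring.
  replace (- ln (2 * k) * t) with (- (t * ln (2 * k))) by ring. ring.
Qed.

Lemma inv_INR_S_le_1 j : 0 < / INR (S j) <= 1.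
Proof.
  split; [apply Rinv_0_lt_compat, INR_S_pos|]. rewrite <- Rinv_1.
  apply Rinv_le_contravar; [lra|]. rewrite S_INR. assert (H := pos_INR j). lra.
Qed.

Lemma eta_tail_analytic t0 : 0 < t0 -> an_at eta_tail t0.
Proof.
  (* Radius [t0] works uniformly in [j]: the factor [exp (- L (t0 + h))] then has norm
     [exp (- L t0) * exp (L t0) = 1], although [L = ln (2 j + 2)] is unbounded. *)
  intros Ht. exists t0.
  pose (S := Rabs t0 + t0). pose (K := 2 * (S ^ 2 * exp S) + S).
  assert (S0 : 0 <= S) by (unfold S; rewrite Rabs_pos_eq; lra).
  exists (Series (fun j => K * / INR (Datatypes.S j) ^ 2)). split; [easy|].
  apply (wiener_series t0 (fun j x => second_diff j (t0 + x))); [lra| |].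
  2:{ apply ex_series_scal_l_R, ex_series_inv_sqr. }
  intros j. destruct (second_diff_eq j) as (L & a & b & HL & Ha & Hb & Hab & E).
  set (q := / INR (Datatypes.S j)) in *.
  assert (Q : 0 < q <= 1) by apply inv_INR_S_le_1.
  apply wiener_ext with (1 := fun h _ => eq_sym (E (t0 + h))).
  rewrite <- pow_inv. fold q.
  assert (T : forall c, Rabs c <= q ->
     wiener t0 (fun h => exp_tail (c * (t0 + h))) (q ^ 2 * (S ^ 2 * exp S))).
  { intros c Hc. apply wiener_le with (2 := wiener_exp_tail t0 t0 c (Rlt_le _ _ Ht)).
    fold S. assert (C0 := Rabs_pos c).
    rewrite <- Rmult_assoc, <- Rpow_mult_distr.
    apply Rmult_le_compat; [apply pow_le; nra|left; apply exp_pos| |].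
    - apply pow_incr. split; [nra|]. apply Rmult_le_compat_r; lra.
    - apply exp_le_compat. nra. }
  apply wiener_le with (1 * (q ^ 2 * (S ^ 2 * exp S) + q ^ 2 * (S ^ 2 * exp S) + q ^ 2 * S)).
  { unfold K. right; ring. }
  apply wiener_mult; [lra| |].
  - apply wiener_le with (Rabs (exp (- L * t0)) * exp (Rabs (- L) * t0)).
    + rewrite Rabs_pos_eq by (left; apply exp_pos). rewrite <- exp_plus.
      rewrite Rabs_left1 by lra. right. rewrite <- exp_0. f_equal. ring.
    + apply wiener_ext with (fun h => exp (- L * t0) * exp (- L * h)).
      * intros h _. rewrite <- exp_plus. f_equal. ring.
      * apply wiener_scal; [lra|]. apply wiener_exp. lra.
  - apply wiener_plus; [lra|apply wiener_plus; [lra|now apply T|now apply T]|].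
    apply wiener_le with (Rabs (a + b) * S).
    + now apply Rmult_le_compat_r.
    + apply wiener_scal; [lra|]. apply wiener_shift. lra.
Qed.

(** At [t = 0] each second difference is [1 - 2 + 1 = 0], and near 0 it is at most linear in [t]
    with a constant of order [1 / (j + 1) ^ 2]. *)
Lemma eta_tail_small : exists K, 0 <= K /\
  forall t, 0 < t <= 1 -> Rabs (eta_tail t) <= K * t.
Proof.
  pose (A := 2 * exp 1 + 1). assert (A0 : 0 < A) by (unfold A; assert (H := exp_pos 1); lra).
  exists (Series (fun j => A * / INR (S j) ^ 2)).
  assert (E : ex_series (fun j => A * / INR (S j) ^ 2))
    by apply ex_series_scal_l_R, ex_series_inv_sqr.
  split.
  { apply Series_nonneg; [|easy]. intros n. apply Rmult_le_pos; [lra|].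
    left. apply Rinv_0_lt_compat, pow_lt, INR_S_pos. }
  intros t Ht.
  assert (B : forall j, Rabs (second_diff j t) <= A * / INR (S j) ^ 2 * t).
  { intros j. destruct (second_diff_eq j) as (L & a & b & HL & Ha & Hb & Hab & Eq).
    rewrite Eq. rewrite <- pow_inv. set (q := / INR (S j)) in *.
    assert (Q : 0 < q <= 1) by apply inv_INR_S_le_1.
    assert (T : forall c, Rabs c <= q -> Rabs (exp_tail (c * t)) <= q ^ 2 * t * exp 1).
    { intros c Hc. apply Rle_trans with (1 := exp_tail_bound _).
      assert (C0 := Rabs_pos c).
      assert (M : Rabs (c * t) <= q * t).
      { rewrite Rabs_mult, (Rabs_pos_eq t) by lra. apply Rmult_le_compat_r; lra. }
      assert (C1 := Rabs_pos (c * t)).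
      rewrite <- (pow2_abs (c * t)).
      apply Rmult_le_compat; [apply pow_le; lra|left; apply exp_pos| |].
      - apply Rle_trans with ((q * t) ^ 2); [now apply pow_incr|].
        rewrite Rpow_mult_distr. apply Rmult_le_compat_l; [apply pow_le; lra|]. nra.
      - apply exp_le_compat. nra. }
    rewrite Rabs_mult, (Rabs_pos_eq (exp _)) by (left; apply exp_pos).
    apply Rle_trans with (1 * (q ^ 2 * t * exp 1 + q ^ 2 * t * exp 1 + q ^ 2 * t)).
    - apply Rmult_le_compat; [left; apply exp_pos|apply Rabs_pos| |].
      + rewrite <- exp_0. apply exp_le_compat. nra.
      + apply Rle_trans with (1 := Rabs_triang _ _). apply Rplus_le_compat.
        * apply Rle_trans with (1 := Rabs_triang _ _).
          apply Rplus_le_compat; now apply T.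
        * rewrite Rabs_mult, (Rabs_pos_eq t) by lra. apply Rmult_le_compat_r; lra.
    - unfold A. right; ring. }
  unfold eta_tail. rewrite <- Series_scal_r.
  assert (E' : ex_series (fun j => A * / INR (S j) ^ 2 * t)) by now apply ex_series_scal_r.
  apply Rle_trans with (Series (fun j => Rabs (second_diff j t))).
  - apply Series_Rabs. apply ex_series_le_R with (2 := E'). intros n.
    now rewrite Rabs_Rabsolu.
  - apply Series_le; [|easy]. intros n. split; [apply Rabs_pos|apply B].
Qed.

Lemma Rpower_2_one_minus t : Rpower 2 (1 - t) = 2 * / Rpower 2 t.
Proof. unfold Rminus. rewrite Rpower_plus, Rpower_Ropp, Rpower_1 by lra. ring. Qed.

(** The odd integers are counted twice, except for 1, which is missing from the second copy; hence
    the final [- 1]. *)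
Lemma eta_tail_zr t : 2 <= t -> eta_tail t = 2 * (1 - Rpower 2 (1 - t)) * zr t - 1.
Proof.
  intros Ht. destruct (Series_dirichlet_odd t Ht) as [E1 S1].
  assert (E2 : ex_series (fun j => dirichlet t (S (2 * j)))).
  { apply ex_series_ext with (fun j => / Rpower 2 t * dirichlet t j).
    - intros j. symmetry; apply dirichlet_double.
    - now apply ex_series_scal_l_R, ex_dirichlet. }
  assert (S2 : Series (fun j => dirichlet t (S (2 * j))) = / Rpower 2 t * zr t).
  { rewrite (Series_ext _ (fun j => / Rpower 2 t * dirichlet t j)) by apply dirichlet_double.
    apply Series_scal_l. }
  assert (E3 : ex_series (fun j => dirichlet t (S (S (2 * j))))).
  { apply ex_series_ext with (fun j => dirichlet t (2 * (1 + j))).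
    - intros j. f_equal. lia.
    - apply (ex_series_incr_n (fun j => dirichlet t (2 * j)) 1). easy. }
  assert (S3 : Series (fun j => dirichlet t (S (S (2 * j))))
               = (1 - / Rpower 2 t) * zr t - 1).
  { rewrite (Series_incr_1 _ E1) in S1.
    replace (dirichlet t (2 * 0)) with 1 in S1.
    - rewrite (Series_ext _ (fun k => dirichlet t (2 * S k))); [lra|].
      intros k. f_equal. lia.
    - unfold dirichlet, Rpower. simpl. rewrite ln_1, Rmult_0_r, exp_0. field. }
  unfold eta_tail, second_diff.
  rewrite Series_plus; [|apply ex_series_minus_R; [easy|now apply ex_series_scal_l_R]|easy].
  rewrite Series_minus; [|easy|now apply ex_series_scal_l_R].
  rewrite Series_scal_l, S1, S2, S3.
  rewrite Rpower_2_one_minus. ring.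
Qed.

Lemma an_reflect f c t0 : an_at f (c - t0) -> an_at (fun t => f (c - t)) t0.
Proof.
  intros (r & M & Hr & a & E & B & S). exists r, M. split; [easy|].
  assert (A : forall n, Rabs (a n) * r ^ n = Rabs (a n * (-1) ^ n) * r ^ n).
  { intros n. now rewrite Rabs_mult, pow_1_abs, Rmult_1_r. }
  exists (fun n => a n * (-1) ^ n). split; [|split].
  - now apply ex_series_ext with (1 := A).
  - now rewrite <- (Series_ext _ _ A).
  - intros h Hh. replace (c - (t0 + h)) with (c - t0 + - h) by ring.
    apply is_series_ext with (2 := S (- h) ltac:(now rewrite Rabs_Ropp)).
    intros n. eqR. replace (- h) with ((-1) * h) by ring. rewrite Rpow_mult_distr. ring.
Qed.

(** Agreement of [f] and [psi] is asked only at points accumulating at 0, which is all that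
    continuations stopping at positive points provide. *)
Lemma an_value_from_right f psi c K :
  an_at f 0 -> (forall t, 0 < t <= 1 -> Rabs (psi t - c) <= K * t) ->
  (forall e, 0 < e -> exists t, 0 < t < e /\ f t = psi t) -> f 0 = c.
Proof.
  intros Hf Hpsi H. destruct (Req_dec (f 0) c) as [|N]; [easy|]. exfalso.
  set (d := Rabs (f 0 - c)). assert (D : 0 < d) by (apply Rabs_pos_lt; lra).
  destruct (an_limit f 0 (d / 2) Hf ltac:(lra)) as (e & He & C).
  assert (K0 : 0 <= K).
  { assert (X := Hpsi 1 ltac:(lra)). assert (Y := Rabs_pos (psi 1 - c)). lra. }
  assert (P : 0 < d / 2 / (K + 1)) by (apply Rdiv_lt_0_compat; lra).
  destruct (H (Rmin (Rmin e 1) (d / 2 / (K + 1)))) as (t & Ht & E).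
  { repeat apply Rmin_glb_lt; lra. }
  assert (X1 := Rmin_l (Rmin e 1) (d / 2 / (K + 1))).
  assert (X2 := Rmin_r (Rmin e 1) (d / 2 / (K + 1))).
  assert (X3 := Rmin_l e 1). assert (X4 := Rmin_r e 1).
  specialize (C t ltac:(rewrite Rabs_pos_eq; lra)). rewrite Rplus_0_l, E in C.
  specialize (Hpsi t ltac:(lra)).
  assert (X5 : t * (K + 1) < d / 2).
  { replace (d / 2) with (d / 2 / (K + 1) * (K + 1)) by (field; lra).
    apply Rmult_lt_compat_r; lra. }
  assert (X6 : d <= Rabs (psi t - f 0) + Rabs (psi t - c)).
  { unfold d. replace (f 0 - c) with (- (psi t - f 0) + (psi t - c)) by ring.
    apply Rle_trans with (1 := Rabs_triang _ _). rewrite Rabs_Ropp. lra. }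
  lra.
Qed.

Lemma Can_real f t0 : an_at f t0 -> Can_at (fun t => RtoC (f t)) t0.
Proof. intros H. split; [exact H|exact (an_const 0 t0)]. Qed.

(** * Continuation of zeta down to 0 *)

Section ZetaZero.
Variable F : C -> C.
Hypothesis F_cont : is_continuation zeta_series F.

Let A (t : R) : R := 2 * (1 - Rpower 2 (1 - t)).

Lemma eta_factor_analytic t0 : an_at A t0.
Proof.
  apply an_mult; [apply an_const|].
  apply an_ext with (fun t => 1 + -1 * exp (ln 2 + - ln 2 * t)).
  - intros t. unfold Rpower. replace (ln 2 + - ln 2 * t) with ((1 - t) * ln 2) by ring. ring.
  - apply an_plus; [apply an_const|]. apply an_mult; [apply an_const|apply an_exp_affine].
Qed.

Lemma line_real a b t : line (RtoC a) (RtoC b) t = RtoC (a + t * b).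
Proof. unfold line. now rewrite <- RtoC_mult, <- RtoC_plus. Qed.

(** The continuation runs along [3 - t] and stops near [e' / 2], short of 0, because [eta_tail] is
    known to be analytic on the positive axis only. The point 1, where zeta has its pole, lies on
    the way and is covered by meromorphic germs. *)
Lemma eta_identity e : 0 < e ->
  exists t, 0 < t < e /\ (RtoC (A t) * F (RtoC t))%C = RtoC (1 + eta_tail t).
Proof.
  intros He0. pose (e' := Rmin e 1).
  assert (He : 0 < e' <= 1) by (split; [apply Rmin_glb_lt; lra|apply Rmin_r]).
  assert (Le : e' <= e) by apply Rmin_l.
  pose (D := fun t => (RtoC (A (3 - t)) * F (line (RtoC 3) (RtoC (-1)) t)
                       + RtoC (- (1 + eta_tail (3 - t))))%C).
  destruct (Cidentity_theorem D 0 (3 - e' / 2)) as (d & Hd & Z).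
  - lra.
  - intros t Ht. apply Cmer_plus; [apply Cmer_mult|].
    + apply Can_Cmer, (Can_real (fun t => A (3 - t))).
      apply (an_reflect A), eta_factor_analytic.
    + apply meromorphic_line; [|apply F_cont].
      intros X. apply RtoC_inj in X. lra.
    + apply Can_Cmer, (Can_real (fun t => - (1 + eta_tail (3 - t)))).
      apply an_ext with (fun t => -1 + -1 * eta_tail (3 - t)); [intros; cbn; ring|].
      apply an_plus; [apply an_const|]. apply an_mult; [apply an_const|].
      apply an_reflect, eta_tail_analytic. lra.
  - exists 1. split; [lra|]. intros x Hx.
    assert (X := Rabs_def2 x 1 ltac:(lra)).
    unfold D. rewrite line_real.
    replace (3 + (0 + x) * -1) with (3 - (0 + x)) by ring.
    set (t := 3 - (0 + x)). assert (T : 2 <= t) by (unfold t; lra).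
    destruct F_cont as [_ F2]. rewrite F2 by (cbn; lra).
    rewrite zeta_series_real, eta_tail_zr by easy.
    rewrite <- RtoC_mult, <- RtoC_plus. f_equal. unfold A. ring.
  (* Vanishing is obtained on a punctured neighbourhood, so the point is moved off [e' / 2] by [x],
     by little enough to remain positive. *)
  - pose (x := Rmin (d / 2) (e' / 4)).
    assert (X1 : 0 < x) by (apply Rmin_glb_lt; lra).
    assert (X2 : x <= d / 2) by apply Rmin_l.
    assert (X3 : x <= e' / 4) by apply Rmin_r.
    exists (e' / 2 - x). split; [lra|].
    specialize (Z x ltac:(rewrite Rabs_pos_eq; lra)).
    unfold D in Z. rewrite line_real in Z.
    replace (3 - (3 - e' / 2 + x)) with (e' / 2 - x) in Z by ring.
    replace (3 + (3 - e' / 2 + x) * -1) with (e' / 2 - x) in Z by ring.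
    rewrite RtoC_opp in Z.
    set (u := (RtoC (A _) * F _)%C) in *. set (v := RtoC (1 + _)) in *.
    replace u with ((u + - v) + v)%C by ring. rewrite Z. ring.
Qed.

(** Both alternatives of [is_continuation] at 0 in one statement. If [F] is analytic there, then
    [k = 0] and [G = F], with value [- 1 / 2]. If it had a pole, [G] would be the numerator and
    would turn out to vanish at 0, contrary to [pole_at]. The denominator 2 is [- A 0]. *)
Lemma continued_zeta_0_aux G k c :
  Can_at (fun t => G (line 0 1 t)) 0 ->
  (k = 0%nat /\ c = 1 \/ k <> 0%nat /\ c = 0) ->
  (exists d, 0 < d /\ forall t, 0 < t < d ->
     (F (RtoC t) * RtoC (t ^ k))%C = G (RtoC t)) ->
  G (RtoC 0) = RtoC (- c / 2).
Proof.
  intros [G1 G2] Hk (d & Hd & E).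
  destruct eta_tail_small as (K & K0 & HK).
  assert (A0 : A 0 = -2).
  { unfold A. rewrite Rminus_0_r, Rpower_1; lra. }
  assert (L0 : line 0 1 0 = RtoC 0) by (unfold line; ring).
  assert (L1 : forall t, line 0 1 t = RtoC t) by (intros; unfold line; ring).
  assert (Near : forall e, 0 < e -> exists t, 0 < t < e /\
     (RtoC (A t) * G (RtoC t))%C = RtoC ((1 + eta_tail t) * t ^ k)).
  { intros e He. destruct (eta_identity (Rmin e d)) as (t & Ht & H).
    { now apply Rmin_glb_lt. }
    assert (Rmin e d <= e) by apply Rmin_l. assert (Rmin e d <= d) by apply Rmin_r.
    exists t. split; [lra|]. rewrite <- E by lra. rewrite Cmult_assoc, H.
    now rewrite RtoC_mult. }
  assert (R1 : A 0 * Re (G (line 0 1 0)) = c).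
  { apply (an_value_from_right (fun t => A t * Re (G (line 0 1 t)))
      (fun t => (1 + eta_tail t) * t ^ k) c (K + 1)).
    - apply an_mult; [apply eta_factor_analytic|exact G1].
    - intros t Ht. specialize (HK t Ht).
      destruct Hk as [[-> ->]|[Hk ->]].
      + simpl. replace ((1 + eta_tail t) * 1 - 1) with (eta_tail t) by ring. nra.
      + destruct k as [|k]; [easy|]. rewrite Rminus_0_r, Rabs_mult.
        rewrite (Rabs_pos_eq (t ^ S k)) by (apply pow_le; lra).
        apply Rmult_le_compat; [apply Rabs_pos|apply pow_le; lra| |].
        * apply Rle_trans with (1 := Rabs_triang _ _). rewrite Rabs_R1. nra.
        * simpl. assert (t ^ k <= 1) by (rewrite <- (pow1 k); apply pow_incr; lra). nra.
    - intros e He. destruct (Near e He) as (t & Ht & H). exists t. split; [easy|].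
      rewrite L1. apply (f_equal Re) in H. cbn in H. rewrite <- H. unfold Re; ring. }
  assert (R2 : A 0 * Im (G (line 0 1 0)) = 0).
  { apply (an_value_from_right (fun t => A t * Im (G (line 0 1 t)))
      (fun t => 0) 0 0).
    - apply an_mult; [apply eta_factor_analytic|exact G2].
    - intros t Ht. rewrite Rminus_0_r, Rabs_R0. lra.
    - intros e He. destruct (Near e He) as (t & Ht & H). exists t. split; [easy|].
      rewrite L1. apply (f_equal Im) in H. cbn in H. rewrite <- H. unfold Im; ring. }
  rewrite L0, A0 in R1, R2. destruct (G (RtoC 0)) as [x y].
  unfold Re, Im in *; simpl in *. unfold RtoC. f_equal; lra.
Qed.

Lemma continued_zeta_0 : F (RtoC 0) = RtoC (- 1 / 2).
Proof.
  assert (L0 : line 0 1 0 = RtoC 0) by (unfold line; ring).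
  destruct (proj1 F_cont (RtoC 0)) as [H|(m & g & Hg & G0 & H)].
  - apply (continued_zeta_0_aux F 0 1).
    + apply analytic_line. now rewrite L0.
    + now left.
    + exists 1. split; [lra|]. intros t _. simpl. ring.
  - exfalso. apply G0. replace (RtoC 0) with (RtoC (- 0 / 2)) at 2 by (f_equal; field).
    apply (continued_zeta_0_aux g (S m) 0).
    + apply analytic_line. now rewrite L0.
    + now right.
    + rewrite <- L0 in H.
      destruct (pole_line_eq F g m 0 1 0 C1_nz H) as (d & Hd & E).
      exists d. split; [easy|]. intros t Ht.
      specialize (E t ltac:(rewrite Rabs_pos_eq; lra)).
      assert (L1 : line 0 1 (0 + t) = RtoC t) by (unfold line; rewrite RtoC_plus; ring).
      rewrite L1 in E. rewrite E. rewrite Cpow_1_l. field.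
Qed.
End ZetaZero.

(** * Partial fractions *)

Lemma binom_S x k : binom x (S k) = binom x k * IZR (x - Z.of_nat k) / INR (S k).
Proof. reflexivity. Qed.

Lemma binom_absorb x k : INR (S k) * binom (x + 1) (S k) = IZR (x + 1) * binom x k.
Proof.
  induction k as [|k IH].
  - simpl. rewrite Z.sub_0_r. field.
  - rewrite (binom_S _ (S k)), (binom_S x k), Nat2Z.inj_succ.
    replace (x + 1 - Z.succ (Z.of_nat k))%Z with (x - Z.of_nat k)%Z by lia.
    assert (P := pos_INR k). rewrite (S_INR (S k)), (S_INR k) in *.
    apply Rmult_eq_reg_l with (INR k + 1); [|lra].
    transitivity ((INR k + 1) * binom (x + 1) (S k) * IZR (x - Z.of_nat k)); [field; lra|].
    rewrite IH. field. lra.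
Qed.

Lemma binom_pascal x k : binom (x + 1) (S k) = binom x (S k) + binom x k.
Proof.
  assert (P := pos_INR k). apply Rmult_eq_reg_l with (INR (S k)); [|rewrite S_INR; lra].
  rewrite binom_absorb, binom_S, minus_IZR, plus_IZR, <- INR_IZR_INZ, S_INR.
  field. lra.
Qed.

Lemma binom_fact n k :
  binom (Z.of_nat (n + k)) k = INR (fact (n + k)) / (INR (fact k) * INR (fact n)).
Proof.
  revert n; induction k as [|k IH]; intros n.
  - rewrite Nat.add_0_r. simpl. field. apply INR_fact_neq_0.
  - rewrite binom_S. replace (n + S k)%nat with (S n + k)%nat by lia. rewrite IH.
    replace (Z.of_nat (S n + k) - Z.of_nat k)%Z with (Z.of_nat (S n)) by lia.
    rewrite <- INR_IZR_INZ, !fact_simpl, !mult_INR.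
    field. repeat split; try apply INR_fact_neq_0; apply not_0_INR; lia.
Qed.

Lemma binom_sym n k : binom (Z.of_nat (n + k)) k = binom (Z.of_nat (n + k)) n.
Proof.
  rewrite binom_fact, (Nat.add_comm n k), binom_fact. field.
  split; apply INR_fact_neq_0.
Qed.

Lemma binom_small_nat n k : (n < k)%nat -> binom (Z.of_nat n) k = 0.
Proof.
  induction k as [|k IH]; intros H; [lia|]. rewrite binom_S.
  destruct (Nat.eq_dec n k) as [->|].
  - rewrite Z.sub_diag. unfold Rdiv. ring.
  - rewrite IH by lia. unfold Rdiv. ring.
Qed.

(* The coefficient of [y ^ j] in the expansion of [(d + y) ^ (- b)]. *)
Definition taylor_inv (b j : nat) (d : R) : R :=
  (-1) ^ j * binom (Z.of_nat j + Z.of_nat b - 1) j * (/ d) ^ (b + j).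

Lemma taylor_inv_0 b d : taylor_inv b 0 d = (/ d) ^ b.
Proof. unfold taylor_inv. simpl binom. rewrite Nat.add_0_r. simpl. ring. Qed.

Lemma taylor_inv_order_0 j d : taylor_inv 0 (S j) d = 0.
Proof.
  unfold taylor_inv. replace (Z.of_nat (S j) + Z.of_nat 0 - 1)%Z with (Z.of_nat j) by lia.
  rewrite binom_small_nat by lia. ring.
Qed.

(** Comparison of the coefficients of [y ^ (j + 1)] in [(d + y) * (d + y) ^ (- b - 1) = (d + y) ^ (-
    b)]. *)
Lemma taylor_inv_rec b j d : d <> 0 ->
  d * taylor_inv (S b) (S j) d = taylor_inv b (S j) d - taylor_inv (S b) j d.
Proof.
  intros Hd. unfold taylor_inv.
  replace (Z.of_nat (S j) + Z.of_nat (S b) - 1)%Z with (Z.of_nat (j + b) + 1)%Z by lia.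
  replace (Z.of_nat (S j) + Z.of_nat b - 1)%Z with (Z.of_nat (j + b)) by lia.
  replace (Z.of_nat j + Z.of_nat (S b) - 1)%Z with (Z.of_nat (j + b)) by lia.
  rewrite binom_pascal. replace (S b + S j)%nat with (S (S (b + j))) by lia.
  replace (b + S j)%nat with (S (b + j)) by lia.
  replace (S b + j)%nat with (S (b + j)) by lia. cbn [pow]. field. easy.
Qed.

(** These are the residues of [y ^ (- w - 1) * (y + d) ^ (- b - 1)] at [0] and at [- d]. They cancel
    because this function is [O (y ^ (- 2))] at infinity; in coefficients this is the symmetry of
    the binomial. *)
Lemma taylor_inv_antisym b w d : d <> 0 ->
  taylor_inv (S b) w d + taylor_inv (S w) b (- d) = 0.
Proof.
  intros Hd. unfold taylor_inv.
  replace (Z.of_nat w + Z.of_nat (S b) - 1)%Z with (Z.of_nat (b + w)) by lia.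
  replace (Z.of_nat b + Z.of_nat (S w) - 1)%Z with (Z.of_nat (b + w)) by lia.
  rewrite binom_sym. rewrite Rinv_opp. replace (- / d) with ((-1) * / d) by ring.
  rewrite Rpow_mult_distr. replace (S w + b)%nat with (S (b + w)) by lia.
  replace (S b + w)%nat with (S (b + w)) by lia.
  set (y := (/ d) ^ S (b + w)). simpl pow. rewrite pow_add.
  assert (E : (-1) ^ b * (-1) ^ b = 1).
  { rewrite <- Rpow_mult_distr. replace (-1 * -1) with 1 by ring. apply pow1. }
  transitivity ((-1) ^ w * binom (Z.of_nat (b + w)) b * y * (1 - (-1) ^ b * (-1) ^ b)); [ring|].
  rewrite E. ring.
Qed.

(* The principal part at [x] of order [n] with coefficients [c 1, ..., c n];
   [c 0] is the constant term there of the function being decomposed, which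
   makes the decompositions below hold at the poles too, where [/ 0 = 0]. *)
Definition part (x : R) (n : nat) (c : nat -> R) (t : R) : R :=
  if Req_EM_T t x then - c 0%nat
  else rsum n (fun i => c (S i) * (/ (t - x)) ^ S i).

(** When the factor [(t - x + d) ^ (- b)] is split off, these are the coefficients of the product at
    the old pole [x], found by multiplication with a Taylor series; [transferred], with [- d] in
    place of [d], gives those at the new pole [x - d]. Index 0 is the constant term. *)
Definition shifted (n : nat) (c : nat -> R) (b : nat) (d : R) (i : nat) : R :=
  rsum (S n - i) (fun w => c (i + w)%nat * taylor_inv b w d).

Definition transferred (n : nat) (c : nat -> R) (b : nat) (d : R) (i : nat) : R :=
  rsum n (fun w => c (S w) * taylor_inv (S w) (b - i) d).

Section TwoPoles.
Variables d X : R.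
Hypothesis d_neq_0 : d <> 0.

(** The principal part at [Z = 0] of [Z ^ (- i) * (Z + d) ^ (- e)], with minus the constant term as
    its value at the pole. *)
Let pole_term (i e : nat) (d Z : R) : R :=
  if Req_EM_T Z 0 then - taylor_inv e i d
  else rsum i (fun j => taylor_inv e (i - S j) d * (/ Z) ^ S j).

Lemma pole_term_rec i e d' Z : d' <> 0 ->
  d' * pole_term (S i) (S e) d' Z
  = pole_term (S i) e d' Z - pole_term i (S e) d' Z.
Proof.
  intros Hd. unfold pole_term. destruct (Req_EM_T Z 0).
  - rewrite <- Ropp_mult_distr_r, taylor_inv_rec by easy. ring.
  - cbn [rsum]. rewrite Nat.sub_diag, !taylor_inv_0.
    rewrite (rsum_ext i _ (fun j => / d' * (taylor_inv e (S i - S j) d' * (/ Z) ^ S j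
      - taylor_inv (S e) (i - S j) d' * (/ Z) ^ S j))).
    + rewrite rsum_scal_l, rsum_minus. simpl pow. field. easy.
    + intros j Hj. replace (S i - S j)%nat with (S (i - S j)) by lia.
      apply Rmult_eq_reg_l with d'; [|easy].
      rewrite <- Rmult_assoc, taylor_inv_rec by easy. field. easy.
Qed.

(** Set to 0 at both poles by hand, because the induction passes through exponent 0, where
    [(/ 0) ^ 0] is 1. *)
Let product (i e : nat) : R :=
  if Req_EM_T X 0 then 0 else if Req_EM_T (X + d) 0 then 0
  else (/ X) ^ i * (/ (X + d)) ^ e.

Lemma pole_term_order_0 i d' Z :
  pole_term (S i) 0 d' Z = if Req_EM_T Z 0 then 0 else (/ Z) ^ S i.
Proof.
  unfold pole_term. destruct (Req_EM_T Z 0).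
  - rewrite taylor_inv_order_0. ring.
  - cbn [rsum]. rewrite Nat.sub_diag, taylor_inv_0, rsum_zero; [simpl; ring|].
    intros j Hj. replace (S i - S j)%nat with (S (i - S j)) by lia.
    rewrite taylor_inv_order_0. ring.
Qed.

Lemma pole_term_0 e d' Z :
  pole_term 0 e d' Z = if Req_EM_T Z 0 then - (/ d') ^ e else 0.
Proof. unfold pole_term. destruct (Req_EM_T Z 0); [now rewrite taylor_inv_0|easy]. Qed.

(** Induction on the total order by [d / (X * (X + d)) = / X - / (X + d)], a recursion that
    [pole_term_rec] reproduces on the right-hand side. The base cases have one exponent equal to
    0. *)
Lemma product_decomposition_aux i e : (0 < i + e)%nat ->
  product i e = pole_term i e d X + pole_term e i (- d) (X + d).
Proof.
  remember (i + e)%nat as n eqn:En. revert i e En.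
  induction n as [|n IH]; intros i e En Hn; [lia|].
  destruct i as [|i]; [destruct e as [|e]; [lia|]|destruct e as [|e]].
  - rewrite pole_term_0, pole_term_order_0. unfold product.
    destruct (Req_EM_T X 0) as [HX|HX], (Req_EM_T (X + d) 0) as [HY|HY].
    + exfalso; lra.
    + replace (X + d) with d by lra. ring.
    + ring.
    + simpl; ring.
  - rewrite pole_term_0, pole_term_order_0. unfold product.
    destruct (Req_EM_T X 0) as [HX|HX], (Req_EM_T (X + d) 0) as [HY|HY].
    + exfalso; lra.
    + ring.
    + replace (- d) with X by lra. ring.
    + simpl; ring.
  - apply Rmult_eq_reg_l with d; [|easy].
    rewrite Rmult_plus_distr_l, pole_term_rec by easy.
    replace (d * pole_term (S e) (S i) (- d) (X + d))
      with (- (- d * pole_term (S e) (S i) (- d) (X + d))) by ring.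
    rewrite pole_term_rec by lra.
    assert (H1 := IH (S i) e ltac:(lia) ltac:(lia)).
    assert (H2 := IH i (S e) ltac:(lia) ltac:(lia)).
    transitivity (product (S i) e - product i (S e)); [|rewrite H1, H2; ring].
    unfold product. destruct (Req_EM_T X 0); [ring|].
    destruct (Req_EM_T (X + d) 0); [ring|]. simpl. field. split; easy.
Qed.

(** For positive exponents the convention [/ 0 = 0] agrees with the values put into [product] by
    hand. *)
Lemma product_decomposition i e : (0 < i)%nat -> (0 < e)%nat ->
  (/ X) ^ i * (/ (X + d)) ^ e = pole_term i e d X + pole_term e i (- d) (X + d).
Proof.
  intros Hi He. rewrite <- product_decomposition_aux by lia. unfold product.
  destruct (Req_EM_T X 0) as [HX|HX].
  - rewrite HX, Rinv_0, (pow_i i) by easy. ring.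
  - destruct (Req_EM_T (X + d) 0) as [HY|HY]; [|easy].
    rewrite HY, Rinv_0, (pow_i e) by easy. ring.
Qed.
End TwoPoles.

Lemma rsum_triangle n (f : nat -> nat -> R) :
  rsum n (fun j => rsum (n - j) (fun w => f (j + w)%nat j))
  = rsum n (fun i => rsum (S i) (fun j => f i j)).
Proof.
  induction n as [|n IH]; [easy|].
  change (rsum (S n) (fun i => rsum (S i) (fun j => f i j)))
    with (rsum n (fun i => rsum (S i) (fun j => f i j)) + rsum (S n) (fun j => f n j)).
  rewrite <- IH.
  rewrite (rsum_ext (S n) _ (fun j => rsum (n - j) (fun w => f (j + w)%nat j) + f n j)).
  - rewrite rsum_plus. f_equal. cbn [rsum]. rewrite Nat.sub_diag. cbn [rsum]. ring.
  - intros j Hj. replace (S n - j)%nat with (S (n - j)) by lia. cbn [rsum].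
    replace (j + (n - j))%nat with n by lia. easy.
Qed.

Lemma part_step x n c b e t : x <> b -> (0 < e)%nat ->
  part x n (shifted n c e (x - b)) t + part b e (transferred n c e (b - x)) t
  = part x n c t * (/ (t - b)) ^ e.
Proof.
  intros Hx He. set (d := x - b). assert (Hd : d <> 0) by (unfold d; lra).
  replace (b - x) with (- d) by (unfold d; ring).
  set (X := t - x). replace (t - b) with (X + d) by (unfold X, d; ring).
  (* At [X = 0] all powers of [/ 0] vanish, so the value at the pole can be carried as a separate
     summand. *)
  assert (E : part x n c t = rsum n (fun i => c (S i) * (/ X) ^ S i)
     + (if Req_EM_T X 0 then - c 0%nat else 0)).
  { unfold part. fold X. destruct (Req_EM_T t x) as [Ht|Ht], (Req_EM_T X 0) as [HX|HX];
      try (unfold X in HX; lra).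
    rewrite HX, Rinv_0, rsum_zero; [ring|]. intros i _. rewrite pow_i by lia. ring. }
  rewrite E, Rmult_plus_distr_r, <- rsum_scal_r.
  rewrite (rsum_ext n _ (fun i => c (S i) *
     (if Req_EM_T X 0 then - taylor_inv e (S i) d
      else rsum (S i) (fun j => taylor_inv e (S i - S j) d * (/ X) ^ S j))
     + c (S i) *
     (if Req_EM_T (X + d) 0 then - taylor_inv (S i) e (- d)
      else rsum e (fun j => taylor_inv (S i) (e - S j) (- d) * (/ (X + d)) ^ S j)))).
  2:{ intros i _. rewrite Rmult_assoc, (product_decomposition d X Hd) by lia. ring. }
  rewrite rsum_plus.
  transitivity (rsum n (fun i => c (S i) *
     (if Req_EM_T X 0 then - taylor_inv e (S i) d
      else rsum (S i) (fun j => taylor_inv e (S i - S j) d * (/ X) ^ S j)))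
     + (if Req_EM_T X 0 then - c 0%nat else 0) * (/ (X + d)) ^ e
     + rsum n (fun i => c (S i) *
     (if Req_EM_T (X + d) 0 then - taylor_inv (S i) e (- d)
      else rsum e (fun j => taylor_inv (S i) (e - S j) (- d) * (/ (X + d)) ^ S j))));
    [|ring].
  f_equal.
  - unfold part. fold X. destruct (Req_EM_T t x) as [Ht|Ht], (Req_EM_T X 0) as [HX|HX];
      try (unfold X in HX; lra).
    + rewrite HX, Rplus_0_l. unfold shifted. rewrite Nat.sub_0_r, rsum_first.
      rewrite taylor_inv_0. cbn [Nat.add].
      rewrite (rsum_ext n (fun i => c (S i) * - taylor_inv e (S i) d)
        (fun i => (-1) * (c (S i) * taylor_inv e (S i) d))) by (intros; ring).
      rewrite rsum_scal_l. ring.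
    + rewrite Rmult_0_l, Rplus_0_r.
      rewrite (rsum_ext n _ (fun j => rsum (n - j) (fun w =>
        c (S (j + w)) * (taylor_inv e (S (j + w) - S j) d * (/ X) ^ S j)))).
      * rewrite (rsum_triangle n (fun i j => c (S i) * (taylor_inv e (S i - S j) d * (/ X) ^ S j))).
        apply rsum_ext. intros i _. now rewrite rsum_scal_l.
      * intros j _. unfold shifted. rewrite <- rsum_scal_r. apply rsum_ext. intros w _.
        replace (S (j + w) - S j)%nat with w by lia. simpl. ring.
  - unfold part. replace (t - b) with (X + d) by (unfold X, d; ring).
    destruct (Req_EM_T t b) as [Ht|Ht], (Req_EM_T (X + d) 0) as [HX|HX];
      try (unfold X, d in HX; lra).
    + unfold transferred. rewrite Nat.sub_0_r.
      rewrite (rsum_ext n (fun i => c (S i) * - taylor_inv (S i) e (- d))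
        (fun i => (-1) * (c (S i) * taylor_inv (S i) e (- d)))) by (intros; ring).
      rewrite rsum_scal_l. ring.
    + unfold transferred.
      rewrite (rsum_ext e _ (fun j => rsum n (fun w =>
        c (S w) * (taylor_inv (S w) (e - S j) (- d) * (/ (X + d)) ^ S j)))).
      * rewrite rsum_swap. apply rsum_ext. intros i _. now rewrite rsum_scal_l.
      * intros j _. rewrite <- rsum_scal_r. apply rsum_ext. intros w _. ring.
Qed.

(** Cancellation is termwise: as [e] is positive, each [(t - x) ^ (- w - 1)] times the new factor
    has residues with sum 0, by [taylor_inv_antisym]. *)
Lemma residue_cancel n c e d : d <> 0 -> (0 < e)%nat ->
  shifted n c e d 1 + transferred n c e (- d) 1 = 0.
Proof.
  intros Hd He. unfold shifted, transferred.
  replace (S n - 1)%nat with n by lia. rewrite <- rsum_plus.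
  apply rsum_zero. intros w _. destruct e as [|e]; [lia|].
  replace (S e - 1)%nat with e by lia. change (1 + w)%nat with (S w).
  rewrite <- Rmult_plus_distr_l, taylor_inv_antisym by easy. ring.
Qed.

Lemma part_delta x n t : (0 < n)%nat ->
  part x n (fun i => if Nat.eqb i n then 1 else 0) t = (/ (t - x)) ^ n.
Proof.
  intros Hn. unfold part. destruct (Req_EM_T t x) as [->|Ht].
  - rewrite Rminus_diag, Rinv_0, pow_i by easy. destruct n; [lia|]. simpl. ring.
  - destruct n as [|n]; [lia|]. cbn [rsum]. rewrite Nat.eqb_refl, rsum_zero; [ring|].
    intros i Hi. replace (S i =? S n)%nat with false by (symmetry; apply Nat.eqb_neq; lia).
    ring.
Qed.

(** * Symmetric sums over the integers *)

Definition window (A B : nat) (h : Z -> R) : R :=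
  h 0%Z + rsum A (fun k => h (Z.of_nat (S k))) + rsum B (fun k => h (- Z.of_nat (S k))%Z).

Lemma window_ext A B h h' : (forall z, h z = h' z) -> window A B h = window A B h'.
Proof. intros H. unfold window. rewrite H. f_equal; [f_equal|]; now apply rsum_ext. Qed.

Lemma window_shift_1 A B h :
  window A (S B) (fun z => h (z + 1)%Z) = window (S A) B h.
Proof.
  unfold window. rewrite (rsum_first B), (rsum_first A).
  change (- Z.of_nat 1 + 1)%Z with 0%Z. change (0 + 1)%Z with (Z.of_nat 1).
  rewrite (rsum_ext A (fun k => h (Z.of_nat (S k) + 1)%Z) (fun i => h (Z.of_nat (S (S i)))))
    by (intros; f_equal; lia).
  rewrite (rsum_ext B (fun k => h (- Z.of_nat (S (S k)) + 1)%Z) (fun i => h (- Z.of_nat (S i))%Z))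
    by (intros; f_equal; lia). ring.
Qed.

Lemma window_shift a A B h : (a <= B)%nat ->
  window A B (fun z => h (z + Z.of_nat a)%Z) = window (A + a) (B - a) h.
Proof.
  revert A B; induction a as [|a IH]; intros A B Ha.
  - rewrite Nat.add_0_r, Nat.sub_0_r. apply window_ext. intros; f_equal; lia.
  - destruct B as [|B]; [lia|].
    rewrite (window_ext _ _ _ (fun z => (fun y => h (y + Z.of_nat a)%Z) (z + 1)%Z))
      by (intros; f_equal; lia).
    rewrite (window_shift_1 A B (fun y => h (y + Z.of_nat a)%Z)), IH by lia. f_equal; lia.
Qed.

Lemma window_rsum A B n (h : nat -> Z -> R) :
  window A B (fun z => rsum n (fun i => h i z)) = rsum n (fun i => window A B (h i)).
Proof.
  unfold window. rewrite !rsum_plus. f_equal; [f_equal|]; apply rsum_swap.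
Qed.

Lemma window_scal A B c h : window A B (fun z => c * h z) = c * window A B h.
Proof. unfold window. rewrite !rsum_scal_l. ring. Qed.

Lemma window_plus A B h h' :
  window A B (fun z => h z + h' z) = window A B h + window A B h'.
Proof. unfold window. rewrite !rsum_plus. ring. Qed.

Lemma is_lim_seq_rsum n (f : nat -> nat -> R) (l : nat -> R) :
  (forall i, (i < n)%nat -> is_lim_seq (f i) (l i)) ->
  is_lim_seq (fun M => rsum n (fun i => f i M)) (rsum n l).
Proof.
  induction n as [|n IH]; intros H; simpl; [apply is_lim_seq_const|].
  apply is_lim_seq_plus'; [apply IH; intros; apply H; lia|apply H; lia].
Qed.

Lemma is_lim_seq_scal (c : R) (f : nat -> R) (l : R) :
  is_lim_seq f l -> is_lim_seq (fun n => c * f n) (c * l).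
Proof. intros H. apply (is_lim_seq_scal_l f c l H). Qed.

(** For exponent 1 neither side of the sum converges by itself, but sides that differ by a bounded
    number of terms still have the symmetric limit. *)
Lemma rsum_overhang (f : nat -> R) a : is_lim_seq f 0 ->
  is_lim_seq (fun M => rsum (M + a) f - rsum M f) 0.
Proof.
  intros H. apply is_lim_seq_ext with (fun M => rsum a (fun i => f (M + i)%nat)).
  - intros M. rewrite rsum_app. ring.
  - rewrite <- (rsum_zero a (fun _ => 0)) by easy.
    apply (is_lim_seq_rsum a (fun i M => f (M + i)%nat)).
    intros i _. now apply is_lim_seq_incr_n.
Qed.

Lemma inv_pow_null i : is_lim_seq (fun k => (/ INR (S k)) ^ S i) 0.
Proof.
  assert (H : is_lim_seq (fun k => / INR (S k)) 0).
  { apply (is_lim_seq_incr_1 (fun k => / INR k)).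
    replace (Finite 0) with (Rbar_inv p_infty) by easy.
    apply is_lim_seq_inv; [apply is_lim_seq_INR|easy]. }
  apply (is_lim_seq_le_le (fun _ => 0) _ (fun k => / INR (S k))); try easy.
  - intros k. assert (X := inv_INR_S_le_1 k). set (y := / INR (S k)) in *.
    split; [apply pow_le; lra|]. simpl.
    assert (y ^ i <= 1) by (rewrite <- (pow1 i); apply pow_incr; lra).
    assert (0 <= y ^ i) by (apply pow_le; lra). nra.
  - apply is_lim_seq_const.
Qed.

(* Half of the sum of [z ^ (- 2 k)] over the nonzero integers [z]; the value
   at [0] is [zeta 0]. *)
Definition zeven (k : nat) : R :=
  match k with O => - 1 / 2 | _ => zr (INR (2 * k)) end.

Lemma dirichlet_nat i n : dirichlet (INR i) n = (/ INR (S n)) ^ i.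
Proof. unfold dirichlet. rewrite Rpower_pow by apply INR_S_pos. now rewrite pow_inv. Qed.

Lemma lim_inv_pow_even k :
  is_lim_seq (fun M => rsum M (fun n => (/ INR (S n)) ^ (2 * S k))) (zeven (S k)).
Proof.
  assert (H : 2 <= INR (2 * S k)) by (apply (le_INR 2); lia).
  apply is_lim_seq_ext with (fun M => rsum M (dirichlet (INR (2 * S k)))).
  - intros M. apply rsum_ext. intros i _. apply dirichlet_nat.
  - apply Series_is_lim_rsum. now apply ex_dirichlet.
Qed.

Lemma lim_inv_odd_pow_even k :
  is_lim_seq (fun M => rsum M (fun n => (/ INR (S (2 * n))) ^ (2 * S k)))
    ((1 - / 2 ^ (2 * S k)) * zeven (S k)).
Proof.
  assert (H : 2 <= INR (2 * S k)) by (apply (le_INR 2); lia).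
  destruct (Series_dirichlet_odd _ H) as [E S].
  rewrite Rpower_pow in S by lra. cbn [zeven]. rewrite <- S.
  apply is_lim_seq_ext with (fun M => rsum M (fun j => dirichlet (INR (2 * Datatypes.S k)) (2 * j))).
  - intros M. apply rsum_ext. intros i _. apply dirichlet_nat.
  - now apply Series_is_lim_rsum.
Qed.

Lemma even_S_double k : Nat.even (S (2 * k)) = false.
Proof. now rewrite Nat.even_succ, Nat.odd_even. Qed.

Lemma pow_opp_even x k : (- x) ^ (2 * k) = x ^ (2 * k).
Proof. rewrite !pow_mult. f_equal. ring. Qed.

Lemma pow_opp_odd x k : (- x) ^ S (2 * k) = - x ^ S (2 * k).
Proof. rewrite <- !tech_pow_Rmult, pow_opp_even. ring. Qed.

Lemma even_or_odd i : (exists k, i = 2 * k)%nat \/ (exists k, i = S (2 * k))%nat.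
Proof. destruct (Nat.Even_or_Odd i) as [[k H]|[k H]]; [left|right]; exists k; lia. Qed.

Definition two_sided (A B : nat) (f : nat -> R) (i : nat) : R :=
  rsum A (fun n => (f n) ^ i) + rsum B (fun n => (- f n) ^ i).


Lemma lim_two_sided a b i : (0 < i)%nat ->
  is_lim_seq (fun M => two_sided (M + a) (M + b) (fun n => / INR (S n)) i)
    (Finite (if Nat.even i then 2 * zeven (Nat.div2 i) else 0)).
Proof.
  intros Hi. unfold two_sided. destruct (even_or_odd i) as [[k ->]|[k ->]].
  - destruct k as [|k]; [lia|].
    rewrite Nat.even_even, Nat.div2_double.
    apply is_lim_seq_ext with (fun M =>
      rsum (M + a) (fun n => (/ INR (S n)) ^ (2 * S k))
      + rsum (M + b) (fun n => (/ INR (S n)) ^ (2 * S k))).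
    + intros M. f_equal. apply rsum_ext. intros n _. now rewrite pow_opp_even.
    + replace (2 * zeven (S k)) with (zeven (S k) + zeven (S k)) by ring.
      apply is_lim_seq_plus';
        [apply (is_lim_seq_incr_n (fun M => rsum M _))|apply (is_lim_seq_incr_n (fun M => rsum M _))];
        apply lim_inv_pow_even.
  - rewrite even_S_double.
    pose (f := fun n => (/ INR (S n)) ^ S (2 * k)).
    apply is_lim_seq_ext with (fun M =>
      (rsum (M + a) f - rsum M f) - (rsum (M + b) f - rsum M f)).
    + intros M. rewrite (rsum_ext (M + b) (fun n => (- / INR (S n)) ^ S (2 * k))
        (fun n => (-1) * f n)).
      * rewrite rsum_scal_l. unfold f. ring.
      * intros n _. rewrite pow_opp_odd. unfold f. ring.
    + replace 0 with (0 - 0) by ring.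
      apply is_lim_seq_minus'; apply rsum_overhang, inv_pow_null.
Qed.

Lemma lim_two_sided_odd i : (0 < i)%nat ->
  is_lim_seq (fun M => two_sided M M (fun n => / INR (S (2 * n))) i)
    (Finite (if Nat.even i then 2 * ((1 - / 2 ^ i) * zeven (Nat.div2 i)) else 0)).
Proof.
  intros Hi. unfold two_sided. destruct (even_or_odd i) as [[k ->]|[k ->]].
  - destruct k as [|k]; [lia|].
    rewrite Nat.even_even, Nat.div2_double.
    set (l := (1 - / 2 ^ (2 * S k)) * zeven (S k)).
    apply is_lim_seq_ext with (fun M =>
      rsum M (fun n => (/ INR (S (2 * n))) ^ (2 * S k))
      + rsum M (fun n => (/ INR (S (2 * n))) ^ (2 * S k))).
    + intros M. f_equal. apply rsum_ext. intros n _. now rewrite pow_opp_even.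
    + replace (2 * l) with (l + l) by ring.
      apply is_lim_seq_plus'; apply lim_inv_odd_pow_even.
  - rewrite even_S_double.
    apply is_lim_seq_ext with (fun _ => 0); [|apply is_lim_seq_const].
    intros M. rewrite <- rsum_plus. symmetry. apply rsum_zero.
    intros n _. rewrite pow_opp_odd. ring.
Qed.

(** The separate [g 0] becomes the term [k = 0]; for integer poles it is the value of the family at
    its pole. *)
Lemma rsum_even n (g : nat -> R) :
  rsum n (fun i => if Nat.even (S i) then g (S i) else 0) + g 0%nat
  = rsum (S (n / 2)) (fun k => g (2 * k)%nat).
Proof.
  assert (H : forall m, rsum (2 * m) (fun i => if Nat.even (S i) then g (S i) else 0) + g 0%nat
     = rsum (S m) (fun k => g (2 * k)%nat)).
  { induction m as [|m IH]; [simpl; ring|].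
    replace (2 * S m)%nat with (S (S (2 * m))) at 1 by lia. cbn [rsum].
    replace (S (S (2 * m))) with (2 * S m)%nat by lia. rewrite Nat.even_even.
    rewrite even_S_double.
    cbn [rsum] in IH. lra. }
  destruct (even_or_odd n) as [[m ->]|[m ->]].
  - rewrite H. replace (2 * m / 2)%nat with m; [easy|].
    rewrite Nat.mul_comm, Nat.div_mul; lia.
  - replace (S (2 * m) / 2)%nat with m.
    + rewrite <- H. cbn [rsum].
      rewrite even_S_double. ring.
    + symmetry. replace (S (2 * m)) with (1 + m * 2)%nat by lia.
      rewrite Nat.div_add by lia. easy.
Qed.

Lemma window_inv_pow A B i y : (0 < i)%nat ->
  window A B (fun z => (y * / IZR z) ^ i)
  = y ^ i * two_sided A B (fun n => / INR (S n)) i.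
Proof.
  intros Hi. unfold window, two_sided. rewrite Rinv_0, Rmult_0_r, pow_i by easy.
  rewrite Rmult_plus_distr_l, <- !rsum_scal_l, Rplus_0_l. f_equal; apply rsum_ext; intros n _.
  - rewrite <- INR_IZR_INZ. apply Rpow_mult_distr.
  - rewrite opp_IZR, <- INR_IZR_INZ, Rinv_opp. apply Rpow_mult_distr.
Qed.

(** The powers [y ^ (2 k)] come from [t = z / y]. [kappa] is 1 for a pole at an integer [z], and
    [2 ^ (2 k) - 1] at a half-integer, which is the ratio for [k >= 1] of the sums of [z ^ (- 2 k)]
    over all half-integers and over all nonzero integers. *)
Definition part_value (n : nat) (c : nat -> R) (y : R) (kappa : nat -> R) : R :=
  rsum (S (n / 2)) (fun k => 2 * zeven k * y ^ (2 * k) * c (2 * k)%nat * kappa k).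

Lemma lim_window_part_integer n c (N a : nat) :
  (0 < N)%nat -> (a <= 3 * N)%nat ->
  is_lim_seq (fun M => window M (3 * N + M)
     (fun z => part (- (INR a / INR N)) n c (IZR z / INR N)))
    (part_value n c (INR N) (fun _ => 1)).
Proof.
  intros HN Ha. assert (P : 0 < INR N) by now apply lt_0_INR.
  pose (h := fun z => (if Z.eq_dec z 0 then - c 0%nat else 0)
     + rsum n (fun i => c (S i) * (INR N * / IZR z) ^ S i)).
  (* Translation by [a] moves the pole to 0 and leaves overhangs [a] and [3 N - a], independent of
     [M]. *)
  apply is_lim_seq_ext with (fun M => window (M + a) (M + (3 * N - a)) h).
  { intros M. replace (M + (3 * N - a))%nat with (3 * N + M - a)%nat by lia.
    rewrite <- window_shift by lia. apply window_ext. intros z. unfold part, h.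
    assert (E : IZR z / INR N - - (INR a / INR N) = IZR (z + Z.of_nat a) / INR N).
    { rewrite plus_IZR, <- INR_IZR_INZ. field. lra. }
    rewrite E.
    destruct (Z.eq_dec (z + Z.of_nat a) 0) as [Z0|Z0], (Req_EM_T (IZR z / INR N) (- (INR a / INR N))) as [X|X].
    - rewrite Z0, Rinv_0, rsum_zero; [ring|]. intros i _. rewrite Rmult_0_r, pow_i by lia. ring.
    - exfalso. apply X. apply Rminus_diag_uniq. rewrite E, Z0. unfold Rdiv. ring.
    - exfalso. apply Z0, eq_IZR. apply Rminus_diag_eq in X. rewrite E in X.
      apply Rmult_integral in X. destruct X as [X|X]; [easy|].
      exfalso. revert X. apply Rinv_neq_0_compat. lra.
    - rewrite Rplus_0_l. apply rsum_ext. intros i _. f_equal. f_equal.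
      unfold Rdiv. rewrite Rinv_mult, Rinv_inv. ring. }
  replace (part_value n c (INR N) (fun _ => 1)) with
    (- c 0%nat + rsum n (fun i => c (S i) * (INR N ^ S i *
       (if Nat.even (S i) then 2 * zeven (Nat.div2 (S i)) else 0)))).
  - apply is_lim_seq_ext with (fun M => - c 0%nat + rsum n (fun i => c (S i) * (INR N ^ S i *
       two_sided (M + a) (M + (3 * N - a)) (fun n => / INR (S n)) (S i)))).
    + intros M. unfold h. rewrite window_plus, window_rsum. f_equal.
      * unfold window. destruct (Z.eq_dec 0 0); [|easy].
        rewrite !rsum_zero; [ring| |]; intros i _;
          destruct (Z.eq_dec _ 0); try easy; lia.
      * apply rsum_ext. intros i _. rewrite window_scal. now rewrite window_inv_pow by lia.
    + apply is_lim_seq_plus'; [apply is_lim_seq_const|].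
      apply (is_lim_seq_rsum n (fun i M => c (S i) * (INR N ^ S i *
        two_sided (M + a) (M + (3 * N - a)) (fun n => / INR (S n)) (S i)))).
      intros i _. apply is_lim_seq_scal, is_lim_seq_scal, lim_two_sided. lia.
  - unfold part_value.
    pose (G := fun i => c i * (INR N ^ i * (2 * zeven (Nat.div2 i)))).
    rewrite (rsum_ext (S (n / 2)) _ (fun k => G (2 * k)%nat)).
    + rewrite <- (rsum_even n G). unfold G. rewrite Rplus_comm. f_equal.
      * apply rsum_ext. intros i _. destruct (Nat.even (S i)); ring.
      * simpl. field.
    + intros k _. unfold G. rewrite Nat.div2_double. ring.
Qed.

Lemma lim_window_part_half n c (N : nat) :
  Nat.odd N = true ->
  is_lim_seq (fun M => window M (3 * N + M)
     (fun z => part (- (3 / 2)) n c (IZR z / INR N)))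
    (part_value n c (INR N) (fun k => 2 ^ (2 * k) - 1)).
Proof.
  intros Hodd.
  destruct (proj1 (Nat.odd_spec N) Hodd) as [g Hg].
  assert (HN : (0 < N)%nat) by lia.
  assert (P : 0 < INR N) by now apply lt_0_INR.
  (* [a = (3 N - 1) / 2]: the translated pole is [- 1 / 2], and the translated window is symmetric
     about it. *)
  pose (a := (3 * g + 1)%nat). assert (A : (3 * N = 2 * a + 1)%nat) by (unfold a; lia).
  assert (AR : 3 * INR N = 2 * INR a + 1).
  { replace 3 with (INR 3) by (simpl; ring). rewrite <- mult_INR, A, plus_INR, mult_INR.
    simpl; ring. }
  pose (h := fun z => rsum n (fun i => c (S i) * (2 * INR N * / IZR (2 * z + 1)) ^ S i)).
  assert (W : forall A f, window A (S A) (fun z => f (2 * z + 1)%Z)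
     = rsum (S A) (fun k => f (Z.of_nat (S (2 * k)))) + rsum (S A) (fun k => f (- Z.of_nat (S (2 * k)))%Z)).
  { intros B f. unfold window. rewrite (rsum_first B (fun k => f (Z.of_nat (S (2 * k))))).
    f_equal; [f_equal|]; try apply rsum_ext; intros; f_equal; lia. }
  apply is_lim_seq_ext with (fun M => window (M + a) (S (M + a)) h).
  { intros M. replace (S (M + a)) with (3 * N + M - a)%nat by lia.
    rewrite <- window_shift by lia. apply window_ext. intros z. unfold part, h.
    assert (E : IZR z / INR N - - (3 / 2) = IZR (2 * (z + Z.of_nat a) + 1) / (2 * INR N)).
    { rewrite plus_IZR, mult_IZR, plus_IZR, <- INR_IZR_INZ.
      replace (2 * (IZR z + INR a) + 1) with (2 * IZR z + 3 * INR N) by lra. field. lra. }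
    rewrite E. destruct (Req_EM_T (IZR z / INR N) (- (3 / 2))) as [X|X].
    - exfalso. apply Rminus_diag_eq in X. rewrite E in X.
      apply Rmult_integral in X. destruct X as [X|X].
      + apply eq_IZR in X. lia.
      + revert X. apply Rinv_neq_0_compat. lra.
    - apply rsum_ext. intros i _. f_equal. f_equal.
      unfold Rdiv. rewrite Rinv_mult, Rinv_inv. ring. }
  replace (part_value n c (INR N) _) with
    (rsum n (fun i => c (S i) * ((2 * INR N) ^ S i *
       (if Nat.even (S i) then 2 * ((1 - / 2 ^ S i) * zeven (Nat.div2 (S i))) else 0)))).
  - apply is_lim_seq_ext with (fun M => rsum n (fun i => c (S i) * ((2 * INR N) ^ S i *
       two_sided (M + S a) (M + S a) (fun n => / INR (S (2 * n))) (S i)))).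
    + intros M. unfold h. rewrite window_rsum. apply rsum_ext. intros i _.
      rewrite window_scal. f_equal.
      rewrite (W (M + a)%nat (fun z => (2 * INR N * / IZR z) ^ S i)).
      unfold two_sided. rewrite Rmult_plus_distr_l, <- !rsum_scal_l.
      replace (M + S a)%nat with (S (M + a)) by lia.
      f_equal; apply rsum_ext; intros k _.
      * rewrite <- INR_IZR_INZ. symmetry. apply Rpow_mult_distr.
      * rewrite opp_IZR, <- INR_IZR_INZ, Rinv_opp. symmetry. apply Rpow_mult_distr.
    + apply (is_lim_seq_rsum n (fun i M => c (S i) * ((2 * INR N) ^ S i *
        two_sided (M + S a) (M + S a) (fun n => / INR (S (2 * n))) (S i)))).
      intros i _. apply is_lim_seq_scal, is_lim_seq_scal.
      apply (is_lim_seq_incr_n (fun M => two_sided M M _ _)). apply lim_two_sided_odd. lia.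
  - unfold part_value.
    (* No integer hits the pole, and accordingly [G 0 = 0], from the factor [1 - / 2 ^ 0]. *)
    pose (G := fun i => c i * ((2 * INR N) ^ i *
      (2 * ((1 - / 2 ^ i) * zeven (Nat.div2 i))))).
    rewrite (rsum_ext (S (n / 2)) _ (fun k => G (2 * k)%nat)).
    + rewrite <- (rsum_even n G). unfold G. rewrite <- (Rplus_0_r (rsum n _)) at 1. f_equal.
      * apply rsum_ext. intros i _. destruct (Nat.even (S i)); ring.
      * simpl. field.
    + intros k _. unfold G. rewrite Nat.div2_double, Rpow_mult_distr. field.
      apply pow_nonzero. lra.
Qed.

(** * The six Weyl chambers *)

(** Numbered like the [I_j]: before the factor at [- 3 / 2] is split off, family [j] sits at the
    pole [- pole_index j]. *)
Definition pole_index (j : nat) : nat :=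
  match j with 1 => 0 | 3 => 1 | 5 | 7 => 2 | _ => 3 end%nat.

Definition pole_order (p q r u j : nat) : nat :=
  match j with 1 => p | 3 => q | 5 | 7 => r | _ => u end%nat.

Definition coef2 (p q : nat) (first : bool) : nat -> R :=
  let delta := fun i => if Nat.eqb i p then 1 else 0 in
  if first then shifted p delta q 1 else transferred p delta q (- (1)).

(** Each family records its history: [shifted] where it stays at its pole, [transferred] where it
    moves to the pole just added. The poles [- 1], [- 2], [- 3] are added in this order. *)
Definition coef4 (p q r u j : nat) : nat -> R :=
  match j with
  | 1 => shifted p (shifted p (coef2 p q true) r 2) u 3
  | 2 => transferred p (shifted p (coef2 p q true) r 2) u (- (3))
  | 3 => shifted q (shifted q (coef2 p q false) r 1) u 2
  | 4 => transferred q (shifted q (coef2 p q false) r 1) u (- (2))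
  | 5 => shifted r (transferred p (coef2 p q true) r (- (2))) u 1
  | 6 => transferred r (transferred p (coef2 p q true) r (- (2))) u (- (1))
  | 7 => shifted r (transferred q (coef2 p q false) r (- (1))) u 1
  | _ => transferred r (transferred q (coef2 p q false) r (- (1))) u (- (1))
  end%nat.

Definition pole_dist (j : nat) : R := 3 / 2 - INR (pole_index j).

Definition coefA (p q r u v j : nat) : nat -> R :=
  shifted (pole_order p q r u j) (coef4 p q r u j) v (pole_dist j).

Definition coefB (p q r u v j : nat) : nat -> R :=
  transferred (pole_order p q r u j) (coef4 p q r u j) v (- pole_dist j).

Definition ratfun (p q r u v : nat) (t : R) : R :=
  (/ t) ^ p * (/ (t + 1)) ^ q * (/ (t + 2)) ^ r * (/ (t + 3)) ^ u * (/ (t + 3 / 2)) ^ v.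

Lemma part_step_at x n c b e d t : x - b = d -> d <> 0 -> (0 < e)%nat ->
  part x n c t * (/ (t - b)) ^ e =
  part x n (shifted n c e d) t + part b e (transferred n c e (- d)) t.
Proof.
  intros <- Hd He. replace (- (x - b)) with (b - x) by ring.
  symmetry. apply part_step; [lra|easy].
Qed.

(** Starting from the single family [t ^ (- p)] at 0, each of the four further factors doubles the
    number of families. *)
Lemma ratfun_parts p q r u v t :
  (0 < p)%nat -> (0 < q)%nat -> (0 < r)%nat -> (0 < u)%nat -> (0 < v)%nat ->
  ratfun p q r u v t = rsum 8 (fun i =>
    part (- INR (pole_index (S i))) (pole_order p q r u (S i)) (coefA p q r u v (S i)) t
    + part (- (3 / 2)) v (coefB p q r u v (S i)) t).
Proof.
  intros Hp Hq Hr Hu Hv. unfold ratfun.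
  replace (/ t) with (/ (t - (- INR 0))) by (f_equal; simpl; ring).
  replace (t + 1) with (t - (- INR 1)) by (simpl; ring).
  replace (t + 2) with (t - (- INR 2)) by (simpl; ring).
  replace (t + 3) with (t - (- INR 3)) by (simpl; ring).
  replace (t + 3 / 2) with (t - (- (3 / 2))) by ring.
  rewrite <- (part_delta (- INR 0) p t Hp).
  rewrite (part_step_at _ _ _ (- INR 1) q 1) by (try easy; simpl; lra).
  rewrite Rmult_plus_distr_r.
  rewrite (part_step_at _ p _ (- INR 2) r 2) by (try easy; simpl; lra).
  rewrite (part_step_at _ q _ (- INR 2) r 1) by (try easy; simpl; lra).
  rewrite !Rmult_plus_distr_r.
  rewrite (part_step_at (- INR 0) p _ (- INR 3) u 3) by (try easy; simpl; lra).
  rewrite (part_step_at (- INR 1) q _ (- INR 3) u 2) by (try easy; simpl; lra).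
  rewrite !(part_step_at (- INR 2) r _ (- INR 3) u 1) by (try easy; simpl; lra).
  rewrite !Rmult_plus_distr_r.
  rewrite (part_step_at (- INR 0) p _ (- (3 / 2)) v (pole_dist 1))
    by (try easy; unfold pole_dist; simpl; lra).
  rewrite (part_step_at (- INR 1) q _ (- (3 / 2)) v (pole_dist 3))
    by (try easy; unfold pole_dist; simpl; lra).
  rewrite !(part_step_at (- INR 2) r _ (- (3 / 2)) v (pole_dist 5))
    by (try easy; unfold pole_dist; simpl; lra).
  rewrite !(part_step_at (- INR 3) u _ (- (3 / 2)) v (pole_dist 2))
    by (try easy; unfold pole_dist; simpl; lra).
  cbn [rsum]. unfold coefA, coefB.
  cbn [pole_order pole_index coef4]. unfold coef2.
  change (pole_dist 4) with (pole_dist 2). change (pole_dist 6) with (pole_dist 2).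
  change (pole_dist 8) with (pole_dist 2). change (pole_dist 7) with (pole_dist 5).
  ring.
Qed.

Definition parity_factor (N k : nat) : R := if Nat.even N then 1 else 2 ^ (2 * k) - 1.

Definition ratfun_value (p q r u v N : nat) : R :=
  rsum 8 (fun i =>
    part_value (pole_order p q r u (S i)) (coefA p q r u v (S i)) (INR N) (fun _ => 1)
    + part_value v (coefB p q r u v (S i)) (INR N) (parity_factor N)).

Lemma part_value_ext n c y f g : (forall k, f k = g k) ->
  part_value n c y f = part_value n c y g.
Proof. intros H. apply rsum_ext. intros; now rewrite H. Qed.

Lemma lim_window_ratfun p q r u v N :
  (0 < p)%nat -> (0 < q)%nat -> (0 < r)%nat -> (0 < u)%nat -> (0 < v)%nat -> (0 < N)%nat ->
  is_lim_seq (fun M => window M (3 * N + M) (fun z => ratfun p q r u v (IZR z / INR N)))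
    (ratfun_value p q r u v N).
Proof.
  intros Hp Hq Hr Hu Hv HN. assert (P : 0 < INR N) by now apply lt_0_INR.
  apply is_lim_seq_ext with (fun M => rsum 8 (fun i =>
    window M (3 * N + M) (fun z => part (- INR (pole_index (S i))) (pole_order p q r u (S i))
      (coefA p q r u v (S i)) (IZR z / INR N))
    + window M (3 * N + M) (fun z => part (- (3 / 2)) v (coefB p q r u v (S i)) (IZR z / INR N)))).
  { intros M. rewrite (window_ext _ _ _ _ (fun z => ratfun_parts p q r u v (IZR z / INR N) Hp Hq Hr Hu Hv)).
    rewrite window_rsum. apply rsum_ext. intros i _. now rewrite window_plus. }
  apply (is_lim_seq_rsum 8 (fun i M =>
    window M (3 * N + M) (fun z => part (- INR (pole_index (S i))) (pole_order p q r u (S i))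
      (coefA p q r u v (S i)) (IZR z / INR N))
    + window M (3 * N + M) (fun z => part (- (3 / 2)) v (coefB p q r u v (S i)) (IZR z / INR N)))).
  intros i _. apply is_lim_seq_plus'.
  - replace (- INR (pole_index (S i))) with (- (INR (pole_index (S i) * N) / INR N))
      by (rewrite mult_INR; field; lra).
    apply lim_window_part_integer; [easy|].
    apply Nat.mul_le_mono_r. clear. do 8 (destruct i as [|i]; [cbn; lia|]). cbn; lia.
  - destruct (Nat.even N) eqn:E.
    + destruct (proj1 (Nat.even_spec N) E) as [g Hg].
      replace (- (3 / 2)) with (- (INR (3 * g) / INR N)).
      * rewrite (part_value_ext _ _ _ (parity_factor N) (fun _ => 1))
          by (intros; unfold parity_factor; now rewrite E).
        apply lim_window_part_integer; lia.
      * rewrite Hg, !mult_INR in *. simpl in *. field. lra.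
    + rewrite (part_value_ext _ _ _ (parity_factor N) (fun k => 2 ^ (2 * k) - 1))
        by (intros; unfold parity_factor; now rewrite E).
      apply lim_window_part_half. now rewrite <- Nat.negb_even, E.
Qed.

(** The last form is [2 z + 3 N] and not [z + 3 N / 2], whence the factor [2 ^ (- v)] in
    [lattice_ratfun]. *)
Definition lattice (p q r u v N : nat) (z : Z) : R :=
  (/ IZR z) ^ p * (/ (IZR z + INR N)) ^ q * (/ (IZR z + 2 * INR N)) ^ r
  * (/ (IZR z + 3 * INR N)) ^ u * (/ (2 * IZR z + 3 * INR N)) ^ v.

(** Homogeneity; it persists at the poles because [/ 0 = 0] is compatible with scaling. *)
Lemma lattice_ratfun p q r u v N z : (0 < N)%nat ->
  lattice p q r u v N z
  = (/ INR N) ^ (p + q + r + u + v) * (/ 2) ^ v * ratfun p q r u v (IZR z / INR N).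
Proof.
  intros HN. assert (P : 0 < INR N) by now apply lt_0_INR.
  unfold lattice, ratfun. rewrite !pow_add. set (y := IZR z).
  replace (/ y) with (/ INR N * / (y / INR N)).
  2:{ unfold Rdiv. rewrite Rinv_mult, Rinv_inv, (Rmult_comm (/ y)), <- Rmult_assoc.
      rewrite Rinv_l by lra. ring. }
  replace (/ (y + INR N)) with (/ INR N * / (y / INR N + 1)).
  2:{ rewrite <- Rinv_mult. f_equal. field. lra. }
  replace (/ (y + 2 * INR N)) with (/ INR N * / (y / INR N + 2)).
  2:{ rewrite <- Rinv_mult. f_equal. field. lra. }
  replace (/ (y + 3 * INR N)) with (/ INR N * / (y / INR N + 3)).
  2:{ rewrite <- Rinv_mult. f_equal. field. lra. }
  replace (/ (2 * y + 3 * INR N)) with (/ 2 * / INR N * / (y / INR N + 3 / 2)).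
  2:{ rewrite <- !Rinv_mult. f_equal. field. lra. }
  rewrite !Rpow_mult_distr. ring.
Qed.

(** In [chamber] the slot of [s] receives exponent 0; the power of its form is kept apart as a
    weight. *)
Definition g2_term (e1 e2 e3 e4 e5 e6 : nat) (m n : R) : R :=
  (/ m) ^ e1 * (/ n) ^ e2 * (/ (m + n)) ^ e3 * (/ (m + 2 * n)) ^ e4
  * (/ (m + 3 * n)) ^ e5 * (/ (2 * m + 3 * n)) ^ e6.

Lemma inv_opp_pow x n : (/ - x) ^ n = (-1) ^ n * (/ x) ^ n.
Proof. rewrite Rinv_opp. replace (- / x) with ((-1) * / x) by ring. apply Rpow_mult_distr. Qed.

Section Regions.
Variables p q r u v : nat.
Hypothesis Hp : (0 < p)%nat.
Hypothesis Hq : (0 < q)%nat.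
Hypothesis Hr : (0 < r)%nat.
Hypothesis Hu : (0 < u)%nat.
Hypothesis Hv : (0 < v)%nat.

(* The six Weyl chambers met by the line [n = N] of the lattice, each written
   in its own positive coordinates; [N = S N'] is the form carrying [s]. *)
Definition chamber (i N' k' : nat) : R :=
  let N := INR (S N') in let k := INR (S k') in
  match i with
  | 0 => g2_term p 0 q r u v k N
  | 1 => if Nat.ltb k' N' then g2_term p q 0 r v u k (N - k)%R else 0%R
  | 2 => if Nat.ltb (2 * k' + 1) N' then g2_term v q r 0 p u (N - 2 * k)%R k else 0%R
  | 3 => if Nat.ltb (2 * k' + 1) N' then g2_term v r q 0 u p (N - 2 * k)%R k else 0%R
  | 4 => if Nat.ltb k' N' then g2_term u r 0 q v p k (N - k)%R else 0%R
  | _ => g2_term u 0 r q p v k N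
  end%nat.

Definition chamber_sign (i : nat) : nat :=
  match i with
  | 0 => 0 | 1 => p | 2 => p + q | 3 => p + q + v | 4 => p + q + r + v
  | _ => p + q + r + u + v
  end%nat.

Lemma chamber_nonneg i N' k' : 0 <= chamber i N' k'.
Proof.
  assert (G : forall a b c d e f x y, 0 < x -> 0 < y -> 0 <= g2_term a b c d e f x y).
  { intros. unfold g2_term. repeat apply Rmult_le_pos; apply pow_le; left;
      apply Rinv_0_lt_compat; lra. }
  assert (A := INR_S_pos N'). assert (B := INR_S_pos k').
  assert (C : (k' < N')%nat -> 0 < INR (S N') - INR (S k')).
  { intros H. assert (X : INR (S k') < INR (S N')) by (apply lt_INR; lia). lra. }
  assert (D : (2 * k' + 1 < N')%nat -> 0 < INR (S N') - 2 * INR (S k')).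
  { intros H. assert (X : INR (2 * S k') < INR (S N')) by (apply lt_INR; lia).
    rewrite mult_INR in X. simpl (INR 2) in X. lra. }
  unfold chamber. destruct i as [|[|[|[|[|i]]]]]; try now apply G.
  - destruct (Nat.ltb_spec k' N'); [apply G; auto|lra].
  - destruct (Nat.ltb_spec (2 * k' + 1) N'); [apply G; auto|lra].
  - destruct (Nat.ltb_spec (2 * k' + 1) N'); [apply G; auto|lra].
  - destruct (Nat.ltb_spec k' N'); [apply G; auto|lra].
Qed.

(** Since the exponents are positive, [/ 0 = 0] removes the poles, and sums may run over all
    integers. *)
Lemma lattice_zero N z :
  (z = 0 \/ z = - Z.of_nat N \/ z = - (2 * Z.of_nat N) \/ z = - (3 * Z.of_nat N)
   \/ 2 * z = - (3 * Z.of_nat N))%Z ->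
  lattice p q r u v N z = 0.
Proof.
  intros H. unfold lattice.
  assert (Z : forall y e, y = 0 -> (0 < e)%nat -> (/ y) ^ e = 0).
  { intros y e -> He. rewrite Rinv_0. now apply pow_i. }
  destruct H as [->|[->|[->|[->|H]]]].
  - rewrite (Z 0 p) by easy. ring.
  - rewrite (Z (_ + INR N) q); [ring| |easy]. rewrite opp_IZR, <- INR_IZR_INZ. ring.
  - rewrite (Z (_ + 2 * INR N) r); [ring| |easy].
    rewrite opp_IZR, mult_IZR, <- INR_IZR_INZ. ring.
  - rewrite (Z (_ + 3 * INR N) u); [ring| |easy].
    rewrite opp_IZR, mult_IZR, <- INR_IZR_INZ. ring.
  - rewrite (Z (2 * _ + _) v); [ring| |easy].
    rewrite <- mult_IZR, H, opp_IZR, mult_IZR, <- INR_IZR_INZ. ring.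
Qed.

(** Each sign collects the exponents of the forms that are negative on the interval. The six values
    of [z] form three pairs under the reflection [z -> - 3 N - z]. For [N = N' + 1] and [k = k' + 1]
    the two tests read [k < N] and [2 k < N]. *)
Lemma chamber_lattice N' k' :
  rsum 6 (fun i => (-1) ^ chamber_sign i * chamber i N' k')
  = let N := S N' in let k := S k' in
    let L := lattice p q r u v N in
    L (Z.of_nat k) + L (- (3 * Z.of_nat N + Z.of_nat k))%Z
    + (if Nat.ltb k' N' then
         L (- Z.of_nat k)%Z + L (- (3 * Z.of_nat N - Z.of_nat k))%Z else 0)
    + (if Nat.ltb (2 * k' + 1) N' then
         L (- (Z.of_nat N + Z.of_nat k))%Z + L (- (2 * Z.of_nat N - Z.of_nat k))%Z else 0).
Proof.
  cbn zeta. cbn [rsum]. unfold chamber, chamber_sign, lattice, g2_term.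
  rewrite !opp_IZR, ?plus_IZR, ?minus_IZR, ?mult_IZR, <- !INR_IZR_INZ.
  set (N := INR (S N')). set (k := INR (S k')).
  assert (S1 : forall n, (-1) ^ n * (-1) ^ n = 1).
  { intros n. rewrite <- Rpow_mult_distr. replace (-1 * -1) with 1 by ring. apply pow1. }
  replace (- (3 * N + k) + N) with (- (k + 2 * N)) by ring.
  replace (- (3 * N + k) + 2 * N) with (- (k + N)) by ring.
  replace (- (3 * N + k) + 3 * N) with (- k) by ring.
  replace (2 * - (3 * N + k) + 3 * N) with (- (2 * k + 3 * N)) by ring.
  replace (- (3 * N + k)) with (- (k + 3 * N)) by ring.
  replace (- k + N) with (N - k) by ring.
  replace (- k + 2 * N) with (k + 2 * (N - k)) by ring.
  replace (- k + 3 * N) with (2 * k + 3 * (N - k)) by ring.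
  replace (2 * - k + 3 * N) with (k + 3 * (N - k)) by ring.
  replace (- (3 * N - k) + N) with (- (k + 2 * (N - k))) by ring.
  replace (- (3 * N - k) + 2 * N) with (- (N - k)) by ring.
  replace (- (3 * N - k) + 3 * N) with k by ring.
  replace (2 * - (3 * N - k) + 3 * N) with (- (k + 3 * (N - k))) by ring.
  replace (- (3 * N - k)) with (- (2 * k + 3 * (N - k))) by ring.
  replace (- (N + k) + N) with (- k) by ring.
  replace (- (N + k) + 2 * N) with (N - 2 * k + k) by ring.
  replace (- (N + k) + 3 * N) with (2 * (N - 2 * k) + 3 * k) by ring.
  replace (2 * - (N + k) + 3 * N) with (N - 2 * k) by ring.
  replace (- (N + k)) with (- (N - 2 * k + 3 * k)) by ring.
  replace (- (2 * N - k) + N) with (- (N - 2 * k + k)) by ring.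
  replace (- (2 * N - k) + 2 * N) with k by ring.
  replace (- (2 * N - k) + 3 * N) with (N - 2 * k + 3 * k) by ring.
  replace (2 * - (2 * N - k) + 3 * N) with (- (N - 2 * k)) by ring.
  replace (- (2 * N - k)) with (- (2 * (N - 2 * k) + 3 * k)) by ring.
  rewrite !inv_opp_pow, !pow_add.
  destruct (Nat.ltb k' N'), (Nat.ltb (2 * k' + 1) N'); cbn [pow]; ring.
Qed.

Lemma rsum_if_ltb a M f : (a <= M)%nat ->
  rsum M (fun k => if Nat.ltb k a then f k else 0) = rsum a f.
Proof.
  intros H. replace M with (a + (M - a))%nat by lia. rewrite rsum_app.
  rewrite (rsum_zero (M - a)).
  - rewrite Rplus_0_r. apply rsum_ext. intros i Hi.
    now destruct (Nat.ltb_spec i a); [|lia].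
  - intros i _. now destruct (Nat.ltb_spec (a + i) a); [lia|].
Qed.

(** [N' <= M] makes the sums over the bounded chambers complete. The integers from [- 1] down to
    [- 3 N] form three blocks of length [N], each ending in a pole; the middle block is shared by
    two chambers. *)
Lemma chamber_window N' M : (N' <= M)%nat ->
  rsum M (fun k => rsum 6 (fun i => (-1) ^ chamber_sign i * chamber i N' k))
  = window M (3 * S N' + M) (lattice p q r u v (S N')).
Proof.
  intros HM. rewrite (rsum_ext M _ _ (fun k _ => chamber_lattice N' k)). cbn zeta.
  set (L := lattice p q r u v (S N')). set (N := S N').
  assert (L0 : forall z, (z = 0 \/ z = - Z.of_nat N \/ z = - (2 * Z.of_nat N)
     \/ z = - (3 * Z.of_nat N) \/ 2 * z = - (3 * Z.of_nat N))%Z -> L z = 0)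
    by apply (lattice_zero N).
  rewrite !rsum_plus, rsum_if_ltb by easy.
  unfold window. replace (L 0%Z) with 0 by (symmetry; apply L0; lia).
  rewrite (rsum_app (3 * N) M).
  replace (rsum M (fun i => L (- Z.of_nat (S (3 * N + i)))%Z))
    with (rsum M (fun i => L (- (3 * Z.of_nat N + Z.of_nat (S i)))%Z))
    by (apply rsum_ext; intros; f_equal; lia).
  assert (Block : forall a, rsum N (fun i => L (- Z.of_nat (S (a + i)))%Z)
     = rsum N' (fun i => L (- Z.of_nat (S (a + i)))%Z) + L (- Z.of_nat (a + N))%Z).
  { intros a. unfold N at 1. cbn [rsum]. repeat f_equal. unfold N. lia. }
  replace (3 * N)%nat with (N + (N + N))%nat at 1 by lia. rewrite !rsum_app.
  replace (rsum N (fun i => L (- Z.of_nat (S i))%Z))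
    with (rsum N (fun i => L (- Z.of_nat (S (0 + i)))%Z)) by easy.
  replace (rsum N (fun i => L (- Z.of_nat (S (N + (N + i))))%Z))
    with (rsum N (fun i => L (- Z.of_nat (S (2 * N + i)))%Z))
    by (apply rsum_ext; intros; f_equal; lia).
  rewrite !Block.
  rewrite (L0 (- Z.of_nat (0 + N))%Z) by (unfold N; lia).
  rewrite (L0 (- Z.of_nat (N + N))%Z) by (unfold N; lia).
  rewrite (L0 (- Z.of_nat (2 * N + N))%Z) by (unfold N; lia).
  rewrite (rsum_rev N' (fun i => L (- Z.of_nat (S (2 * N + i)))%Z)).
  rewrite (rsum_ext N' (fun i => L (- Z.of_nat (S (2 * N + (N' - 1 - i))))%Z)
     (fun k => L (- (3 * Z.of_nat N - Z.of_nat (S k)))%Z))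
    by (intros i Hi; f_equal; unfold N; lia).
  (* The two chambers fill the middle block from its two ends. For even [N] they leave out the
     midpoint [- 3 N / 2], where [L] vanishes. *)
  assert (Mid : rsum M (fun k => if Nat.ltb (2 * k + 1) N'
        then L (- (Z.of_nat N + Z.of_nat (S k)))%Z + L (- (2 * Z.of_nat N - Z.of_nat (S k)))%Z
        else 0) = rsum N' (fun i => L (- Z.of_nat (S (N + i)))%Z)).
  { rewrite (rsum_ext M _ (fun k => if Nat.ltb k N' then if Nat.ltb (2 * k + 1) N'
        then L (- (Z.of_nat N + Z.of_nat (S k)))%Z + L (- (2 * Z.of_nat N - Z.of_nat (S k)))%Z
        else 0 else 0)).
    2:{ intros k _. destruct (Nat.ltb_spec (2 * k + 1) N'), (Nat.ltb_spec k N'); easy || lia. }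
    rewrite rsum_if_ltb by easy.
    rewrite (rsum_ext N' _ (fun k =>
       (if Nat.ltb (2 * k + 1) N' then L (- (Z.of_nat N + Z.of_nat (S k)))%Z else 0)
       + (if Nat.ltb (2 * k + 1) N' then L (- (2 * Z.of_nat N - Z.of_nat (S k)))%Z else 0)))
      by (intros k _; destruct (Nat.ltb (2 * k + 1) N'); ring).
    rewrite rsum_plus.
    rewrite (rsum_rev N' (fun k => if Nat.ltb (2 * k + 1) N'
       then L (- (2 * Z.of_nat N - Z.of_nat (S k)))%Z else 0)).
    rewrite <- rsum_plus. apply rsum_ext. intros k Hk.
    replace (- Z.of_nat (S (N + k)))%Z with (- (Z.of_nat N + Z.of_nat (S k)))%Z by lia.
    destruct (Nat.ltb_spec (2 * k + 1) N'), (Nat.ltb_spec (2 * (N' - 1 - k) + 1) N'); try lia.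
    - ring.
    - rewrite Rplus_0_l. f_equal. unfold N; lia.
    - rewrite L0; [ring|]. unfold N; lia. }
  rewrite Mid. fold N.
  replace (rsum N' (fun i => L (- Z.of_nat (S (0 + i)))%Z))
    with (rsum N' (fun i => L (- Z.of_nat (S i))%Z)) by easy.
  rewrite (rsum_plus N'). ring.
Qed.

Lemma chamber_sum N' :
  is_series (fun k => rsum 6 (fun i => (-1) ^ chamber_sign i * chamber i N' k))
    ((/ INR (S N')) ^ (p + q + r + u + v) * (/ 2) ^ v * ratfun_value p q r u v (S N')).
Proof.
  apply is_series_rsum.
  apply (is_lim_seq_ext_loc (fun M => (/ INR (S N')) ^ (p + q + r + u + v) * (/ 2) ^ v
     * window M (3 * S N' + M) (fun z => ratfun p q r u v (IZR z / INR (S N'))))).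
  - exists N'. intros M HM. rewrite chamber_window by easy.
    rewrite <- window_scal. apply window_ext. intros z.
    symmetry. apply lattice_ratfun. lia.
  - apply is_lim_seq_scal. apply lim_window_ratfun; lia.
Qed.
End Regions.

(** * Regrouping the double series *)

Lemma is_series_rsum_n n (f : nat -> nat -> R) (l : nat -> R) :
  (forall i, (i < n)%nat -> is_series (f i) (l i)) ->
  is_series (fun N => rsum n (fun i => f i N)) (rsum n l).
Proof.
  induction n as [|n IH]; intros H; simpl.
  - apply is_series_rsum. apply is_lim_seq_ext with (fun _ => 0); [|apply is_lim_seq_const].
    intros m. now rewrite rsum_zero.
  - apply (is_series_plus (fun N => rsum n (fun i => f i N)) (f n) (rsum n l) (l n)).
    + apply IH. intros; apply H; lia.
    + apply H; lia.
Qed.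

Lemma is_series_scal_R (c : R) (a : nat -> R) (l : R) :
  is_series a l -> is_series (fun n => c * a n) (c * l).
Proof. intros H. exact (is_series_scal_l c a l H). Qed.

Lemma INR_S_ge_1 n : 1 <= INR (S n).
Proof. rewrite S_INR. assert (H := pos_INR n). lra. Qed.

Lemma inv_pow_le_1 y e : 1 <= y -> 0 <= (/ y) ^ e <= 1.
Proof.
  intros H. assert (P : 0 < / y <= 1).
  { split; [apply Rinv_0_lt_compat; lra|]. rewrite <- Rinv_1. apply Rinv_le_contravar; lra. }
  split; [apply pow_le; lra|]. rewrite <- (pow1 e). apply pow_incr. lra.
Qed.

Lemma inv_pow_le_inv y k e : 1 <= k <= y -> (0 < e)%nat -> 0 <= (/ y) ^ e <= / k.
Proof.
  intros H He. destruct e as [|e]; [lia|]. simpl.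
  assert (A := inv_pow_le_1 y e ltac:(lra)).
  assert (B : 0 < / y <= / k).
  { split; [apply Rinv_0_lt_compat; lra|apply Rinv_le_contravar; lra]. }
  nra.
Qed.

Lemma g2_term_bound e1 e2 e3 e4 e5 e6 m n b1 b2 b3 b4 b5 b6 :
  0 <= (/ m) ^ e1 <= b1 -> 0 <= (/ n) ^ e2 <= b2 -> 0 <= (/ (m + n)) ^ e3 <= b3 ->
  0 <= (/ (m + 2 * n)) ^ e4 <= b4 -> 0 <= (/ (m + 3 * n)) ^ e5 <= b5 ->
  0 <= (/ (2 * m + 3 * n)) ^ e6 <= b6 ->
  g2_term e1 e2 e3 e4 e5 e6 m n <= b1 * b2 * b3 * b4 * b5 * b6.
Proof.
  intros H1 H2 H3 H4 H5 H6. unfold g2_term.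
  repeat (apply Rmult_le_compat; try (repeat apply Rmult_le_pos; lra); try lra).
Qed.

Section Regroup.
Variable wgt : nat -> R.
Hypothesis wgt_bound : forall N, Rabs (wgt N) <= / INR (S N) ^ 2.
Variable tau : nat -> nat -> R.
Hypothesis tau_bound : forall N k, 0 <= tau N k <= / INR (S k) ^ 2.

Lemma tau_ex N : ex_series (tau N).
Proof.
  apply ex_series_le_R with (2 := ex_series_inv_sqr). intros k.
  rewrite Rabs_pos_eq; apply tau_bound.
Qed.

Lemma wgt_tau_bound N k :
  Rabs (wgt N * tau N k) <= / INR (S N) ^ 2 * / INR (S k) ^ 2.
Proof.
  assert (C := tau_bound N k). rewrite Rabs_mult, (Rabs_pos_eq (tau N k)) by lra.
  apply Rmult_le_compat; [apply Rabs_pos|lra|apply wgt_bound|lra].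
Qed.

Lemma product_summable :
  (forall k, ex_series (fun n => / INR (S k) ^ 2 * / INR (S n) ^ 2)) /\
  ex_series (fun k => Series (fun n => / INR (S k) ^ 2 * / INR (S n) ^ 2)).
Proof.
  split.
  - intros k. apply ex_series_scal_l_R, ex_series_inv_sqr.
  - apply ex_series_ext with (fun k => Series (fun n => / INR (S n) ^ 2) * / INR (S k) ^ 2).
    + intros k. eqR. rewrite Series_scal_l. ring.
    + apply ex_series_scal_l_R, ex_series_inv_sqr.
Qed.

Lemma Fubini_product (a : nat -> nat -> R) :
  (forall k n, Rabs (a k n) <= / INR (S k) ^ 2 * / INR (S n) ^ 2) ->
  Series (fun n => Series (fun k => a k n)) = Series (fun k => Series (a k)).
Proof.
  intros H. destruct product_summable as [E1 E2].
  now apply (Fubini_abs a (fun k n => / INR (S k) ^ 2 * / INR (S n) ^ 2)).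
Qed.

Lemma swap_wgt_tau :
  Series (fun k => Series (fun N => wgt N * tau N k))
  = Series (fun N => wgt N * Series (tau N)).
Proof.
  transitivity (Series (fun N => Series (fun k => wgt N * tau N k))).
  - apply (Fubini_product (fun N k => wgt N * tau N k)). apply wgt_tau_bound.
  - apply Series_ext. intros N. apply Series_scal_l.
Qed.

Lemma ex_series_wgt_tau : ex_series (fun N => wgt N * Series (tau N)).
Proof.
  apply ex_series_le_R with (fun N => Series (fun k => / INR (S k) ^ 2) * / INR (S N) ^ 2).
  2:{ apply ex_series_scal_l_R, ex_series_inv_sqr. }
  intros N.
  assert (C : 0 <= Series (tau N)).
  { apply Series_nonneg; [apply tau_bound|apply tau_ex]. }
  assert (D : Series (tau N) <= Series (fun k => / INR (S k) ^ 2)).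
  { apply Series_le; [apply tau_bound|apply ex_series_inv_sqr]. }
  rewrite Rabs_mult, (Rabs_pos_eq (Series _)) by easy.
  rewrite Rmult_comm. apply Rmult_le_compat; [easy|apply Rabs_pos|easy|apply wgt_bound].
Qed.

(** For fixed [m] the sum over [n] is the sum over the total without its first terms, where [tau]
    vanishes. All indices start at 0 and stand for their successors, hence [S m + n] for the
    total. *)
Lemma regroup_sum (a : nat -> nat -> R) :
  (forall m n, a m n = wgt (S m + n) * tau (S m + n) m) ->
  (forall N k, (N < S k)%nat -> tau N k = 0) ->
  Series (fun m => Series (fun n => a m n)) = Series (fun N => wgt N * Series (tau N)).
Proof.
  intros Ha H0. rewrite <- swap_wgt_tau. apply Series_ext. intros m.
  rewrite (Series_incr_n_aux (fun N => wgt N * tau N m) (S m)).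
  - apply Series_ext. intros n. apply Ha.
  - intros k Hk. rewrite H0 by easy. ring.
Qed.

Lemma regroup_sum_double (a : nat -> nat -> R) :
  (forall m n, a m n = wgt (2 * S n + m) * tau (2 * S n + m) n) ->
  (forall N k, (N < 2 * S k)%nat -> tau N k = 0) ->
  Series (fun m => Series (fun n => a m n)) = Series (fun N => wgt N * Series (tau N)).
Proof.
  intros Ha H0. rewrite <- swap_wgt_tau.
  (* Here the chamber is indexed by the inner variable [n], so the order of summation is exchanged
     first. *)
  transitivity (Series (fun n => Series (fun m => a m n))).
  - symmetry. apply (Fubini_product a). intros m n. rewrite Ha.
    apply Rle_trans with (1 := wgt_tau_bound (2 * S n + m) n).
    apply Rmult_le_compat_r; [left; apply Rinv_0_lt_compat, pow_lt, INR_S_pos|].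
    apply Rinv_le_contravar; [apply pow_lt, INR_S_pos|]. apply pow_incr.
    split; [apply pos_INR|apply le_INR; lia].
  - apply Series_ext. intros n.
    rewrite (Series_incr_n_aux (fun N => wgt N * tau N n) (2 * S n)).
    + apply Series_ext. intros m. apply Ha.
    + intros k Hk. rewrite H0 by easy. ring.
Qed.
End Regroup.

(** * Complex powers of positive reals *)

Lemma Cexp_plus a b : Cexp (a + b) = (Cexp a * Cexp b)%C.
Proof.
  unfold Cexp, Cmult, Cplus, Re, Im; simpl. rewrite exp_plus, cos_plus, sin_plus.
  f_equal; ring.
Qed.

Lemma rcpow_plus x a b : rcpow x (a + b) = (rcpow x a * rcpow x b)%C.
Proof. unfold rcpow. rewrite <- Cexp_plus. f_equal. ring. Qed.

Lemma rcpow_neq_0 x s : rcpow x s <> RtoC 0.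
Proof.
  assert (H : Cexp 0 = RtoC 1).
  { unfold Cexp, RtoC, Re, Im; simpl. rewrite exp_0, cos_0, sin_0. f_equal; ring. }
  intros E. apply C1_nz. rewrite <- H. replace (RtoC 0) with (s * RtoC (ln x) + - s * RtoC (ln x))%C by ring.
  rewrite Cexp_plus. fold (rcpow x s). rewrite E. ring.
Qed.

Lemma rcpow_opp x s : rcpow x (- s) = (/ rcpow x s)%C.
Proof.
  assert (N := rcpow_neq_0 x s).
  assert (H : (rcpow x (- s) * rcpow x s = 1)%C).
  { rewrite <- rcpow_plus. replace (- s + s)%C with (RtoC 0) by ring.
    rewrite rcpow_real. unfold Rpower. now rewrite Rmult_0_l, exp_0. }
  replace (rcpow x (- s)) with (rcpow x (- s) * rcpow x s * / rcpow x s)%C by (now field).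
  rewrite H. ring.
Qed.

Lemma rcpow_nat x n : 0 < x -> rcpow x (RtoC (INR n)) = RtoC (x ^ n).
Proof. intros H. now rewrite rcpow_real, Rpower_pow. Qed.

Lemma rcpow_mult x y s : 0 < x -> 0 < y -> rcpow (x * y) s = (rcpow x s * rcpow y s)%C.
Proof.
  intros Hx Hy. unfold rcpow. rewrite ln_mult, RtoC_plus by easy.
  rewrite <- Cexp_plus. f_equal. ring.
Qed.

Definition Cdirichlet (s : C) (N : nat) : C := (/ rcpow (INR (S N)) s)%C.

Lemma Cdirichlet_bound s N : 2 <= Re s ->
  Rabs (Re (Cdirichlet s N)) <= / INR (S N) ^ 2 /\
  Rabs (Im (Cdirichlet s N)) <= / INR (S N) ^ 2.
Proof.
  intros Hs. unfold Cdirichlet. rewrite <- rcpow_opp.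
  set (l := ln (INR (S N))).
  assert (L : 0 <= l).
  { unfold l. rewrite <- ln_1. apply ln_le; [lra|apply INR_S_ge_1]. }
  assert (B : exp (Re (- s * RtoC l)%C) <= / INR (S N) ^ 2).
  { rewrite <- Rpower_pow by apply INR_S_pos. unfold Rpower. fold l.
    rewrite <- exp_Ropp. apply exp_le_compat.
    replace (Re (- s * RtoC l)%C) with (- (Re s * l)) by (unfold Re; simpl; ring).
    simpl (INR 2). nra. }
  assert (P := exp_pos (Re (- s * RtoC l)%C)).
  unfold rcpow, Cexp. fold l. cbn [Re Im fst snd].
  assert (C1 := COS_bound (Im (- s * RtoC l)%C)). assert (C2 := SIN_bound (Im (- s * RtoC l)%C)).
  rewrite !Rabs_mult, !(Rabs_pos_eq (exp _)) by lra.
  split.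
  - assert (Rabs (cos (Im (- s * RtoC l)%C)) <= 1) by (apply Rabs_le; lra).
    assert (Q := Rabs_pos (cos (Im (- s * RtoC l)%C))). nra.
  - assert (Rabs (sin (Im (- s * RtoC l)%C)) <= 1) by (apply Rabs_le; lra).
    assert (Q := Rabs_pos (sin (Im (- s * RtoC l)%C))). nra.
Qed.

Section LatticeIdentity.
Variables p q r u v : nat.
Hypothesis Hp : (0 < p)%nat.
Hypothesis Hq : (0 < q)%nat.
Hypothesis Hr : (0 < r)%nat.
Hypothesis Hu : (0 < u)%nat.
Hypothesis Hv : (0 < v)%nat.

Let ch := chamber p q r u v.

Ltac factor_bound b1 b2 b3 b4 b5 b6 :=
  eapply Rle_trans; [apply (g2_term_bound _ _ _ _ _ _ _ _ b1 b2 b3 b4 b5 b6)|];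
  try (apply inv_pow_le_inv; [lra|easy]); try (apply inv_pow_le_1; lra);
  rewrite <- pow_inv; right; ring.

(** Two of the forms with positive exponent are at least [k], and all others are at least 1.
    Together with the weight this gives a product majorant, so the two variables can be summed in
    any order. *)
Lemma chamber_bound i N k : 0 <= ch i N k <= / INR (S k) ^ 2.
Proof.
  split; [now apply chamber_nonneg|].
  assert (A := INR_S_ge_1 N). assert (B := INR_S_ge_1 k).
  assert (C : (k < N)%nat -> 1 <= INR (S N) - INR (S k)).
  { intros H. assert (X : INR (S (S k)) <= INR (S N)) by (apply le_INR; lia).
    rewrite (S_INR (S k)) in X. lra. }
  assert (D : (2 * k + 1 < N)%nat -> 1 <= INR (S N) - 2 * INR (S k)).
  { intros H. assert (X : INR (S (2 * S k)) <= INR (S N)) by (apply le_INR; lia).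
    rewrite S_INR, mult_INR in X. simpl (INR 2) in X. lra. }
  unfold ch, chamber. cbn zeta.
  set (N0 := INR (S N)) in *. set (k0 := INR (S k)) in *.
  assert (P : 0 < / k0) by (apply Rinv_0_lt_compat; lra).
  assert (Z : 0 <= / k0 ^ 2) by (rewrite <- pow_inv; apply pow_le; lra).
  destruct i as [|[|[|[|[|i]]]]].
  - factor_bound (/ k0) 1 (/ k0) 1 1 1.
  - destruct (Nat.ltb_spec k N) as [H|H]; [|easy]. specialize (C H).
    factor_bound (/ k0) 1 1 (/ k0) 1 1.
  - destruct (Nat.ltb_spec (2 * k + 1) N) as [H|H]; [|easy]. specialize (D H).
    factor_bound 1 (/ k0) (/ k0) 1 1 1.
  - destruct (Nat.ltb_spec (2 * k + 1) N) as [H|H]; [|easy]. specialize (D H).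
    factor_bound 1 (/ k0) (/ k0) 1 1 1.
  - destruct (Nat.ltb_spec k N) as [H|H]; [|easy]. specialize (C H).
    factor_bound (/ k0) 1 1 (/ k0) 1 1.
  - factor_bound (/ k0) 1 (/ k0) 1 1 1.
Qed.

Definition chamber_total (wgt : nat -> R) (i : nat) : R :=
  Series (fun N => wgt N * Series (ch i N)).

Let wt := (p + q + r + u + v)%nat.

(** The total exponent is [2 k - wt]: [- wt] comes from the scaling in [lattice_ratfun], and [2 k]
    from [part_value]. *)
Definition power_weight (k N : nat) : R := (/ INR (S N)) ^ wt * INR (S N) ^ (2 * k).

Lemma double_half_le n : (2 * (n / 2) <= n)%nat.
Proof. apply Nat.Div0.mul_div_le. Qed.

Lemma pole_order_le j : (pole_order p q r u j <= wt)%nat.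
Proof. unfold wt. do 8 (destruct j as [|j]; [cbn; lia|]). cbn; lia. Qed.

Lemma power_weight_bound k N : (2 * k <= wt)%nat -> 0 <= power_weight k N <= 1.
Proof.
  intros H. unfold power_weight. assert (P := INR_S_pos N).
  replace wt with ((wt - 2 * k) + 2 * k)%nat by lia. rewrite pow_add, Rmult_assoc.
  rewrite <- (Rpow_mult_distr (/ INR (S N))), Rinv_l, pow1, Rmult_1_r by lra.
  apply inv_pow_le_1, INR_S_ge_1.
Qed.

Lemma parity_factor_bound N k : 0 <= parity_factor N k <= 2 ^ (2 * k).
Proof.
  assert (1 <= 2 ^ (2 * k)) by (apply pow_R1_Rle; lra).
  unfold parity_factor. destruct (Nat.even N); lra.
Qed.

(** By linearity real weights are enough: they will be the real and the imaginary part of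
    [N ^ (- s)]. For each [N] the identity is [chamber_sum], and the bound on [wgt] permits the
    summation over [N]. *)
Theorem weighted_identity wgt :
  (forall N, Rabs (wgt N) <= / INR (S N) ^ 2) ->
  rsum 6 (fun i => (-1) ^ chamber_sign p q r u v i * chamber_total wgt i)
  = (/ 2) ^ v * rsum 8 (fun i =>
      rsum (S (pole_order p q r u (S i) / 2)) (fun k =>
        2 * zeven k * coefA p q r u v (S i) (2 * k)
        * Series (fun N => power_weight k N * wgt N))
      + rsum (S (v / 2)) (fun k =>
        2 * zeven k * coefB p q r u v (S i) (2 * k)
        * Series (fun N => parity_factor (S N) k * (power_weight k N * wgt N)))).
Proof.
  intros Hw. set (sg := chamber_sign p q r u v).
  assert (E : forall i, is_series (fun N => (-1) ^ sg i * (wgt N * Series (ch i N)))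
     ((-1) ^ sg i * chamber_total wgt i)).
  { intros i. apply is_series_scal_R. apply Series_correct.
    apply (ex_series_wgt_tau wgt Hw (ch i) (chamber_bound i)). }
  assert (S1 := is_series_rsum_n 6 _ _ (fun i _ => E i)).
  rewrite <- (is_series_unique _ _ S1). apply is_series_unique.
  pose (f := fun i N => rsum (S (pole_order p q r u (S i) / 2)) (fun k =>
        2 * zeven k * coefA p q r u v (S i) (2 * k) * (power_weight k N * wgt N))
      + rsum (S (v / 2)) (fun k =>
        2 * zeven k * coefB p q r u v (S i) (2 * k)
          * (parity_factor (S N) k * (power_weight k N * wgt N)))).
  assert (B : forall k N, (2 * k <= wt)%nat ->
     Rabs (power_weight k N * wgt N) <= / INR (S N) ^ 2).
  { intros k N Hk. assert (A := power_weight_bound k N Hk).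
    rewrite Rabs_mult, (Rabs_pos_eq (power_weight k N)) by lra.
    assert (Q := Rabs_pos (wgt N)). assert (Q' := Hw N). nra. }
  apply is_series_ext with (fun N => (/ 2) ^ v * rsum 8 (fun i => f i N)).
  - intros N. eqR.
    transitivity (wgt N * ((/ INR (S N)) ^ (p + q + r + u + v) * (/ 2) ^ v
       * ratfun_value p q r u v (S N))).
    + unfold ratfun_value, part_value. rewrite <- rsum_scal_l.
      rewrite <- Rmult_assoc, <- rsum_scal_l. apply rsum_ext. intros i _. unfold f.
      rewrite !Rmult_plus_distr_l, <- !rsum_scal_l.
      f_equal; apply rsum_ext; intros k _; unfold power_weight, wt; ring.
    + rewrite <- (is_series_unique _ _ (chamber_sum p q r u v Hp Hq Hr Hu Hv N)).
      destruct (rsum_Series 6 (fun i k => (-1) ^ sg i * ch i N k)) as [_ R2].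
      { intros i _. apply ex_series_scal_l_R, (tau_ex (ch i) (chamber_bound i)). }
      unfold sg, ch in R2. rewrite R2, <- rsum_scal_l. apply rsum_ext. intros i _.
      rewrite Series_scal_l. unfold sg, ch. ring.
  - apply is_series_scal_R. apply is_series_rsum_n. intros i _. unfold f.
    apply (is_series_plus (fun N => rsum _ _) (fun N => rsum _ _)).
    + apply (is_series_rsum_n _ (fun k N => _ * (power_weight k N * wgt N))). intros k Hk.
      apply is_series_scal_R, Series_correct.
      apply ex_series_le_R with (2 := ex_series_inv_sqr). intros N. apply B.
      assert (A := pole_order_le (S i)). assert (D := double_half_le (pole_order p q r u (S i))). lia.
    + apply (is_series_rsum_n _ (fun k N => _ * (parity_factor (S N) k * (power_weight k N * wgt N)))).
      intros k Hk. apply is_series_scal_R, Series_correct.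
      apply ex_series_le_R with (2 := ex_series_scal_l_R (2 ^ (2 * k)) _ ex_series_inv_sqr).
      intros N. assert (D := double_half_le v).
      assert (F := parity_factor_bound (S N) k).
      rewrite Rabs_mult, Rabs_pos_eq by lra.
      apply Rmult_le_compat; [lra|apply Rabs_pos|lra|]. apply B. unfold wt; lia.
Qed.

Variable s : C.
Hypothesis Hs : 2 <= Re s.

Definition Cchamber_total (i : nat) : C :=
  (chamber_total (fun N => Re (Cdirichlet s N)) i,
   chamber_total (fun N => Im (Cdirichlet s N)) i).

Lemma Re_scal_r (c : R) (z : C) : Re (RtoC c * z)%C = c * Re z.
Proof. unfold Re; simpl; ring. Qed.

Lemma Im_scal_r (c : R) (z : C) : Im (RtoC c * z)%C = c * Im z.
Proof. unfold Im; simpl; ring. Qed.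

Lemma CSeries_regroup_swap (a : nat -> nat -> C) (i : nat) :
  (forall m n, a m n = (RtoC (ch i n m) * Cdirichlet s n)%C) ->
  CSeries (fun m => CSeries (fun n => a m n)) = Cchamber_total i.
Proof.
  intros H. unfold CSeries, Cchamber_total, chamber_total. cbn [Re Im fst snd]. f_equal.
  - rewrite <- (swap_wgt_tau _ (fun N => proj1 (Cdirichlet_bound s N Hs)) (ch i) (chamber_bound i)).
    apply Series_ext; intros m; apply Series_ext; intros n. rewrite H, Re_scal_r. ring.
  - rewrite <- (swap_wgt_tau _ (fun N => proj2 (Cdirichlet_bound s N Hs)) (ch i) (chamber_bound i)).
    apply Series_ext; intros m; apply Series_ext; intros n. rewrite H, Im_scal_r. ring.
Qed.

Lemma CSeries_regroup_sum (a : nat -> nat -> C) (i : nat) :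
  (forall m n, a m n = (RtoC (ch i (S m + n) m) * Cdirichlet s (S m + n))%C) ->
  (forall N k, (N < S k)%nat -> ch i N k = 0) ->
  CSeries (fun m => CSeries (fun n => a m n)) = Cchamber_total i.
Proof.
  intros H H0. unfold CSeries, Cchamber_total, chamber_total. cbn [Re Im fst snd]. f_equal.
  - apply (regroup_sum _ (fun N => proj1 (Cdirichlet_bound s N Hs)) (ch i) (chamber_bound i)).
    + intros m n. rewrite H, Re_scal_r. ring.
    + easy.
  - apply (regroup_sum _ (fun N => proj2 (Cdirichlet_bound s N Hs)) (ch i) (chamber_bound i)).
    + intros m n. rewrite H, Im_scal_r. ring.
    + easy.
Qed.

Lemma CSeries_regroup_sum_double (a : nat -> nat -> C) (i : nat) :
  (forall m n, a m n = (RtoC (ch i (2 * S n + m) n) * Cdirichlet s (2 * S n + m))%C) ->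
  (forall N k, (N < 2 * S k)%nat -> ch i N k = 0) ->
  CSeries (fun m => CSeries (fun n => a m n)) = Cchamber_total i.
Proof.
  intros H H0. unfold CSeries, Cchamber_total, chamber_total. cbn [Re Im fst snd]. f_equal.
  - apply (regroup_sum_double _ (fun N => proj1 (Cdirichlet_bound s N Hs)) (ch i) (chamber_bound i)).
    + intros m n. rewrite H, Re_scal_r. ring.
    + easy.
  - apply (regroup_sum_double _ (fun N => proj2 (Cdirichlet_bound s N Hs)) (ch i) (chamber_bound i)).
    + intros m n. rewrite H, Im_scal_r. ring.
    + easy.
Qed.

Lemma rcpow_Cdirichlet N y : y = INR (S N) -> rcpow y s = (/ Cdirichlet s N)%C.
Proof. intros ->. unfold Cdirichlet. field. apply rcpow_neq_0. Qed.

Lemma Cdirichlet_neq_0 N : Cdirichlet s N <> RtoC 0.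
Proof. unfold Cdirichlet. rewrite <- rcpow_opp. apply rcpow_neq_0. Qed.

Ltac term_eq m n Inv Nz := unfold g2_term;
  let A := fresh in let B := fresh in
  assert (A := INR_S_pos m); assert (B := INR_S_pos n);
  rewrite !rcpow_nat by lra; rewrite !RtoC_mult, !Inv by lra;
  cbn [pow]; field; repeat split; try apply Nz; try apply Cdirichlet_neq_0; lra.

(** The form in the slot of [s] is [n], [m + n] or [m + 2 n]. In the first case it is itself a
    summation variable; in the others the double series is regrouped along it. *)
Lemma zeta2_chambers :
  let P := RtoC (INR p) in let Q := RtoC (INR q) in let R' := RtoC (INR r) in
  let U := RtoC (INR u) in let V := RtoC (INR v) in
  zeta2_G2_series P s Q R' U V = Cchamber_total 0 /\
  zeta2_G2_series P Q s R' V U = Cchamber_total 1 /\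
  zeta2_G2_series V Q R' s P U = Cchamber_total 2 /\
  zeta2_G2_series V R' Q s U P = Cchamber_total 3 /\
  zeta2_G2_series U R' s Q V P = Cchamber_total 4 /\
  zeta2_G2_series U s R' Q P V = Cchamber_total 5.
Proof.
  cbn zeta. unfold zeta2_G2_series. cbn zeta.
  assert (Sum : forall m n, INR (S m) + INR (S n) = INR (S (S m + n))).
  { intros m n. rewrite <- plus_INR. f_equal. lia. }
  assert (Dbl : forall m n, INR (S m) + 2 * INR (S n) = INR (S (2 * S n + m))).
  { intros m n. replace 2 with (INR 2) by easy. rewrite <- mult_INR, <- plus_INR.
    f_equal. lia. }
  assert (Inv : forall y e, 0 < y -> RtoC ((/ y) ^ e) = (/ RtoC (y ^ e))%C).
  { intros y e Hy. rewrite pow_inv, RtoC_inv; [easy|]. apply pow_nonzero. lra. }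
  assert (Nz : forall y e, 0 < y -> RtoC (y ^ e) <> RtoC 0).
  { intros y e Hy E. apply RtoC_inj in E. revert E. apply pow_nonzero. lra. }
  repeat split.
  - apply CSeries_regroup_swap. intros m n.
    rewrite (rcpow_Cdirichlet n _ eq_refl). unfold ch, chamber. cbn zeta. term_eq m n Inv Nz.
  - apply CSeries_regroup_sum.
    + intros m n. rewrite (rcpow_Cdirichlet _ _ (Sum m n)). unfold ch, chamber. cbn zeta.
      replace (Nat.ltb m (S m + n)) with true by (symmetry; apply Nat.ltb_lt; lia).
      rewrite <- Sum. replace (INR (S m) + INR (S n) - INR (S m)) with (INR (S n)) by ring.
      term_eq m n Inv Nz.
    + intros N k H. unfold ch, chamber. destruct (Nat.ltb_spec k N); [lia|easy].
  - apply CSeries_regroup_sum_double.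
    + intros m n. rewrite (rcpow_Cdirichlet _ _ (Dbl m n)). unfold ch, chamber. cbn zeta.
      replace (Nat.ltb (2 * n + 1) (2 * S n + m)) with true by (symmetry; apply Nat.ltb_lt; lia).
      rewrite <- Dbl. replace (INR (S m) + 2 * INR (S n) - 2 * INR (S n)) with (INR (S m)) by ring.
      term_eq m n Inv Nz.
    + intros N k H. unfold ch, chamber. destruct (Nat.ltb_spec (2 * k + 1) N); [lia|easy].
  - apply CSeries_regroup_sum_double.
    + intros m n. rewrite (rcpow_Cdirichlet _ _ (Dbl m n)). unfold ch, chamber. cbn zeta.
      replace (Nat.ltb (2 * n + 1) (2 * S n + m)) with true by (symmetry; apply Nat.ltb_lt; lia).
      rewrite <- Dbl. replace (INR (S m) + 2 * INR (S n) - 2 * INR (S n)) with (INR (S m)) by ring.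
      term_eq m n Inv Nz.
    + intros N k H. unfold ch, chamber. destruct (Nat.ltb_spec (2 * k + 1) N); [lia|easy].
  - apply CSeries_regroup_sum.
    + intros m n. rewrite (rcpow_Cdirichlet _ _ (Sum m n)). unfold ch, chamber. cbn zeta.
      replace (Nat.ltb m (S m + n)) with true by (symmetry; apply Nat.ltb_lt; lia).
      rewrite <- Sum. replace (INR (S m) + INR (S n) - INR (S m)) with (INR (S n)) by ring.
      term_eq m n Inv Nz.
    + intros N k H. unfold ch, chamber. destruct (Nat.ltb_spec k N); [lia|easy].
  - apply CSeries_regroup_swap. intros m n.
    rewrite (rcpow_Cdirichlet n _ eq_refl). unfold ch, chamber. cbn zeta. term_eq m n Inv Nz.
Qed.
End LatticeIdentity.

(** * The coefficients of the [I_j] *)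

(** All differences between poles are [1], [2], [3], [1 / 2] or [3 / 2] up to sign, hence of this
    form. A coefficient is thus a sum of products of binomials with one [mono], and the comparison
    with the [I_j] becomes linear arithmetic on exponents, that of the sign being taken modulo 2. *)
Definition mono (e1 e2 e3 : Z) : R := powerRZ (-1) e1 * powerRZ 2 e2 * powerRZ 3 e3.

Lemma mono_mul a b c a' b' c' :
  mono a b c * mono a' b' c' = mono (a + a') (b + b') (c + c').
Proof. unfold mono. rewrite !powerRZ_add by lra. ring. Qed.

Lemma powerRZ_even z : powerRZ (-1) (2 * z) = 1.
Proof.
  replace (2 * z)%Z with (z + z)%Z by lia. rewrite powerRZ_add by lra.
  assert (S1 : forall n, (-1) ^ n * (-1) ^ n = 1).
  { intros n. rewrite <- Rpow_mult_distr. replace (-1 * -1) with 1 by ring. apply pow1. }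
  destruct z; simpl; [ring|apply S1|]. now rewrite <- Rinv_mult, S1, Rinv_1.
Qed.

Lemma mono_eq a b c a' b' c' :
  (exists z, a - a' = 2 * z)%Z -> b = b' -> c = c' -> mono a b c = mono a' b' c'.
Proof.
  intros [z Hz] -> ->. unfold mono. do 2 f_equal.
  replace a with (a' + 2 * z)%Z by lia. rewrite powerRZ_add by lra.
  rewrite powerRZ_even. ring.
Qed.

Lemma mono_0 : mono 0 0 0 = 1.
Proof. unfold mono; simpl; ring. Qed.

Lemma mono_neq_0 a b c : mono a b c <> 0.
Proof.
  unfold mono. repeat apply Rmult_integral_contrapositive_currified;
    apply powerRZ_NOR; lra.
Qed.

Lemma mono_inv_pow a b c n :
  (/ mono a b c) ^ n
  = mono (a * Z.of_nat n) (- b * Z.of_nat n) (- c * Z.of_nat n).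
Proof.
  assert (I : / mono a b c = mono a (- b) (- c)).
  { apply Rmult_eq_reg_l with (mono a b c); [|apply mono_neq_0].
    rewrite Rinv_r by apply mono_neq_0. rewrite mono_mul, <- mono_0.
    apply mono_eq; [exists (- a)%Z; lia|lia|lia]. }
  rewrite I. induction n as [|n IH].
  - simpl. rewrite <- mono_0. f_equal; lia.
  - simpl pow. rewrite IH, mono_mul. f_equal; lia.
Qed.

Lemma mono_sign n : (-1) ^ n = mono (Z.of_nat n) 0 0.
Proof. unfold mono. rewrite <- pow_powerRZ. simpl. ring. Qed.

Lemma mono_half_pow n : (/ 2) ^ n = mono 0 (- Z.of_nat n) 0.
Proof.
  replace 2 with (mono 0 1 0) at 1 by (unfold mono; simpl; ring).
  rewrite mono_inv_pow. f_equal; lia.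
Qed.

Lemma mono_two_pow n : 2 ^ n = mono 0 (Z.of_nat n) 0.
Proof. unfold mono. rewrite <- pow_powerRZ. simpl. ring. Qed.

Lemma mono_sgn a : sgn a = mono a 0 0.
Proof. unfold sgn, mono. simpl. ring. Qed.

Lemma taylor_direct e1 e2 e3 b j d : d = mono e1 e2 e3 ->
  taylor_inv b j d = binom (Z.of_nat j + Z.of_nat b - 1) j *
    mono (Z.of_nat j + e1 * (Z.of_nat b + Z.of_nat j))
      (- e2 * (Z.of_nat b + Z.of_nat j)) (- e3 * (Z.of_nat b + Z.of_nat j)).
Proof.
  intros ->. unfold taylor_inv. rewrite mono_inv_pow, mono_sign.
  rewrite (Rmult_comm (mono _ _ _) (binom _ _)), Rmult_assoc, mono_mul.
  f_equal. f_equal; rewrite Nat2Z.inj_add; ring.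
Qed.

(** The symmetry of the binomial makes the summation index [w] the lower entry, as in the [I_j]. *)
Lemma taylor_transposed e1 e2 e3 w b i d : (i <= b)%nat -> d = mono e1 e2 e3 ->
  taylor_inv (S w) (b - i) d = binom (Z.of_nat w + Z.of_nat b - Z.of_nat i) w *
    mono (Z.of_nat b - Z.of_nat i + e1 * (Z.of_nat w + 1 + Z.of_nat b - Z.of_nat i))
      (- e2 * (Z.of_nat w + 1 + Z.of_nat b - Z.of_nat i))
      (- e3 * (Z.of_nat w + 1 + Z.of_nat b - Z.of_nat i)).
Proof.
  intros Hi Hd. rewrite (taylor_direct e1 e2 e3) by easy.
  replace (Z.of_nat (b - i) + Z.of_nat (S w) - 1)%Z with (Z.of_nat (w + (b - i))) by lia.
  rewrite binom_sym.
  replace (Z.of_nat (w + (b - i))) with (Z.of_nat w + Z.of_nat b - Z.of_nat i)%Z by lia.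
  f_equal. f_equal; rewrite Nat2Z.inj_sub, Nat2Z.inj_succ by easy; ring.
Qed.

(** The initial coefficients are those of a single power, so one term survives. Its binomial is
    turned over to get the constant lower entry [q - 1], which is [a9 - 1]. *)
Lemma coef2_first p q i : (0 < q)%nat -> (i <= p)%nat ->
  coef2 p q true i = binom (Z.of_nat p + Z.of_nat q - 1 - Z.of_nat i) (q - 1) *
    mono (Z.of_nat p - Z.of_nat i) 0 0.
Proof.
  intros Hq Hi. unfold coef2, shifted. replace (S p - i)%nat with (S (p - i)) by lia.
  cbn [rsum]. rewrite rsum_zero.
  2:{ intros w Hw. replace (i + w =? p)%nat with false; [ring|].
      symmetry; apply Nat.eqb_neq; lia. }
  replace (i + (p - i) =? p)%nat with true by (symmetry; apply Nat.eqb_eq; lia).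
  rewrite (taylor_direct 0 0 0) by (symmetry; apply mono_0).
  replace (Z.of_nat (p - i) + Z.of_nat q - 1)%Z with (Z.of_nat (q - 1 + (p - i))) by lia.
  rewrite binom_sym.
  replace (Z.of_nat (q - 1 + (p - i))) with (Z.of_nat p + Z.of_nat q - 1 - Z.of_nat i)%Z by lia.
  rewrite Rplus_0_l, Rmult_1_l. f_equal. f_equal; lia.
Qed.

Lemma coef2_second p q i : (0 < p)%nat -> (i <= q)%nat ->
  coef2 p q false i = binom (Z.of_nat p + Z.of_nat q - 1 - Z.of_nat i) (p - 1) *
    mono (Z.of_nat p) 0 0.
Proof.
  intros Hp Hi. unfold coef2, transferred. destruct p as [|p]; [lia|].
  cbn [rsum]. rewrite rsum_zero.
  2:{ intros w Hw. replace (S w =? S p)%nat with false; [ring|].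
      symmetry; apply Nat.eqb_neq; lia. }
  rewrite Nat.eqb_refl.
  rewrite (taylor_transposed 1 0 0) by (try easy; unfold mono; simpl; ring).
  replace (S p - 1)%nat with p by lia.
  replace (Z.of_nat (S p) + Z.of_nat q - 1 - Z.of_nat i)%Z
    with (Z.of_nat p + Z.of_nat q - Z.of_nat i)%Z by lia.
  rewrite Rplus_0_l, Rmult_1_l. f_equal.
  apply mono_eq; [exists (Z.of_nat q - Z.of_nat i)%Z; lia|lia|lia].
Qed.

Definition dist_sign (j : nat) : Z := (pick j 1 0 1 0 0 0 0 0)%Z.
Definition dist_three (j : nat) : Z := (pick j 1 1 0 1 0 1 0 1)%Z.

Lemma pole_dist_mono j : (1 <= j <= 8)%nat ->
  - pole_dist j = mono (dist_sign j) (-1) (dist_three j).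
Proof.
  intros Hj. unfold pole_dist, mono.
  do 9 (destruct j as [|j]; [try lia; simpl; field|]). lia.
Qed.

Lemma pole_dist_mono' j : (1 <= j <= 8)%nat ->
  pole_dist j = mono (1 + dist_sign j) (-1) (dist_three j).
Proof.
  intros Hj. unfold pole_dist, mono.
  do 9 (destruct j as [|j]; [try lia; simpl; field|]). lia.
Qed.

Definition zrsum (n : Z) (f : nat -> R) : R := rsum (Z.to_nat (n + 1)) f.

Definition innerA (p q r u v j k : nat) : R :=
  zrsum (a2 p q r u j - 2 * k) (fun sigma => binom (sigma + v - 1) sigma *
   zrsum (a3 p q r j - a4 k sigma j) (fun rho =>
     binom (rho + u - a5 k sigma j) rho *
   zrsum (a6 p q j - a7 k sigma rho j) (fun omega =>
     binom (omega + r - a8 k sigma rho j) omega *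
     binom (p + q - 1 - omega - a7 k sigma rho j) (Z.to_nat (a9 p q j - 1)) *
     sgn (a10 sigma rho omega j) *
     powerRZ 2 (a11 r u k sigma rho omega j) *
     powerRZ 3 (a12 u v k sigma rho j)))).

Definition innerB (p q r u v j k : nat) : R :=
  zrsum (a2 p q r u j - 1) (fun sigma => binom (sigma + v - 2 * k) sigma *
   zrsum (a3 p q r j - b4 sigma j) (fun rho =>
     binom (rho + u - b5 sigma j) rho *
   zrsum (a6 p q j - b7 sigma rho j) (fun omega =>
     binom (omega + r - b8 sigma rho j) omega *
     binom (p + q - 1 - omega - b7 sigma rho j) (Z.to_nat (a9 p q j - 1)) *
     sgn (a10 sigma rho omega j) *
     powerRZ 2 (b11 r u sigma rho omega j) *
     powerRZ 3 (b12 u v k sigma rho j)))).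

(** The outermost index [sigma] belongs to the factor split off last, with exponent [v]; then [rho]
    belongs to [u], and [omega] to [r]. Both sides nest alike and differ only in the order of the
    factors, so ranges and summands can be compared one by one. *)
Lemma nested_match c c' n1 n1' n2 n2' n3 n3' al be ga al' be' ga' :
  n1 = n1' ->
  (forall s, (s < n1)%nat -> n2 s = n2' s) ->
  (forall s t, (s < n1)%nat -> (t < n2 s)%nat -> n3 s t = n3' s t) ->
  (forall s t w, (s < n1)%nat -> (t < n2 s)%nat -> (w < n3 s t)%nat ->
     c * (al s * (be s t * ga s t w)) = c' * (ga' s t w * be' s t * al' s)) ->
  c * rsum n1 (fun s => al s * rsum (n2 s) (fun t => be s t *
        rsum (n3 s t) (fun w => ga s t w)))
  = c' * rsum n1' (fun s => rsum (n2' s) (fun t =>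
        rsum (n3' s t) (fun w => ga' s t w) * be' s t) * al' s).
Proof.
  intros <- H2 H3 H. rewrite <- !rsum_scal_l. apply rsum_ext. intros s Hs.
  rewrite <- (H2 s Hs). rewrite <- rsum_scal_l, <- rsum_scal_r, <- !rsum_scal_l.
  apply rsum_ext. intros t Ht. rewrite <- (H3 s t Hs Ht).
  rewrite <- !rsum_scal_l, <- !rsum_scal_r, <- !rsum_scal_l.
  apply rsum_ext. intros w Hw. now apply H.
Qed.

Lemma assemble c c' x1 x1' k1 x2 x2' k2 x3 x3' k3 x4 x4' n n' sA p2 p3 m1 m2 m3 m4 :
  x1 = x1' -> x2 = x2' -> x3 = x3' -> x4 = x4' -> n = n' ->
  c * (sA * p2 * p3) = c' * (m4 * m3 * m2 * m1) ->
  c * (binom x1 k1 * (binom x2 k2 * (binom x3 k3 * binom x4 n * sA * p2 * p3)))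
  = c' * (binom x4' n' * m4 * (binom x3' k3 * m3) * (binom x2' k2 * m2) * (binom x1' k1 * m1)).
Proof.
  intros -> -> -> -> -> H.
  transitivity (binom x1' k1 * binom x2' k2 * binom x3' k3 * binom x4' n' * (c * (sA * p2 * p3)));
    [ring|]. rewrite H. ring.
Qed.

Ltac mono_value := unfold mono; simpl; try ring; field.

Ltac rewrite_taylor :=
  match goal with
  | |- context [taylor_inv (S ?w) (?b - ?i) (- (1))] =>
      rewrite (taylor_transposed 1 0 0 w b i (- (1))) by (lia || mono_value)
  | |- context [taylor_inv (S ?w) (?b - ?i) (- (2))] =>
      rewrite (taylor_transposed 1 1 0 w b i (- (2))) by (lia || mono_value)
  | |- context [taylor_inv (S ?w) (?b - ?i) (- (3))] =>
      rewrite (taylor_transposed 1 0 1 w b i (- (3))) by (lia || mono_value)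
  | |- context [taylor_inv ?b ?j 1] =>
      rewrite (taylor_direct 0 0 0 b j 1) by mono_value
  | |- context [taylor_inv ?b ?j 2] =>
      rewrite (taylor_direct 0 1 0 b j 2) by mono_value
  | |- context [taylor_inv ?b ?j 3] =>
      rewrite (taylor_direct 0 0 1 b j 3) by mono_value
  | |- context [taylor_inv ?b ?j (pole_dist ?m)] =>
      rewrite (taylor_direct (1 + dist_sign m) (-1) (dist_three m) b j (pole_dist m))
        by (apply pole_dist_mono'; lia)
  end.

Ltac solve_exponents :=
  apply assemble; [lia|lia|lia|lia|lia|];
  match goal with |- context [sgn ?a * powerRZ 2 ?b * powerRZ 3 ?c] =>
    replace (sgn a * powerRZ 2 b * powerRZ 3 c) with (mono a b c) by reflexivity
  end;
  rewrite !mono_sgn, !mono_mul; apply mono_eq;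
  [match goal with |- exists z, ?e = _ => exists (e / 2)%Z end;
   Z.to_euclidean_division_equations; lia|lia|lia].

Ltac case_match :=
  cbn [pick pole_order coef4 dist_sign dist_three]; unfold zrsum, shifted, transferred;
  apply nested_match;
  [lia|intros; lia|intros; lia|
   intros s t w Hs Ht Hw;
   first [rewrite coef2_first by lia|rewrite coef2_second by lia];
   repeat rewrite_taylor;
   unfold dist_sign, dist_three; cbn [pick];
   solve_exponents].

(** The factor is [- 2 ^ (- v)]: the power comes from the form [2 z + 3 N], the sign from the [I_j]
    standing on the same side of the identity as the six series. *)
Lemma coefA_match p q r u v j k :
  (0 < p)%nat -> (0 < q)%nat -> (0 < r)%nat -> (0 < u)%nat -> (0 < v)%nat ->
  (1 <= j <= 8)%nat -> (2 * k <= pole_order p q r u j)%nat ->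
  sgn (p + a1 v j) * innerA p q r u v j k
  = mono 1 (- Z.of_nat v) 0 * coefA p q r u v j (2 * k).
Proof.
  intros Hp Hq Hr Hu Hv Hj Hk. unfold innerA, coefA.
  unfold a1, a2, a3, a4, a5, a6, a7, a8, a9, a10, a11, a12.
  destruct j as [|[|[|[|[|[|[|[|[|j]]]]]]]]]; try lia; cbn [pole_order] in Hk.
  all: case_match.
Qed.

(* The coefficient of [y ^ (v - 2 k)] in [(d + y) ^ (- (w + 1))] for
   [d = - pole_dist j]; unlike with [taylor_inv], the order [v - 2 k] may be [-1],
   where the convention of [binom] gives [-1] for [w = 0] instead of [0]. *)
Definition half_pole_taylor (v k j w : nat) : R :=
  let e := (Z.of_nat v - 2 * Z.of_nat k)%Z in
  binom (Z.of_nat w + Z.of_nat v - 2 * Z.of_nat k) w *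
  mono (e + dist_sign j * (Z.of_nat w + 1 + e))
    (Z.of_nat w + 1 + e) (- dist_three j * (Z.of_nat w + 1 + e)).

(** Compared with [coefA_match] there is a further [2 ^ (2 k - 1)]. It offsets the [2 ^ (- 2 k)] of
    the [B_1j] and the 2 in [zeta w + phi w = 2 * 2 ^ (- w) * zeta w]. The range includes
    [2 k = v + 1]. *)
Lemma coefB_match p q r u v j k :
  (0 < p)%nat -> (0 < q)%nat -> (0 < r)%nat -> (0 < u)%nat -> (0 < v)%nat ->
  (1 <= j <= 8)%nat -> (2 * k <= S v)%nat ->
  sgn (p + b1 v j) * innerB p q r u v j k
  = mono 1 (2 * Z.of_nat k - Z.of_nat v - 1) 0 *
    rsum (pole_order p q r u j) (fun s => coef4 p q r u j (S s) * half_pole_taylor v k j s).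
Proof.
  intros Hp Hq Hr Hu Hv Hj Hk. unfold innerB, half_pole_taylor.
  unfold b1, a2, a3, b4, b5, a6, b7, b8, a9, a10, b11, b12.
  destruct j as [|[|[|[|[|[|[|[|[|j]]]]]]]]]; try lia.
  all: case_match.
Qed.

Lemma coefB_value p q r u v j k : (1 <= j <= 8)%nat -> (2 * k <= v)%nat ->
  rsum (pole_order p q r u j) (fun s => coef4 p q r u j (S s) * half_pole_taylor v k j s)
  = coefB p q r u v j (2 * k).
Proof.
  intros Hj Hk. unfold coefB, transferred. apply rsum_ext. intros s _. f_equal.
  rewrite (taylor_transposed (dist_sign j) (-1) (dist_three j)) by (easy || now apply pole_dist_mono).
  unfold half_pole_taylor. replace (Z.of_nat (2 * k)) with (2 * Z.of_nat k)%Z by lia.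
  f_equal. f_equal; ring.
Qed.

Lemma half_pole_taylor_order_minus_1 k v j s : (2 * k = S v)%nat ->
  half_pole_taylor v k j s = if Nat.eqb s 0 then -1 else 0.
Proof.
  intros H. unfold half_pole_taylor.
  replace (Z.of_nat v - 2 * Z.of_nat k)%Z with (-1)%Z by lia.
  replace (Z.of_nat s + Z.of_nat v - 2 * Z.of_nat k)%Z with (Z.of_nat s - 1)%Z by lia.
  destruct s as [|s].
  - simpl Z.of_nat. simpl binom. simpl Nat.eqb. cbn iota.
    replace (-1 + dist_sign j * (0 + 1 + -1))%Z with (-1)%Z by lia.
    replace (- dist_three j * (0 + 1 + -1))%Z with 0%Z by lia.
    unfold mono; simpl; field.
  - replace (Z.of_nat (S s) - 1)%Z with (Z.of_nat s) by lia.
    rewrite binom_small_nat by lia. simpl. ring.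
Qed.

(** Families [2 i - 1] and [2 i] are the two halves of one splitting, that of the factor with
    exponent [u], so the residues cancel in pairs. *)
Lemma residues_cancel p q r u : (0 < p)%nat -> (0 < q)%nat -> (0 < r)%nat -> (0 < u)%nat ->
  rsum 8 (fun i => coef4 p q r u (S i) 1) = 0.
Proof.
  intros Hp Hq Hr Hu. cbn [rsum]. cbn [coef4].
  assert (H1 := residue_cancel p (shifted p (coef2 p q true) r 2) u 3 ltac:(lra) Hu).
  assert (H2 := residue_cancel q (shifted q (coef2 p q false) r 1) u 2 ltac:(lra) Hu).
  assert (H3 := residue_cancel r (transferred p (coef2 p q true) r (- (2))) u 1 ltac:(lra) Hu).
  assert (H4 := residue_cancel r (transferred q (coef2 p q false) r (- (1))) u 1 ltac:(lra) Hu).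
  lra.
Qed.

(** At [2 k = v + 1] each family contributes a common multiple of its residue [coef4 ... 1], taken
    before the factor at [- 3 / 2] is split off. *)
Lemma spurious_cancel p q r u v k :
  (0 < p)%nat -> (0 < q)%nat -> (0 < r)%nat -> (0 < u)%nat -> (0 < v)%nat ->
  (2 * k = S v)%nat ->
  rsum 8 (fun i => sgn (p + b1 v (S i)) * innerB p q r u v (S i) k) = 0.
Proof.
  intros Hp Hq Hr Hu Hv Hk.
  rewrite (rsum_ext 8 _ (fun i => mono 1 (2 * Z.of_nat k - Z.of_nat v - 1) 0 * -1
     * coef4 p q r u (S i) 1)).
  - now rewrite rsum_scal_l, residues_cancel, Rmult_0_r by easy.
  - intros i Hi. rewrite coefB_match by (easy || lia). rewrite Rmult_assoc. f_equal.
    rewrite (rsum_ext _ _ (fun s => if Nat.eqb s 0 then -1 * coef4 p q r u (S i) 1 else 0)).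
    + assert (O : (0 < pole_order p q r u (S i))%nat).
      { clear Hi. do 8 (destruct i as [|i]; [easy|]). easy. }
      destruct (pole_order p q r u (S i)) as [|n]; [lia|].
      rewrite rsum_first, rsum_zero by easy. simpl. ring.
    + intros s _. rewrite half_pole_taylor_order_minus_1 by easy.
      destruct s as [|s]; simpl; ring.
Qed.

(** * The identity in a half plane *)

Fixpoint csum (n : nat) (f : nat -> C) : C :=
  match n with O => RtoC 0 | S n' => (csum n' f + f n')%C end.

Lemma csum_ext n f g : (forall i, (i < n)%nat -> f i = g i) -> csum n f = csum n g.
Proof.
  induction n as [|n IH]; intros H; simpl; [easy|].
  rewrite IH by (intros; apply H; lia). now rewrite H by lia.
Qed.

Lemma csum_plus n f g : csum n (fun i => f i + g i)%C = (csum n f + csum n g)%C.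
Proof. induction n as [|n IH]; simpl; [ring|rewrite IH; ring]. Qed.

Lemma csum_scal_l n c f : csum n (fun i => c * f i)%C = (c * csum n f)%C.
Proof. induction n as [|n IH]; simpl; [ring|rewrite IH; ring]. Qed.

Lemma csum_scal_r n c f : csum n (fun i => f i * c)%C = (csum n f * c)%C.
Proof. induction n as [|n IH]; simpl; [ring|rewrite IH; ring]. Qed.

Lemma csum_RtoC n f : csum n (fun i => RtoC (f i)) = RtoC (rsum n f).
Proof. induction n as [|n IH]; simpl; [easy|]. now rewrite IH, RtoC_plus. Qed.

Lemma Re_csum n f : Re (csum n f) = rsum n (fun i => Re (f i)).
Proof. induction n as [|n IH]; simpl; [easy|]. now rewrite <- IH. Qed.

Lemma Im_csum n f : Im (csum n f) = rsum n (fun i => Im (f i)).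
Proof. induction n as [|n IH]; simpl; [easy|]. now rewrite <- IH. Qed.

Lemma zsum_csum n f : zsum n f = csum (Z.to_nat (n + 1)) f.
Proof.
  unfold zsum. destruct (Z.ltb_spec n 0) as [H|H].
  - now replace (Z.to_nat (n + 1)) with 0%nat by lia.
  - replace (Z.to_nat (n + 1)) with (S (Z.to_nat n)) by lia.
    generalize (Z.to_nat n). intros m. induction m as [|m IH].
    + rewrite sum_O. simpl. ring.
    + rewrite sum_Sn, IH. reflexivity.
Qed.

Lemma zsum_real n f g z : (forall i, f i = (RtoC (g i) * z)%C) ->
  zsum n f = (RtoC (zrsum n g) * z)%C.
Proof.
  intros H. rewrite zsum_csum. unfold zrsum. rewrite <- csum_RtoC, <- csum_scal_r.
  now apply csum_ext.
Qed.

Lemma zsum_real_step n b G h z : (forall i, G i = (RtoC (h i) * z)%C) ->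
  zsum n (fun i => RtoC (b i) * G i)%C = (RtoC (zrsum n (fun i => b i * h i)%R) * z)%C.
Proof. intros H. apply zsum_real. intros i. rewrite H, RtoC_mult. ring. Qed.

Lemma a2_pole_order p q r u j : (1 <= j <= 8)%nat ->
  a2 p q r u j = Z.of_nat (pole_order p q r u j).
Proof. intros H. do 9 (destruct j as [|j]; [try lia; easy|]). lia. Qed.

Lemma to_nat_half n : Z.to_nat (Z.of_nat n / 2 + 1) = S (n / 2).
Proof.
  replace (Z.of_nat n / 2)%Z with (Z.of_nat (n / 2)) by (rewrite Nat2Z.inj_div; easy). lia.
Qed.

Section Terms.
Variables p q r u v : nat.
Hypothesis zeta_cont : is_continuation zeta_series zeta.

(** For [k >= 1] the argument lies in the half-plane of the series; only [k = 0] calls for the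
    continuation. *)
Lemma zeta_even_zeven k : zeta_even k = RtoC (zeven k).
Proof.
  unfold zeta_even. destruct k as [|k].
  - replace (2 * RtoC (INR 0))%C with (RtoC 0) by (simpl; ring).
    now apply continued_zeta_0.
  - rewrite <- RtoC_mult. replace (2 * INR (S k)) with (INR (2 * S k)) by (rewrite mult_INR; easy).
    rewrite (proj2 zeta_cont).
    + now rewrite zeta_series_real.
    + cbn [Re fst RtoC]. apply (lt_INR 1). lia.
Qed.

Lemma termA_csum s j : (1 <= j <= 8)%nat ->
  termA p q r u v s j = csum (S (pole_order p q r u j / 2)) (fun k =>
    RtoC (2 * zeven k * (sgn (p + a1 v j) * innerA p q r u v j k))
    * zeta (weight p q r u v s k))%C.
Proof.
  intros Hj. unfold termA. rewrite zsum_csum.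
  replace (Z.to_nat (a2 p q r u j / 2 + 1)) with (S (pole_order p q r u j / 2)).
  2:{ rewrite a2_pole_order by easy. symmetry. apply to_nat_half. }
  rewrite <- csum_scal_l. apply csum_ext. intros k _.
  match goal with |- (_ * (_ * ?Z))%C = _ =>
    replace Z with (RtoC (innerA p q r u v j k) * zeta (weight p q r u v s k))%C end.
  - rewrite zeta_even_zeven, !RtoC_mult. ring.
  - symmetry. unfold innerA. apply zsum_real_step. intros sigma. apply zsum_real_step.
    intros rho. apply zsum_real. intros omega. now rewrite !RtoC_mult.
Qed.

(** Where the series converges, this is twice the sum of [N ^ (- w)] over even [N], and
    [zeta w - phi w] is twice the sum over odd [N]. *)
Lemma zeta_plus_phi w : (zeta w + phi w)%C = (rcpow 2 (1 - w) * zeta w)%C.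
Proof. unfold phi. ring. Qed.

Lemma zeta_minus_phi w : (zeta w - phi w)%C = ((2 - rcpow 2 (1 - w)) * zeta w)%C.
Proof. unfold phi. ring. Qed.

Lemma termB1_csum s j :
  termB1 p q r u v s j = csum (S (v / 2)) (fun k =>
    RtoC (2 * zeven k * powerRZ 2 (- (2 * k)) * (sgn (p + b1 v j) * innerB p q r u v j k))
    * (rcpow 2 (1 - weight p q r u v s k) * zeta (weight p q r u v s k)))%C.
Proof.
  unfold termB1. rewrite zsum_csum, to_nat_half.
  rewrite <- csum_scal_l. apply csum_ext. intros k _. rewrite <- zeta_plus_phi.
  match goal with |- (_ * (_ * ?Z))%C = (_ * ?z)%C =>
    replace Z with (RtoC (innerB p q r u v j k) * z)%C end.
  - rewrite zeta_even_zeven, !RtoC_mult. ring.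
  - symmetry. unfold innerB. apply zsum_real_step. intros sigma. apply zsum_real_step.
    intros rho. apply zsum_real. intros omega. now rewrite !RtoC_mult.
Qed.

Lemma termB2_csum s j :
  termB2 p q r u v s j = csum (S (S v / 2)) (fun k =>
    RtoC (2 * zeven k * (1 - powerRZ 2 (- (2 * k))) * (sgn (p + b1 v j) * innerB p q r u v j k))
    * ((2 - rcpow 2 (1 - weight p q r u v s k)) * zeta (weight p q r u v s k)))%C.
Proof.
  unfold termB2. rewrite zsum_csum.
  replace (Z.of_nat v + 1)%Z with (Z.of_nat (S v)) by lia. rewrite to_nat_half.
  rewrite <- csum_scal_l. apply csum_ext. intros k _. rewrite <- zeta_minus_phi.
  match goal with |- (_ * (_ * ?Z))%C = (_ * ?z)%C =>
    replace Z with (RtoC (innerB p q r u v j k) * z)%C end.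
  - rewrite zeta_even_zeven, !RtoC_mult, RtoC_minus. ring.
  - symmetry. unfold innerB. apply zsum_real_step. intros sigma. apply zsum_real_step.
    intros rho. apply zsum_real. intros omega. now rewrite !RtoC_mult.
Qed.
End Terms.

Lemma ex_Cdirichlet w : 2 <= Re w ->
  ex_series (fun N => Re (Cdirichlet w N)) /\ ex_series (fun N => Im (Cdirichlet w N)).
Proof.
  intros Hw. split; apply ex_series_le_R with (2 := ex_series_inv_sqr); intros N;
    now apply Cdirichlet_bound.
Qed.

Lemma CSeries_scal (c : C) (a : nat -> C) :
  ex_series (fun n => Re (a n)) -> ex_series (fun n => Im (a n)) ->
  CSeries (fun n => c * a n)%C = (c * CSeries a)%C.
Proof.
  intros E1 E2. unfold CSeries, Cmult. cbn [fst snd]. f_equal.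
  - rewrite <- !Series_scal_l. rewrite <- Series_minus by now apply ex_series_scal_l_R.
    now apply Series_ext.
  - rewrite <- !Series_scal_l. rewrite <- Series_plus by now apply ex_series_scal_l_R.
    now apply Series_ext.
Qed.

Lemma Series_split_parity_abs (a : nat -> R) :
  ex_series (fun n => Rabs (a n)) ->
  Series a = Series (fun j => a (2 * j)%nat) + Series (fun j => a (S (2 * j))).
Proof.
  intros E. pose (b := fun n => a n + Rabs (a n)).
  assert (Ea : ex_series a).
  { apply ex_series_le_R with (2 := E). intros; apply Rle_refl. }
  destruct (Series_split_parity _ (fun n => Rabs_pos (a n)) E) as (A1 & A2 & A3).
  destruct (Series_split_parity b) as (B1 & B2 & B3).
  - intros n. unfold b. assert (H := Rle_abs (- a n)). rewrite Rabs_Ropp in H. lra.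
  - now apply ex_series_plus_R.
  - assert (D : forall g : nat -> nat, ex_series (fun j => Rabs (a (g j))) ->
       ex_series (fun j => b (g j)) ->
       Series (fun j => a (g j)) = Series (fun j => b (g j)) - Series (fun j => Rabs (a (g j)))).
    { intros g H1 H2. rewrite <- Series_minus by easy. apply Series_ext.
      intros n. unfold b. ring. }
    assert (D0 : Series a = Series b - Series (fun j => Rabs (a j))).
    { apply (D (fun j => j)); [easy|now apply ex_series_plus_R]. }
    rewrite D0.
    rewrite (D (fun j => 2 * j)%nat), (D (fun j => S (2 * j))) by easy.
    rewrite A3, B3. ring.
Qed.

Lemma CSeries_split_parity (a : nat -> C) :
  ex_series (fun n => Rabs (Re (a n))) -> ex_series (fun n => Rabs (Im (a n))) ->
  CSeries a = (CSeries (fun j => a (2 * j)%nat) + CSeries (fun j => a (S (2 * j))))%C.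
Proof.
  intros H1 H2. unfold CSeries, Cplus. cbn [fst snd].
  f_equal; now apply (Series_split_parity_abs (fun n => _ (a n))).
Qed.

Lemma Cdirichlet_double w j :
  Cdirichlet w (S (2 * j)) = (/ rcpow 2 w * Cdirichlet w j)%C.
Proof.
  unfold Cdirichlet. replace (INR (S (S (2 * j)))) with (2 * INR (S j)).
  - rewrite rcpow_mult by (lra || apply INR_S_pos). field. split; apply rcpow_neq_0.
  - rewrite !S_INR, mult_INR. simpl. ring.
Qed.

(** The even integers carry weight 1 and make up the part [2 ^ (- w)] of zeta; the odd ones carry
    [2 ^ (2 k) - 1] and make up the part [1 - 2 ^ (- w)]. *)
Lemma CSeries_parity k w : 2 <= Re w ->
  CSeries (fun N => RtoC (parity_factor (S N) k) * Cdirichlet w N)%C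
  = ((/ rcpow 2 w + RtoC (2 ^ (2 * k) - 1) * (1 - / rcpow 2 w)) * zeta_series w)%C.
Proof.
  intros Hw. destruct (ex_Cdirichlet w Hw) as [E1 E2].
  assert (Abs : forall c : nat -> R, (exists K, forall N, Rabs (c N) <= K) ->
     ex_series (fun N => Rabs (Re (RtoC (c N) * Cdirichlet w N)%C)) /\
     ex_series (fun N => Rabs (Im (RtoC (c N) * Cdirichlet w N)%C))).
  { intros c [K HK].
    split; apply ex_series_le_R with (2 := ex_series_scal_l_R K _ ex_series_inv_sqr);
      intros N; rewrite Rabs_Rabsolu, ?Re_scal_r, ?Im_scal_r, Rabs_mult;
      apply Rmult_le_compat; try apply Rabs_pos; try apply HK; now apply Cdirichlet_bound. }
  assert (Half : CSeries (fun j => Cdirichlet w (S (2 * j))) = (/ rcpow 2 w * zeta_series w)%C).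
  { rewrite (CSeries_ext _ _ (Cdirichlet_double w)). now rewrite CSeries_scal. }
  assert (Odd : CSeries (fun j => Cdirichlet w (2 * j)) = ((1 - / rcpow 2 w) * zeta_series w)%C).
  { destruct (Abs (fun _ => 1)) as [A1 A2].
    { exists 1. intros _. rewrite Rabs_R1. lra. }
    assert (S := CSeries_split_parity (fun N => RtoC 1 * Cdirichlet w N)%C A1 A2).
    rewrite !(CSeries_ext (fun N => RtoC 1 * _)%C _ (fun N => Cmult_1_l _)) in S.
    rewrite Half in S. change (CSeries (fun N => Cdirichlet w N)) with (zeta_series w) in S.
    replace ((1 - / rcpow 2 w) * zeta_series w)%C
      with (zeta_series w - / rcpow 2 w * zeta_series w)%C by ring.
    rewrite S at 1. ring. }
  destruct (Abs (fun N => parity_factor (S N) k)) as [A1 A2].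
  { exists (2 ^ (2 * k)). intros N. assert (B := parity_factor_bound (S N) k).
    rewrite Rabs_pos_eq; lra. }
  rewrite (CSeries_split_parity _ A1 A2).
  rewrite (CSeries_ext (fun j => RtoC (parity_factor (S (2 * j)) k) * Cdirichlet w (2 * j))%C
    (fun j => RtoC (2 ^ (2 * k) - 1) * Cdirichlet w (2 * j))%C).
  2:{ intros j. unfold parity_factor. now rewrite Nat.even_succ, Nat.odd_even. }
  rewrite (CSeries_ext (fun j => RtoC (parity_factor (S (S (2 * j))) k) * Cdirichlet w (S (2 * j)))%C
    (fun j => Cdirichlet w (S (2 * j)))).
  2:{ intros j. unfold parity_factor.
      replace (S (S (2 * j))) with (2 * S j)%nat by lia. rewrite Nat.even_even. ring. }
  rewrite CSeries_scal, Odd, Half; [ring| |].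
  - apply ex_series_ext with (fun j => Re (Cdirichlet w (2 * j))); [easy|].
    destruct (Series_split_parity (fun N => Rabs (Re (Cdirichlet w N)))) as (X & _).
    + intros; apply Rabs_pos.
    + apply ex_series_le_R with (2 := ex_series_inv_sqr). intros N.
      rewrite Rabs_Rabsolu. now apply Cdirichlet_bound.
    + apply ex_series_le_R with (2 := X). intros; apply Rle_refl.
  - destruct (Series_split_parity (fun N => Rabs (Im (Cdirichlet w N)))) as (X & _).
    + intros; apply Rabs_pos.
    + apply ex_series_le_R with (2 := ex_series_inv_sqr). intros N.
      rewrite Rabs_Rabsolu. now apply Cdirichlet_bound.
    + apply ex_series_le_R with (2 := X). intros; apply Rle_refl.
Qed.

Section HalfPlane.
Variables p q r u v : nat.
Hypothesis Hp : (0 < p)%nat.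
Hypothesis Hq : (0 < q)%nat.
Hypothesis Hr : (0 < r)%nat.
Hypothesis Hu : (0 < u)%nat.
Hypothesis Hv : (0 < v)%nat.
Hypothesis zeta_cont : is_continuation zeta_series zeta.

Let wgt := weight p q r u v.
Let wt := (p + q + r + u + v)%nat.

Lemma weight_eq s k : wgt s k = (s + RtoC (INR wt) - RtoC (INR (2 * k)))%C.
Proof.
  unfold wgt, weight, wt. rewrite !plus_INR, mult_INR, !RtoC_plus, RtoC_mult.
  replace (INR 2) with 2 by (simpl; ring). ring.
Qed.

Lemma power_weight_Cdirichlet s k N :
  (RtoC (power_weight p q r u v k N) * Cdirichlet s N)%C = Cdirichlet (wgt s k) N.
Proof.
  assert (P := INR_S_pos N). unfold Cdirichlet, power_weight. fold wt.
  rewrite weight_eq. unfold Cminus. rewrite !rcpow_plus, rcpow_opp, !rcpow_nat by easy.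
  rewrite RtoC_mult, pow_inv.
  assert (Nz : forall n, INR (S N) ^ n <> 0) by (intros; apply pow_nonzero; lra).
  rewrite RtoC_inv by apply Nz. field.
  repeat split; try apply rcpow_neq_0; intros E; apply RtoC_inj in E; now apply Nz in E.
Qed.

Lemma Re_weight_ge s k : 2 <= Re s -> (2 * k <= wt)%nat -> 2 <= Re (wgt s k).
Proof.
  intros Hs Hk. rewrite weight_eq. apply le_INR in Hk.
  assert (E : forall a b : R, Re (s + RtoC a - RtoC b)%C = Re s + a - b)
    by (intros; unfold Re; simpl; ring).
  rewrite E. lra.
Qed.

Ltac component part part_scal part_csum identity :=
  match goal with |- _ ?x = _ ?y => change (part x = part y) end;
  rewrite part_scal, !part_csum;
  etransitivity; [apply rsum_ext; intros ? _; apply part_scal|];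
  etransitivity; [apply identity|];
  f_equal; apply rsum_ext; intros ? _;
  match goal with |- _ = part (?x + ?y)%C => change (part (x + y)%C) with (part x + part y) end;
  rewrite !part_csum; f_equal; apply rsum_ext; intros ? _; rewrite part_scal; f_equal;
  unfold CSeries; cbn [Re Im fst snd]; apply Series_ext; intros ?; now rewrite !part_scal.

Lemma chamber_identity s : 2 <= Re s ->
  csum 6 (fun i => RtoC ((-1) ^ chamber_sign p q r u v i) * Cchamber_total p q r u v s i)%C
  = (RtoC ((/ 2) ^ v) * csum 8 (fun i =>
      csum (S (pole_order p q r u (S i) / 2)) (fun k =>
        RtoC (2 * zeven k * coefA p q r u v (S i) (2 * k)) * zeta (wgt s k))
      + csum (S (v / 2)) (fun k =>
        RtoC (2 * zeven k * coefB p q r u v (S i) (2 * k)) *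
        ((/ rcpow 2 (wgt s k) + RtoC (2 ^ (2 * k) - 1) * (1 - / rcpow 2 (wgt s k)))
         * zeta (wgt s k)))))%C.
Proof.
  intros Hs.
  assert (ZA : forall k, (2 * k <= wt)%nat -> zeta (wgt s k)
    = CSeries (fun N => RtoC (power_weight p q r u v k N) * Cdirichlet s N)%C).
  { intros k Hk. assert (W := Re_weight_ge s k Hs Hk).
    rewrite (proj2 zeta_cont) by lra. apply CSeries_ext. intros N.
    symmetry. apply power_weight_Cdirichlet. }
  assert (ZB : forall k, (2 * k <= wt)%nat ->
     ((/ rcpow 2 (wgt s k) + RtoC (2 ^ (2 * k) - 1) * (1 - / rcpow 2 (wgt s k)))
         * zeta (wgt s k))%C
    = CSeries (fun N => RtoC (parity_factor (S N) k) *
        (RtoC (power_weight p q r u v k N) * Cdirichlet s N))%C).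
  { intros k Hk. assert (W := Re_weight_ge s k Hs Hk).
    rewrite (proj2 zeta_cont) by lra. rewrite <- CSeries_parity by easy.
    apply CSeries_ext. intros N. now rewrite power_weight_Cdirichlet. }
  assert (OA : forall i k, (k < S (pole_order p q r u (S i) / 2))%nat -> (2 * k <= wt)%nat).
  { intros i k Hk. assert (A : (pole_order p q r u (S i) <= wt)%nat) by now apply pole_order_le.
    assert (D := double_half_le (pole_order p q r u (S i))). unfold wt. lia. }
  assert (OB : forall k, (k < S (v / 2))%nat -> (2 * k <= wt)%nat).
  { intros k Hk. assert (D := double_half_le v). unfold wt. lia. }
  rewrite (csum_ext 8 _ (fun i =>
      csum (S (pole_order p q r u (S i) / 2)) (fun k =>
        RtoC (2 * zeven k * coefA p q r u v (S i) (2 * k)) *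
        CSeries (fun N => RtoC (power_weight p q r u v k N) * Cdirichlet s N))
      + csum (S (v / 2)) (fun k =>
        RtoC (2 * zeven k * coefB p q r u v (S i) (2 * k)) *
        CSeries (fun N => RtoC (parity_factor (S N) k) *
        (RtoC (power_weight p q r u v k N) * Cdirichlet s N))))%C).
  2:{ intros i _. f_equal; apply csum_ext; intros k Hk.
      - now rewrite ZA by now apply (OA i).
      - now rewrite ZB by now apply OB. }
  assert (I1 := weighted_identity p q r u v Hp Hq Hr Hu Hv _ (fun N => proj1 (Cdirichlet_bound s N Hs))).
  assert (I2 := weighted_identity p q r u v Hp Hq Hr Hu Hv _ (fun N => proj2 (Cdirichlet_bound s N Hs))).
  apply injective_projections.
  - component Re Re_scal_r Re_csum I1.
  - component Im Im_scal_r Im_csum I2.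
Qed.
End HalfPlane.

(** * Continuation *)

Lemma rcpow_2_one_minus w : rcpow 2 (1 - w) = (2 * / rcpow 2 w)%C.
Proof.
  unfold Cminus. rewrite rcpow_plus, rcpow_opp. f_equal.
  change (RtoC 1) with (RtoC (INR 1)). rewrite rcpow_nat by lra. f_equal. ring.
Qed.

Lemma powerRZ_2_double k : powerRZ 2 (- (2 * Z.of_nat k)) = / 2 ^ (2 * k).
Proof.
  rewrite powerRZ_neg'. f_equal. rewrite pow_powerRZ. f_equal. lia.
Qed.

Lemma mono_minus_half v : mono 1 (- Z.of_nat v) 0 = - (/ 2) ^ v.
Proof.
  rewrite mono_half_pow. unfold mono. simpl. ring.
Qed.

Lemma mono_B v k : mono 1 (2 * Z.of_nat k - Z.of_nat v - 1) 0
  = - (/ 2) ^ v * 2 ^ (2 * k) * / 2.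
Proof.
  replace (mono 1 (2 * Z.of_nat k - Z.of_nat v - 1) 0)
    with (mono 1 (- Z.of_nat v) 0 * (mono 0 (Z.of_nat (2 * k)) 0 * mono 0 (-1) 0)).
  - rewrite mono_minus_half, <- mono_two_pow. unfold mono. simpl. field.
  - rewrite !mono_mul. f_equal; lia.
Qed.

Section Total.
Variables p q r u v : nat.
Hypothesis Hp : (0 < p)%nat.
Hypothesis Hq : (0 < q)%nat.
Hypothesis Hr : (0 < r)%nat.
Hypothesis Hu : (0 < u)%nat.
Hypothesis Hv : (0 < v)%nat.
Hypothesis zeta_cont : is_continuation zeta_series zeta.

Let w := weight p q r u v.

Lemma termA_value s j : (1 <= j <= 8)%nat ->
  termA p q r u v s j = (RtoC (- (/ 2) ^ v) *
    csum (S (pole_order p q r u j / 2)) (fun k =>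
      RtoC (2 * zeven k * coefA p q r u v j (2 * k)) * zeta (w s k)))%C.
Proof.
  intros Hj. rewrite termA_csum by easy. rewrite <- csum_scal_l.
  apply csum_ext. intros k Hk.
  assert (D := double_half_le (pole_order p q r u j)).
  rewrite coefA_match, mono_minus_half by (easy || lia).
  unfold w. rewrite Cmult_assoc, <- RtoC_mult. f_equal. f_equal. ring.
Qed.

Lemma termB1_value s j : (1 <= j <= 8)%nat ->
  termB1 p q r u v s j = (RtoC (- (/ 2) ^ v) *
    csum (S (v / 2)) (fun k => RtoC (2 * zeven k * coefB p q r u v j (2 * k)) *
      (/ rcpow 2 (w s k) * zeta (w s k))))%C.
Proof.
  intros Hj. rewrite termB1_csum by easy. rewrite <- csum_scal_l.
  apply csum_ext. intros k Hk. assert (D := double_half_le v).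
  rewrite coefB_match, coefB_value, mono_B by (easy || lia).
  rewrite rcpow_2_one_minus, powerRZ_2_double. fold w.
  assert (N : 2 ^ (2 * k) <> 0) by (apply pow_nonzero; lra).
  replace (2 * zeven k * / 2 ^ (2 * k) *
     (- (/ 2) ^ v * 2 ^ (2 * k) * / 2 * coefB p q r u v j (2 * k)))
    with (- (/ 2) ^ v * (2 * zeven k * coefB p q r u v j (2 * k)) * / 2) by (field; lra).
  rewrite (RtoC_mult _ (/ 2)), (RtoC_mult (- _)), RtoC_inv by lra. field.
  repeat split; try apply rcpow_neq_0; intros E; apply RtoC_inj in E; lra.
Qed.

(** Stated only for the sum over [j]: when [v] is odd, the extra terms [2 k = v + 1] cancel between
    the families and not within each of them. *)
Lemma termB2_sum s :
  csum 8 (fun i => termB2 p q r u v s (S i)) = (RtoC (- (/ 2) ^ v) *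
    csum 8 (fun i => csum (S (v / 2)) (fun k =>
      RtoC (2 * zeven k * coefB p q r u v (S i) (2 * k)) *
      (RtoC (2 ^ (2 * k) - 1) * (1 - / rcpow 2 (w s k)) * zeta (w s k)))))%C.
Proof.
  pose (g := fun i k => (RtoC (2 * zeven k * (1 - powerRZ 2 (- (2 * Z.of_nat k)))
       * (sgn (Z.of_nat p + b1 v (S i)) * innerB p q r u v (S i) k))
    * ((2 - rcpow 2 (1 - w s k)) * zeta (w s k)))%C).
  transitivity (csum 8 (fun i => csum (S (S v / 2)) (g i))).
  { apply csum_ext. intros i _. now apply termB2_csum. }
  transitivity (csum 8 (fun i => csum (S (v / 2)) (g i))).
  - destruct (even_or_odd v) as [[m Hm]|[m Hm]].
    + replace (S v / 2)%nat with (v / 2)%nat; [easy|].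
      replace (S v) with (1 + m * 2)%nat by lia. rewrite Nat.div_add by lia.
      replace v with (m * 2)%nat by lia. rewrite Nat.div_mul by lia. easy.
    + replace (S v / 2)%nat with (S m).
      2:{ replace (S v) with (S m * 2)%nat by lia. now rewrite Nat.div_mul by lia. }
      replace (v / 2)%nat with m.
      2:{ replace v with (1 + m * 2)%nat by lia. rewrite Nat.div_add by lia. easy. }
      transitivity (csum 8 (fun i => csum (S m) (g i) + g i (S m))%C); [easy|].
      rewrite csum_plus.
      replace (csum 8 (fun i => g i (S m))) with (RtoC 0); [ring|].
      unfold g. rewrite csum_scal_r, csum_RtoC, rsum_scal_l, spurious_cancel by (easy || lia).
      rewrite Rmult_0_r. ring.
  - rewrite <- csum_scal_l. apply csum_ext. intros i Hi.
    rewrite <- csum_scal_l. apply csum_ext. intros k Hk. assert (D := double_half_le v).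
    unfold g. rewrite coefB_match, coefB_value, mono_B by (easy || lia).
    rewrite rcpow_2_one_minus, powerRZ_2_double.
    assert (N : 2 ^ (2 * k) <> 0) by (apply pow_nonzero; lra).
    replace (2 * zeven k * (1 - / 2 ^ (2 * k)) *
       (- (/ 2) ^ v * 2 ^ (2 * k) * / 2 * coefB p q r u v (S i) (2 * k)))
      with (- (/ 2) ^ v * (2 * zeven k * coefB p q r u v (S i) (2 * k)) * (2 ^ (2 * k) - 1) * / 2)
      by (field; lra).
    rewrite (RtoC_mult _ (/ 2)), (RtoC_mult _ (2 ^ (2 * k) - 1)), (RtoC_mult (- _)),
      RtoC_inv by lra. field.
    repeat split; try apply rcpow_neq_0; intros E; apply RtoC_inj in E; lra.
Qed.

Definition total (F : nat -> C -> C) (s : C) : C :=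
  (csum 6 (fun i => RtoC ((-1) ^ chamber_sign p q r u v i) * F i s)
   + csum 8 (fun i => I_sum p q r u v s (S i)))%C.

Lemma total_half_plane F s : 2 <= Re s ->
  (forall i, (i < 6)%nat -> F i s = Cchamber_total p q r u v s i) ->
  total F s = RtoC 0.
Proof.
  intros Hs HF. unfold total.
  rewrite (csum_ext 6 _ (fun i =>
    RtoC ((-1) ^ chamber_sign p q r u v i) * Cchamber_total p q r u v s i)%C)
    by (intros i Hi; now rewrite HF).
  rewrite chamber_identity by easy. unfold I_sum. rewrite !csum_plus, termB2_sum.
  rewrite (csum_ext 8 _ _ (fun i Hi => termA_value s (S i) ltac:(lia))).
  rewrite (csum_ext 8 _ _ (fun i Hi => termB1_value s (S i) ltac:(lia))).
  rewrite !csum_scal_l. fold w. rewrite RtoC_opp.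
  rewrite (csum_ext 8 (fun i => csum (S (v / 2)) (fun k =>
        RtoC (2 * zeven k * coefB p q r u v (S i) (2 * k)) *
        ((/ rcpow 2 (w s k) + RtoC (2 ^ (2 * k) - 1) * (1 - / rcpow 2 (w s k)))
         * zeta (w s k)))%C)
    (fun i => csum (S (v / 2)) (fun k =>
        RtoC (2 * zeven k * coefB p q r u v (S i) (2 * k)) *
        (/ rcpow 2 (w s k) * zeta (w s k)))
      + csum (S (v / 2)) (fun k =>
        RtoC (2 * zeven k * coefB p q r u v (S i) (2 * k)) *
        (RtoC (2 ^ (2 * k) - 1) * (1 - / rcpow 2 (w s k)) * zeta (w s k))))%C).
  2:{ intros i _. rewrite <- csum_plus. apply csum_ext. intros k _. ring. }
  rewrite csum_plus. ring.
Qed.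

Lemma kmax_A j k : (1 <= j <= 8)%nat -> (k < S (pole_order p q r u j / 2))%nat ->
  (k <= kmax p q r u v)%nat.
Proof.
  intros Hj Hk. unfold kmax.
  do 9 (destruct j as [|j]; [try lia; cbn [pole_order] in Hk; lia|]). lia.
Qed.

Section Closure.
(** Instantiated twice: by [Cmer_at] at every parameter of the segment, and by [Can_at] at its
    endpoint. *)
Variable good : (R -> C) -> Prop.
Hypothesis good_ext : forall f g, (forall t, f t = g t) -> good f -> good g.
Hypothesis good_const : forall c, good (fun _ => c).
Hypothesis good_plus : forall f g, good f -> good g -> good (fun t => f t + g t)%C.
Hypothesis good_mult : forall f g, good f -> good g -> good (fun t => f t * g t)%C.
Variable l : R -> C.
Hypothesis good_zeta : forall k, (k <= kmax p q r u v)%nat -> good (fun t => zeta (w (l t) k)).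
Hypothesis good_rcpow : forall k, good (fun t => rcpow 2 (1 - w (l t) k)).

Lemma good_csum n (f : nat -> R -> C) :
  (forall i, (i < n)%nat -> good (f i)) -> good (fun t => csum n (fun i => f i t)).
Proof.
  induction n as [|n IH]; intros H; simpl; [apply good_const|].
  apply good_plus; [apply IH; intros; apply H; lia|apply H; lia].
Qed.

Lemma good_I_sum j : (1 <= j <= 8)%nat -> good (fun t => I_sum p q r u v (l t) j).
Proof.
  intros Hj. unfold I_sum. apply good_plus; [apply good_plus|].
  - apply (good_ext _ _ (fun t => eq_sym (termA_csum p q r u v zeta_cont (l t) j Hj))).
    apply (good_csum _ (fun k t => _ * zeta (weight p q r u v (l t) k))%C). intros k Hk.
    apply good_mult; [apply good_const|]. apply good_zeta. now apply (kmax_A j).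
  - apply (good_ext _ _ (fun t => eq_sym (termB1_csum p q r u v zeta_cont (l t) j))).
    apply (good_csum _ (fun k t => _ * (rcpow 2 (1 - weight p q r u v (l t) k)
       * zeta (weight p q r u v (l t) k)))%C). intros k Hk.
    apply good_mult; [apply good_const|]. apply good_mult; [apply good_rcpow|].
    apply good_zeta. unfold kmax. replace (v + 1)%nat with (S v) by lia.
    assert (X : (v / 2 <= S v / 2)%nat) by (apply Nat.Div0.div_le_mono; lia). lia.
  - apply (good_ext _ _ (fun t => eq_sym (termB2_csum p q r u v zeta_cont (l t) j))).
    apply (good_csum _ (fun k t => _ * ((2 - rcpow 2 (1 - weight p q r u v (l t) k))
       * zeta (weight p q r u v (l t) k)))%C). intros k Hk.
    apply good_mult; [apply good_const|]. apply good_mult.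
    + apply good_ext with (fun t => 2 + RtoC (-1) * rcpow 2 (1 - w (l t) k))%C.
      * intros t. replace (RtoC (-1)) with (- RtoC 1)%C by (rewrite <- RtoC_opp; f_equal; ring).
        unfold w. ring.
      * apply good_plus; [apply good_const|]. apply good_mult; [apply good_const|apply good_rcpow].
    + apply good_zeta. unfold kmax. replace (v + 1)%nat with (S v) by lia. lia.
Qed.

Lemma good_total F : (forall i, (i < 6)%nat -> good (fun t => F i (l t))) ->
  good (fun t => total F (l t)).
Proof.
  intros HF. unfold total. apply good_plus.
  - apply (good_csum 6 (fun i t => _ * F i (l t))%C). intros i Hi.
    apply good_mult; [apply good_const|now apply HF].
  - apply (good_csum 8 (fun i t => I_sum p q r u v (l t) (S i))). intros i Hi.
    apply good_I_sum. lia.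
Qed.
End Closure.

Lemma weight_line z0 d t k : w (line z0 d t) k = line (w z0 k) d t.
Proof. unfold w, weight, line. ring. Qed.

Lemma total_continued F f s :
  (forall i, (i < 6)%nat -> is_continuation (f i) (F i)) ->
  (forall i z, (i < 6)%nat -> 2 <= Re z -> f i z = Cchamber_total p q r u v z i) ->
  (forall i, (i < 6)%nat -> analytic_at (F i) s) ->
  (forall k, (k <= kmax p q r u v)%nat -> analytic_at zeta (w s k)) ->
  total F s = RtoC 0.
Proof.
  intros HF Hf An Az.
  (* The start lies at least 3 to the right of [s], even when [s] is already in the half-plane, so
     that the direction [d] is never 0 and has negative real part. *)
  set (z0 := RtoC (Rabs (Re s) + 3)). set (d := (s - z0)%C).
  assert (Rd : Re d <= -3).
  { change (Re s + - (Rabs (Re s) + 3) <= -3). assert (X := Rle_abs (Re s)). lra. }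
  assert (Hd : d <> RtoC 0) by (intros E; rewrite E in Rd; cbn in Rd; lra).
  assert (L1 : line z0 d 1 = s) by (unfold line, d; ring).
  assert (Lw : forall t k, (1 - w (line z0 d t) k)%C = line (1 - w z0 k) (- d) t).
  { intros t k. rewrite weight_line. unfold line. ring. }
  rewrite <- L1.
  apply (Cidentity_value (fun t => total F (line z0 d t)) 0 1); [lra| | |].
  - intros t _. apply (good_total (fun f => Cmer_at f t)).
    + intros f1 f2. apply Cmer_ext.
    + intros c. apply Cmer_const.
    + intros f1 f2. apply Cmer_plus.
    + intros f1 f2. apply Cmer_mult.
    + intros k _. apply (Cmer_ext _ _ _ (fun t => eq_sym (f_equal zeta (weight_line z0 d t k)))).
      now apply meromorphic_line; [|apply zeta_cont].
    + intros k. apply (Cmer_ext _ _ _ (fun t => eq_sym (f_equal (rcpow 2) (Lw t k)))).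
      apply Can_Cmer, Can_rcpow_line.
    + intros i Hi. apply meromorphic_line; [easy|]. now apply (HF i Hi).
  - apply (good_total (fun f => Can_at f 1)).
    + intros f1 f2. apply Can_ext.
    + intros c. apply Can_const.
    + intros f1 f2. apply Can_plus.
    + intros f1 f2. apply Can_mult.
    + intros k Hk. apply (Can_ext _ _ _ (fun t => eq_sym (f_equal zeta (weight_line z0 d t k)))).
      apply analytic_line. rewrite <- weight_line, L1. now apply Az.
    + intros k. apply (Can_ext _ _ _ (fun t => eq_sym (f_equal (rcpow 2) (Lw t k)))).
      apply Can_rcpow_line.
    + intros i Hi. apply analytic_line. rewrite L1. now apply An.
  (* The start has real part at least 3, and a step shorter than [/ - Re d] changes the real part by
     less than 1. *)
  - exists (/ - Re d). split; [apply Rinv_0_lt_compat; lra|]. intros x [_ Hx].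
    assert (X : 2 <= Re (line z0 d (0 + x))).
    { replace (Re (line z0 d (0 + x))) with (Rabs (Re s) + 3 + x * Re d)
        by (unfold line, z0, Re; cbn; ring).
      assert (Y : Rabs x * - Re d < 1).
      { apply Rmult_lt_compat_r with (r := - Re d) in Hx; [|lra].
        rewrite Rinv_l in Hx by lra. easy. }
      assert (Z := Rle_abs x). assert (Z' := Rabs_pos (Re s)). nra. }
    apply total_half_plane; [easy|]. intros i Hi.
    rewrite (proj2 (HF i Hi)) by lra. now apply Hf.
Qed.
End Total.

Lemma sgn_of_nat n : sgn (Z.of_nat n) = (-1) ^ n.
Proof. unfold sgn. now rewrite pow_powerRZ. Qed.

Close Scope R_scope.

Theorem theorem6p1 (p q r u v : nat)
  (hp : (1 <= p)%nat) (hq : (1 <= q)%nat) (hr : (1 <= r)%nat)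
  (hu : (1 <= u)%nat) (hv : (1 <= v)%nat) :
  let P := RtoC (INR p) in let Q := RtoC (INR q) in let R' := RtoC (INR r) in
  let U := RtoC (INR u) in let V := RtoC (INR v) in
  let f1 := fun s : C => zeta2_G2_series P s Q R' U V in
  let f2 := fun s : C => zeta2_G2_series P Q s R' V U in
  let f3 := fun s : C => zeta2_G2_series V Q R' s P U in
  let f4 := fun s : C => zeta2_G2_series V R' Q s U P in
  let f5 := fun s : C => zeta2_G2_series U R' s Q V P in
  let f6 := fun s : C => zeta2_G2_series U s R' Q P V in
  forall s : C,
    regular_at f1 s -> regular_at f2 s -> regular_at f3 s ->
    regular_at f4 s -> regular_at f5 s -> regular_at f6 s ->
    (forall k : nat, (k <= kmax p q r u v)%nat ->
       regular_at zeta_series (weight p q r u v s k)) ->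
    (continuation f1 s
     + sgn p * continuation f2 s
     + sgn (p + q) * continuation f3 s
     + sgn (p + q + v) * continuation f4 s
     + sgn (p + q + r + v) * continuation f5 s
     + sgn (p + q + r + u + v) * continuation f6 s
     + (I_sum p q r u v s 1 + I_sum p q r u v s 2 + I_sum p q r u v s 3
        + I_sum p q r u v s 4 + I_sum p q r u v s 5 + I_sum p q r u v s 6
        + I_sum p q r u v s 7 + I_sum p q r u v s 8))%C = RtoC 0.
Proof.
  intros P Q R' U V f1 f2 f3 f4 f5 f6 s [C1 A1] [C2 A2] [C3 A3] [C4 A4] [C5 A5] [C6 A6] Hz.
  pose (f := fun i => match i with
    | 0 => f1 | 1 => f2 | 2 => f3 | 3 => f4 | 4 => f5 | _ => f6 end%nat).
  assert (T : total p q r u v (fun i => continuation (f i)) s = RtoC 0).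
  { apply (total_continued p q r u v hp hq hr hu hv) with (f := f).
    (* Regularity at any weight contains the existence of the continuation of zeta, and the weight
       with [k = 0] is always present. *)
    - apply (Hz 0%nat). lia.
    - intros i _. do 5 (destruct i as [|i]; [assumption|]). assumption.
    - intros i z Hi Hre.
      destruct (zeta2_chambers p q r u v hp hq hr hu hv z Hre) as (E1 & E2 & E3 & E4 & E5 & E6).
      do 5 (destruct i as [|i]; [assumption|]).
      destruct i as [|i]; [assumption|]. lia.
    - intros i _. do 5 (destruct i as [|i]; [assumption|]). assumption.
    - intros k Hk. now apply Hz. }
  rewrite <- T. unfold total. cbn [csum]. unfold chamber_sign, f.
  rewrite <- !Nat2Z.inj_add, !sgn_of_nat. simpl ((-1) ^ 0)%R. ring.
Qed.
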